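(* Let $M$ be a smooth manifold, let $X_0,X_1,\dots,X_m\in\mathfrak X(M)$ be smooth vector fields, and consider the control system $\dot x(t)=X_0(x(t))+\sum_{i=1}^m u_i(t)X_i(x(t))$ on $M$. Let $\phi_{t,u}$ be its flow under the admissible control $u=(u_1,\dots,u_m)$. Then, for every fixed admissible control $u$ and every $x_0\in M$, $v_0\in T_{x_0}M$, the curve $$\Gamma(t):=\big(\phi_{t,u}(x_0),\,d\phi_{t,u}(x_0)\,v_0\big)\in TM$$ is an integral curve of the complete lifted control system, that is, $$\dot\Gamma(t)=\Big(X_0^c+\sum_{i=1}^m u_i(t)X_i^c\Big)(\Gamma(t)),\qquad \Gamma(0)=(x_0,v_0).$$
   Context: $\pi:TM\to M$ is the tangent bundle; a point of $TM$ is written $(x,v)$ with $v\in T_xM$, or simply $v$. For $f\in C^\infty(M)$, its complete lift is the function $f^c\in C^\infty(TM)$, $f^c(v)=df(v)$. The complete lift of $X\in\mathfrak X(M)$ is the unique vector field $X^c\in\mathfrak X(TM)$ with $X^c(f^c)=(Xf)^c$ for all $f\in C^\infty(M)$; in induced coordinates $(x^i,v^i)$, if $X=X^i\partial_{x^i}$ then $X^c=X^i(x)\frac{\partial}{\partial x^i}+v^j\frac{\partial X^i}{\partial x^j}(x)\frac{\partial}{\partial v^i}$. The complete lifted control system of the given system is the control system on $TM$: $\dot v(t)=X_0^c(v(t))+\sum_{i=1}^m u_i(t)X_i^c(v(t))$, with the same admissible controls. Admissible controls form a fixed class $\mathcal U$ of locally bounded measurable functions $u:\mathbb R\to U\subset\mathbb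 R^m$; solutions are absolutely continuous curves satisfying the differential equation for almost every $t$. $\phi_{t,u}(x)$ is the value at time $t$ of the solution with control $u$ starting at $x$ at time $0$; $d\phi_{t,u}(x)$ is the differential of $\phi_{t,u}$ at $x$. Statements about flows are understood for the times at which the solution in question is defined. *)

(* Defs.v *)
From HB Require Import structures.
From mathcomp Require Import all_boot all_order all_algebra.
From mathcomp Require Import all_classical all_reals all_analysis.
Set Implicit Arguments.
Unset Strict Implicit.
Unset Printing Implicit Defensive.
Import Order.TTheory GRing.Theory Num.Theory.
Import numFieldNormedType.Exports.
Local Open Scope classical_set_scope.
Local Open Scope ring_scope.

(* Meant for [D] open and [V], [W] finite-dimensional: the differential is then
   C^k iff all its evaluations at a fixed vector are. *)
Fixpoint Ck {R : realType} {V W : normedModType R} (k : nat) (D : set V)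
    (f : V -> W) : Prop :=
  match k with
  | 0%N => forall x, D x -> {for x, continuous f}
  | k'.+1 => (forall x, D x -> differentiable f x) /\
             (forall v, Ck k' D (fun x => 'd f x v))
  end.

Definition smooth_on {R : realType} {V W : normedModType R} (D : set V)
  (f : V -> W) : Prop := forall k, Ck k D f.

Section Ck_theory.
Context {R : realType}.
Implicit Types V W : normedModType R.

Lemma is_diff_near V W (f g df : V -> W) (x : V) :
  {near x, f =1 g} -> is_diff x f df -> is_diff x g df.
Proof.
move=> fg fdf.
pose h := g - f.
have hx : h x = 0 by rewrite /h !fctE (nbhs_singleton fg) subrr.
have ho : h \o shift x = cst (h x) + (0 : V -> W) +o_ 0 id.
  apply/eqaddoP => _/posnumP[e].
  have fg0 : \forall y \near 0, f (y + x) = g (y + x).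
    have : shift x @ 0 --> x.
      by rewrite -[X in _ --> X]add0r; apply: cvgD; [exact: cvg_id|exact: cvg_cst].
    by move=> /(_ _ fg).
  near=> y; rewrite !fctE hx /h !fctE /=.
  by rewrite (near fg0 y) // subrr addr0 subr0 normr0 mulr_ge0.
have h0 : 'd h x = 0 :> (V -> W).
  have := @diff_unique _ _ _ h (\0 : {linear V -> W}) x; apply => //.
  exact: cst_continuous.
have dh : is_diff x h 0.
  apply: DiffDef => //; apply/diff_locallyP; rewrite h0; split => //.
  exact: cst_continuous.
have -> : g = f + h by rewrite /h addrC subrK.
by rewrite -[df]addr0; exact: is_diffD.
Unshelve. all: by end_near. Qed.

Lemma open_near V (D : set V) x (P : V -> Prop) :
  open D -> D x -> (forall y, D y -> P y) -> \forall y \near x, P y.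
Proof.
by move=> oD Dx DP; apply: filterS (open_nbhs_nbhs (conj oD Dx)).
Qed.

Lemma eq_differentiable_on V W (D : set V) (f g : V -> W) x :
  open D -> D x -> (forall y, D y -> f y = g y) -> differentiable f x ->
  differentiable g x /\ 'd g x = 'd f x :> (V -> W).
Proof.
move=> oD Dx fg df.
have [] := is_diff_near (open_near oD Dx fg) (differentiableP df).
by [].
Qed.

Lemma eq_Ck V W k (D : set V) (f g : V -> W) : open D ->
  (forall y, D y -> f y = g y) -> Ck k D f -> Ck k D g.
Proof.
move=> oD; elim: k f g => [|k IH] f g fg /=.
  move=> cf x Dx; rewrite /prop_for /continuous_at -(fg x Dx).
  by apply: cvg_trans (cf x Dx); apply: near_eq_cvg; exact: open_near fg.
move=> [df ddf]; split => [x Dx|v].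
  by have [] := eq_differentiable_on oD Dx fg (df x Dx).
apply: IH (ddf v) => x Dx.
by have [_ ->] := eq_differentiable_on oD Dx fg (df x Dx).
Qed.

Lemma Ck_subset V W k (D D' : set V) (f : V -> W) :
  D' `<=` D -> Ck k D f -> Ck k D' f.
Proof.
move=> sD; elim: k f => [|k IH] f /=; first by move=> cf x /sD; exact: cf.
by move=> [df ddf]; split => [x /sD|v]; [exact: df|exact: IH].
Qed.

Lemma CkS V W k (D : set V) (f : V -> W) : Ck k.+1 D f -> Ck k D f.
Proof.
elim: k f => [|k IH] f.
  by move=> [df _] x Dx; apply: differentiable_continuous; exact: df.
by move=> [df ddf]; split => // v; apply: IH; exact: ddf.
Qed.

Lemma Ck_cst V W k (D : set V) (w : W) : Ck k D (fun=> w).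
Proof.
elim: k w => [|k IH] w /=; first by move=> x _; exact: cst_continuous.
split => [x _|v]; first exact: differentiable_cst.
by under [X in Ck _ _ X]eq_fun do rewrite diff_cst; exact: IH.
Qed.

Lemma Ck_add V W k (D : set V) (f g : V -> W) : open D ->
  Ck k D f -> Ck k D g -> Ck k D (fun x => f x + g x).
Proof.
move=> oD; elim: k f g => [|k IH] f g /=.
  by move=> cf cg x Dx; apply: cvgD; [exact: cf|exact: cg].
move=> [df ddf] [dg ddg]; split => [x Dx|v].
  by apply: differentiableD; [exact: df|exact: dg].
apply: eq_Ck (IH _ _ (ddf v) (ddg v)) => // x Dx.
have E : (fun y => f y + g y) = f + g by [].
have := diffD (df x Dx) (dg x Dx); rewrite -E => H.
exact (esym (congr1 (fun h : V -> W => h v) H)).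
Qed.

Lemma Ck_sum V W k (D : set V) n (f : 'I_n -> V -> W) : open D ->
  (forall i, Ck k D (f i)) -> Ck k D (fun x => \sum_(i < n) f i x).
Proof.
move=> oD; elim: n f => [|n IH] f cf.
  by under [X in Ck _ _ X]eq_fun do rewrite big_ord0; exact: Ck_cst.
under [X in Ck _ _ X]eq_fun do rewrite big_ord_recr /=.
by apply: Ck_add => //; apply: IH.
Qed.

Lemma Ck_mul V k (D : set V) (f g : V -> R) : open D ->
  Ck k D f -> Ck k D g -> Ck k D (fun x => f x * g x).
Proof.
move=> oD; elim: k f g => [|k IH] f g.
  by move=> cf cg x Dx; apply: cvgM; [exact: cf|exact: cg].
move=> cf cg; have [df ddf] := cf; have [dg ddg] := cg; split => [x Dx|v].
  by apply: differentiableM; [exact: df|exact: dg].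
have := Ck_add oD (IH _ _ (CkS cf) (ddg v)) (IH _ _ (CkS cg) (ddf v)).
apply: eq_Ck => // x Dx.
have E : (fun y => f y * g y) = f * g by [].
have := diffM (df x Dx) (dg x Dx); rewrite -E => H.
exact (esym (congr1 (fun h : V -> R => h v) H)).
Qed.

Lemma Ck_lin_comp V W W' k (D : set V) (f : V -> W) (L : {linear W -> W'}) :
  open D -> continuous L -> Ck k D f -> Ck k D (L \o f).
Proof.
move=> oD cL; elim: k f => [|k IH] f.
  by move=> cf x Dx; apply: continuous_comp; [exact: cf|exact: cL].
move=> [df ddf]; split => [x Dx|v].
  by apply: differentiable_comp; [exact: df|exact: linear_differentiable].
apply: eq_Ck (IH _ (ddf v)) => // x Dx.
have := congr1 (fun h => h v)
  (diff_comp (df x Dx) (linear_differentiable (f x) cL)).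
by move=> /= ->; rewrite diff_lin.
Qed.

Lemma Ck_comp_lin V V' W k (D : set V) (f : V -> W) (L : {linear V' -> V}) :
  open D -> continuous L -> Ck k D f -> Ck k (L @^-1` D) (f \o L).
Proof.
move=> oD cL; have oD' : open (L @^-1` D) by apply: open_comp => // x _; exact: cL.
elim: k f => [|k IH] f.
  by move=> cf x Dx; apply: continuous_comp; [exact: cL|exact: cf].
move=> [df ddf]; split => [x Dx|v].
  by apply: differentiable_comp; [exact: linear_differentiable|exact: df].
apply: eq_Ck (IH _ (ddf (L v))) => // x Dx.
have := congr1 (fun h => h v)
  (diff_comp (linear_differentiable x cL) (df _ Dx)).
by move=> /= ->; rewrite diff_lin.
Qed.

Let coord_lin n (j : 'I_n) (x : 'rV[R]_n) : R := x 0 j.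

Let coord_lin_is_linear n (j : 'I_n) : linear (@coord_lin n j).
Proof. by move=> a u v; rewrite /coord_lin !mxE. Qed.

HB.instance Definition _ n (j : 'I_n) :=
  GRing.isLinear.Build R 'rV[R]_n R *:%R (@coord_lin n j)
    (coord_lin_is_linear j).

Lemma Ck_coord V n k (D : set V) (f : V -> 'rV[R]_n) j : open D ->
  Ck k D f -> Ck k D (fun x => f x 0 j).
Proof.
move=> oD; apply: (@Ck_lin_comp _ _ _ _ _ _ (@coord_lin n j)) => //.
exact: coord_continuous.
Qed.

Lemma Ck_scalel V W k (D : set V) (f : V -> R) (w : W) : open D ->
  Ck k D f -> Ck k D (fun x => f x *: w).
Proof.
move=> oD.
have sx_lin : linear ( *:%R ^~ w : R -> _).
  by move=> u y z; rewrite scalerDl scalerA.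
pose sxlM := GRing.isLinear.Build _ _ _ _ _ sx_lin.
pose sxL : {linear _ -> _} := HB.pack ( *:%R ^~ w) sxlM.
apply: (@Ck_lin_comp _ _ _ _ _ _ sxL) => //.
exact: scalel_continuous.
Qed.

Lemma CkP V n k (D : set V) (f : V -> 'rV[R]_n) : open D ->
  (forall j, Ck k D (fun x => f x 0 j)) -> Ck k D f.
Proof.
move=> oD cf.
have -> : f = (fun x => \sum_(j < n) f x 0 j *: delta_mx 0 j).
  by apply/funext => x; exact: row_sum_delta.
by apply: Ck_sum => // j; exact: Ck_scalel.
Qed.

Lemma smooth_differentiable V W (D : set V) (f : V -> W) x :
  smooth_on D f -> D x -> differentiable f x.
Proof. by move=> /(_ 1%N)[df _]; exact: df. Qed.

End Ck_theory.

(* [cimg i] is the open image of the chart [i] and [cinv i] its inverse, whose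
   value outside [cimg i] is irrelevant. *)
Record manifold (R : realType) (n : nat) := Manifold {
  mpoint :> topologicalType;
  mhausdorff : hausdorff_space mpoint;
  msecond_countable : @second_countable mpoint;
  chart : Type;
  cdom : chart -> set mpoint;
  cimg : chart -> set 'rV[R]_n;
  coord : chart -> mpoint -> 'rV[R]_n;
  cinv : chart -> 'rV[R]_n -> mpoint;
  open_cdom : forall i, open (cdom i);
  open_cimg : forall i, open (cimg i);
  coord_cimg : forall i x, cdom i x -> cimg i (coord i x);
  cinv_cdom : forall i z, cimg i z -> cdom i (cinv i z);
  coordK : forall i x, cdom i x -> cinv i (coord i x) = x;
  cinvK : forall i z, cimg i z -> coord i (cinv i z) = z;
  coord_continuous_at : forall i x, cdom i x -> {for x, continuous (coord i)};
  cinv_continuous_at : forall i z, cimg i z -> {for z, continuous (cinv i)};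
  chart_cover : forall x, exists i, cdom i x;
  transition_smooth : forall i j,
    smooth_on (cimg i `&` cinv i @^-1` cdom j) (coord j \o cinv i)
}.

Section Tangent.
Context {R : realType} {n : nat} {M : manifold R n}.
Implicit Types (i j k : chart M) (x : M).

Definition chart_at x : chart M := projT1 (cid (chart_cover x)).

Lemma chart_at_cdom x : cdom (chart_at x) x.
Proof. exact: (projT2 (cid (chart_cover x))). Qed.

(* A tangent vector at [x] is given by its components in the chart
   [chart_at x] fixed once and for all; [tcoord] gives its components in any
   other chart around [x]. *)
Definition tangent (x : M) : normedModType R := 'rV[R]_n.

Definition transition i j : 'rV[R]_n -> 'rV[R]_n := coord j \o cinv i.

Definition tcoord i {x} (v : tangent x) : 'rV[R]_n :=
  'd (transition (chart_at x) i) (coord (chart_at x) x) v.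

Definition tangent_of_coord i x (w : 'rV[R]_n) : tangent x :=
  'd (transition i (chart_at x)) (coord i x) w.

Lemma open_overlap i j : open (cimg i `&` cinv i @^-1` cdom j).
Proof.
rewrite openE => z [iz jz]; apply: filterI.
  by apply: open_nbhs_nbhs; split => //; exact: open_cimg.
have : nbhs (cinv i z) (cdom j).
  by apply: open_nbhs_nbhs; split => //; exact: open_cdom.
exact: (cinv_continuous_at iz).
Qed.

Lemma transition_diff i j x : cdom i x -> cdom j x ->
  differentiable (transition i j) (coord i x).
Proof.
move=> ix jx; apply: (smooth_differentiable (@transition_smooth _ _ M i j)).
by split; [exact: coord_cimg|rewrite /= coordK].
Qed.

Lemma transition_cocycle i j k x v : cdom i x -> cdom j x -> cdom k x ->
  'd (transition j k) (coord j x) ('d (transition i j) (coord i x) v) =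
  'd (transition i k) (coord i x) v.
Proof.
move=> ix jx kx.
have jE : coord j x = transition i j (coord i x) by rewrite /transition /= coordK.
have dij := transition_diff ix jx.
have djk : differentiable (transition j k) (transition i j (coord i x)).
  by rewrite -jE; exact: transition_diff.
have H := diff_comp dij djk.
transitivity ('d (transition j k \o transition i j) (coord i x) v).
  by rewrite jE; exact (esym (congr1 (fun h : 'rV[R]_n -> 'rV[R]_n => h v) H)).
have oij := @open_overlap i j.
have ijx : (cimg i `&` cinv i @^-1` cdom j) (coord i x).
  by split; [exact: coord_cimg|rewrite /= coordK].
have ext y : (cimg i `&` cinv i @^-1` cdom j) y ->
    transition i k y = (transition j k \o transition i j) y.
  by move=> [iy jy]; rewrite /transition /= coordK.
have [_ E] := eq_differentiable_on oij ijx ext (transition_diff ix kx).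
exact (congr1 (fun h : 'rV[R]_n -> 'rV[R]_n => h v) E).
Qed.

Lemma transition_id i x v : cdom i x ->
  'd (transition i i) (coord i x) v = v.
Proof.
move=> ix.
have ext y : cimg i y -> id y = transition i i y.
  by move=> iy; rewrite /transition /= cinvK.
have did : differentiable (@id 'rV[R]_n) (coord i x) by exact: ex_diff.
have [_ E] := eq_differentiable_on (@open_cimg _ _ M i) (coord_cimg ix) ext did.
have /= -> := congr1 (fun h : 'rV[R]_n -> 'rV[R]_n => h v) E.
by rewrite diff_val.
Qed.

Lemma tcoordK i x (v : tangent x) : cdom i x ->
  tangent_of_coord i x (tcoord i v) = v.
Proof.
move=> ix; rewrite /tangent_of_coord /tcoord.
rewrite (transition_cocycle v (chart_at_cdom x) ix (chart_at_cdom x)).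
exact/transition_id/chart_at_cdom.
Qed.

Lemma tangent_of_coordK i x w : cdom i x ->
  tcoord i (tangent_of_coord i x w) = w.
Proof.
move=> ix; rewrite /tangent_of_coord /tcoord.
rewrite (transition_cocycle w ix (chart_at_cdom x) ix).
exact: transition_id.
Qed.

End Tangent.
Arguments tangent {R n} M x.

Definition smooth_fun {R : realType} {n} {M : manifold R n} (f : M -> R) :=
  forall i : chart M, smooth_on (cimg i) (f \o cinv i).

Definition dfun {R : realType} {n} {M : manifold R n} (f : M -> R) (x : M)
    (v : tangent M x) : R :=
  'd (f \o cinv (chart_at x)) (coord (chart_at x) x) v.

Definition mdifferentiable {R : realType} {n p} {M : manifold R n}
    {N : manifold R p} (F : M -> N) (x : M) : Prop :=
  {for x, continuous F} /\
  differentiable (coord (chart_at (F x)) \o F \o cinv (chart_at x))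
    (coord (chart_at x) x).

Definition mdiff {R : realType} {n p} {M : manifold R n} {N : manifold R p}
    (F : M -> N) (x : M) (v : tangent M x) : tangent N (F x) :=
  'd (coord (chart_at (F x)) \o F \o cinv (chart_at x))
    (coord (chart_at x) x) v.

Record tangent_point {R : realType} {n} (M : manifold R n) :=
  TPoint { tbase : M; tvec : tangent M tbase }.
Arguments TPoint {R n M} tbase tvec.
Arguments tbase {R n M} _.
Arguments tvec {R n M} _.

HB.instance Definition _ (R : realType) n (M : manifold R n) :=
  gen_eqMixin (tangent_point M).
HB.instance Definition _ (R : realType) n (M : manifold R n) :=
  gen_choiceMixin (tangent_point M).

Section TangentBundle.
Context {R : realType} {n : nat} {M : manifold R n}.
Implicit Types (i j k : chart M) (x : M) (p q : tangent_point M).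

Definition tb_cdom i : set (tangent_point M) := tbase @^-1` cdom i.
Definition tb_cimg i : set 'rV[R]_(n + n) := lsubmx @^-1` cimg i.
(* the induced coordinates (x^1, .., x^n, v^1, .., v^n) *)
Definition tb_coord i p : 'rV[R]_(n + n) :=
  row_mx (coord i (tbase p)) (tcoord i (tvec p)).
Definition tb_cinv i (z : 'rV[R]_(n + n)) : tangent_point M :=
  let x := cinv i (lsubmx z) in TPoint x (tangent_of_coord i x (rsubmx z)).

Lemma open_tb_cimg i : open (tb_cimg i).
Proof.
apply: open_comp; last exact: open_cimg.
by move=> z _; exact: continuous_lsubmx.
Qed.

Lemma tb_coord_cimg i p : tb_cdom i p -> tb_cimg i (tb_coord i p).
Proof. by move=> ip; rewrite /tb_cimg /= row_mxKl; exact: coord_cimg. Qed.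

Lemma tb_cinv_cdom i z : tb_cimg i z -> tb_cdom i (tb_cinv i z).
Proof. exact: cinv_cdom. Qed.

Lemma tb_coordK i p : tb_cdom i p -> tb_cinv i (tb_coord i p) = p.
Proof.
case: p => x v ix; rewrite /tb_cinv /tb_coord /= row_mxKl row_mxKr.
by rewrite coordK // tcoordK.
Qed.

Lemma tb_cinvK i z : tb_cimg i z -> tb_coord i (tb_cinv i z) = z.
Proof.
move=> iz; rewrite /tb_cinv /tb_coord /= tangent_of_coordK ?cinvK //.
  exact: hsubmxK.
exact: cinv_cdom.
Qed.

Let tb_overlap i j := tb_cimg i `&` tb_cinv i @^-1` tb_cdom j.

Let tb_overlapE i j :
  tb_overlap i j = lsubmx @^-1` (cimg i `&` cinv i @^-1` cdom j).
Proof. by []. Qed.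

Lemma open_tb_overlap i j : open (tb_cimg i `&` tb_cinv i @^-1` tb_cdom j).
Proof.
rewrite -/(tb_overlap i j) tb_overlapE; apply: open_comp.
  by move=> z _; exact: continuous_lsubmx.
exact: open_overlap.
Qed.

Lemma tb_transitionE i j z : tb_cimg i z -> tb_cdom j (tb_cinv i z) ->
  tb_coord j (tb_cinv i z) =
  row_mx (transition i j (lsubmx z))
    ('d (transition i j) (lsubmx z) (rsubmx z)).
Proof.
move=> iz jz; rewrite /tb_coord /=; congr row_mx.
rewrite /tcoord /tangent_of_coord.
set x := cinv i (lsubmx z).
have ix : cdom i x by exact: cinv_cdom.
apply: etrans (transition_cocycle (rsubmx z) ix (chart_at_cdom x) jz) _.
by rewrite /x (cinvK iz).
Qed.

Lemma tb_transition_smooth i j :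
  smooth_on (tb_cimg i `&` tb_cinv i @^-1` tb_cdom j) (tb_coord j \o tb_cinv i).
Proof.
move=> k; have oT := @open_tb_overlap i j; have oij := @open_overlap _ _ M i j.
apply: (@eq_Ck _ _ _ _ _ (fun z => row_mx (transition i j (lsubmx z))
    ('d (transition i j) (lsubmx z) (rsubmx z)))) => //.
  by move=> z [iz jz]; rewrite /= tb_transitionE.
have lcont : continuous (lsubmx : 'rV[R]_(n + n) -> 'rV[R]_n).
  exact: continuous_lsubmx.
have sij := @transition_smooth _ _ M i j.
apply: CkP => // l; case: (split_ordP l) => a ->.
  under [X in Ck _ _ X]eq_fun do rewrite row_mxEl.
  apply: Ck_coord => //.
  by have := Ck_comp_lin oij lcont (sij k).
have E (z : 'rV[R]_(n + n)) :
    row_mx (transition i j (lsubmx z))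
      ('d (transition i j) (lsubmx z) (rsubmx z)) 0 (rshift n a) =
    \sum_(b < n) z 0 (rshift n b) *
      'd (transition i j) (lsubmx z) (delta_mx 0 b) 0 a.
  rewrite row_mxEr (row_sum_delta (rsubmx z)) linear_sum summxE.
  by apply: eq_bigr => b _; rewrite linearZ /= !mxE.
rewrite (funext E); apply: Ck_sum => // b; apply: Ck_mul => //.
  apply: (@Ck_coord _ _ _ _ _ id) => //.
  elim: {b E} k => [z _|k IH]; first exact: cvg_id.
  split => [z _|v]; first exact: ex_diff.
  by apply: eq_Ck (Ck_cst _ _ v) => // z _; rewrite diff_val.
apply: Ck_coord => //.
have [_ ds] := sij k.+1.
by have := Ck_comp_lin oij lcont (ds (delta_mx 0 b)).
Qed.

(* the topology making all the maps [tb_coord i] homeomorphisms between open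
   sets *)
Definition tb_open : set_system (tangent_point M) :=
  [set W | forall i, open (tb_cimg i `&` tb_cinv i @^-1` W)].

Lemma tb_openT : tb_open setT.
Proof. by move=> i; rewrite preimage_setT setIT; exact: open_tb_cimg. Qed.

Lemma tb_openI : setI_closed tb_open.
Proof.
by move=> A B oA oB i; rewrite preimage_setI setIIr; exact: openI.
Qed.

Lemma tb_open_bigU (I : Type) (f : I -> set (tangent_point M)) :
  (forall l, tb_open (f l)) -> tb_open (\bigcup_l f l).
Proof.
move=> fo i; rewrite preimage_bigcup setI_bigcupr.
by apply: bigcup_open => l _; exact: fo.
Qed.

HB.instance Definition _ := @isOpenTopological.Build (tangent_point M)
  tb_open tb_openT tb_openI tb_open_bigU.

Lemma tb_openE (W : set (tangent_point M)) : open W = tb_open W.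
Proof. by []. Qed.

Lemma open_tbase (A : set M) : open A -> open (tbase @^-1` A).
Proof.
move=> oA; rewrite tb_openE => i.
have -> : tb_cimg i `&` tb_cinv i @^-1` (tbase @^-1` A) =
    lsubmx @^-1` (cimg i `&` cinv i @^-1` A) by [].
apply: open_comp; first by move=> z _; exact: continuous_lsubmx.
rewrite openE => z [iz Az]; apply: filterI.
  by apply: open_nbhs_nbhs; split => //; exact: open_cimg.
have : nbhs (cinv i z) A by exact: open_nbhs_nbhs.
exact: (cinv_continuous_at iz).
Qed.

Lemma tbase_continuous : continuous (tbase : tangent_point M -> M).
Proof. by apply/continuousP => A; exact: open_tbase. Qed.

Lemma open_tb_cdom i : open (tb_cdom i).
Proof. exact/open_tbase/open_cdom. Qed.

Lemma open_tb_coord i (Z : set 'rV[R]_(n + n)) : open Z ->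
  open (tb_cdom i `&` tb_coord i @^-1` Z).
Proof.
move=> oZ; rewrite tb_openE => j; rewrite openE => z [jz [iz Zz]].
have oji := @open_tb_overlap j i.
have zji : (tb_cimg j `&` tb_cinv j @^-1` tb_cdom i) z by [].
have := @tb_transition_smooth j i 0%N z zji Z (open_nbhs_nbhs (conj oZ Zz)).
rewrite /= => nZ.
apply: filterS (filterI (open_nbhs_nbhs (conj oji zji)) nZ).
by move=> y /= [[jy iy] Zy].
Qed.

Lemma tb_coord_continuous i p : tb_cdom i p ->
  {for p, continuous (tb_coord i)}.
Proof.
move=> ip A; rewrite nbhsE => -[Z [oZ Zp] ZA].
apply: filterS (open_nbhs_nbhs (conj (@open_tb_coord i Z oZ) (conj ip Zp))).
by move=> q [_ /ZA].
Qed.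

Lemma tb_cinv_continuous i z : tb_cimg i z ->
  {for z, continuous (tb_cinv i)}.
Proof.
move=> iz A; rewrite nbhsE => -[W [oW Wz] WA].
have oi : open (tb_cimg i `&` tb_cinv i @^-1` W) by rewrite tb_openE in oW.
apply: filterS (open_nbhs_nbhs (conj oi (conj iz Wz))).
by move=> y [_ /WA].
Qed.

Lemma cluster_continuous (T U : topologicalType) (f : T -> U) (p q : T) :
  {for p, continuous f} -> {for q, continuous f} ->
  cluster (nbhs p) q -> cluster (nbhs (f p)) (f q).
Proof.
move=> cp cq pq A B /cp pA /cq qB.
by have [t [? ?]] := pq _ _ pA qB; exists (f t).
Qed.

Lemma tb_hausdorff : hausdorff_space (tangent_point M).
Proof.
move=> p q pq.
have bpq : tbase p = tbase q.
  apply: (@mhausdorff _ _ M); apply: cluster_continuous pq;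
  exact: tbase_continuous.
pose i := chart_at (tbase p).
have ip : tb_cdom i p by exact: chart_at_cdom.
have iq : tb_cdom i q by rewrite /tb_cdom /= -bpq; exact: chart_at_cdom.
rewrite -(tb_coordK ip) -(tb_coordK iq); congr tb_cinv.
by apply: norm_hausdorff; apply: cluster_continuous pq;
  exact: tb_coord_continuous.
Qed.

Lemma tb_second_countable : @second_countable (tangent_point M).
Proof.
have [B cB [oB bB]] := @msecond_countable _ _ M.
have /choice[c cP] : forall A : set M, exists o : option (chart M),
    if o is Some i then A `<=` cdom i else ~ exists i, A `<=` cdom i.
  move=> A; have [[i Ai]|nA] := pselect (exists i, A `<=` cdom i).
    by exists (Some i).
  by exists None.
pose bl (z : 'rV[rat]_(n + n) * nat) : set 'rV[R]_(n + n) :=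
  ball (map_mx (ratr : rat -> R) z.1) (z.2.+1%:R^-1).
pose W (t : set M * ('rV[rat]_(n + n) * nat)) : set (tangent_point M) :=
  if c t.1 is Some i then tb_cdom i `&` tb_coord i @^-1` bl t.2 else set0.
exists (W @` (B `*` setT)).
  apply: (@sub_countable _ _ _ (B `*` setT)); first exact: card_image_le.
  by apply: countableX => //; exact: countableP.
split.
  move=> _ [t _ <-]; rewrite /W; case: (c t.1) => [i|]; last exact: open0.
  by apply: open_tb_coord; exact: ball_open.
move=> p A Ap.
have [i [b [Bb bp ip cbi]]] : exists i b,
    [/\ B b, b (tbase p), tb_cdom i p & c b = Some i].
  have [b [Bb bp] sb] := bB (tbase p) _
    (open_nbhs_nbhs (conj (open_cdom (chart_at (tbase p))) (chart_at_cdom _))).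
  have := cP b; case cb : (c b) => [i|] hb; last by case: hb; eexists; exact: sb.
  by exists i, b; split => //; exact: hb.
have iz := tb_coord_cimg ip; set z := tb_coord i p in iz *.
have : nbhs z (tb_cinv i @^-1` A).
  by apply: (tb_cinv_continuous iz); rewrite /z tb_coordK.
move=> /nbhs_ballP[e /= e0 he].
have [N Ne] : exists N : nat, N.+1%:R^-1 < e / 2.
  have e20 : 0 < e / 2 by rewrite divr_gt0.
  exists (Num.truncn (e / 2)^-1); rewrite invf_plt ?posrE //.
  exact: truncnS_gt.
have /choice[q hq] : forall l, exists r : rat,
    ball (z 0 l) (N.+1%:R^-1 : R) (ratr r).
  move=> l; have : z 0 l - N.+1%:R^-1 < z 0 l + N.+1%:R^-1 :> R.
    by rewrite ltrBlDr -addrA ltrDl addr_gt0.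
  move=> /rat_in_itvoo[r]; rewrite in_itv /= => hr; exists r.
  by rewrite /ball /= ltr_distlC.
have qz : bl (\row_l q l, N) z.
  apply: ball_sym; split => // a l.
  rewrite (ord1 a); have -> // : map_mx (ratr : rat -> R) (\row_l q l) 0 l = ratr (q l).
  by rewrite mxE mxE.
exists (W (b, (\row_l q l, N))).
  split; first by exists (b, (\row_l q l, N)).
  by rewrite /W /= cbi; split.
rewrite /W /= cbi => p' [ip' qz']; rewrite -(tb_coordK ip'); apply: he.
apply: ball_splitr (le_ball (ltW Ne) qz) (le_ball (ltW Ne) qz').
Qed.

End TangentBundle.

Definition tangent_bundle {R : realType} {n} (M : manifold R n) :
    manifold R (n + n) :=
  Manifold (@tb_hausdorff R n M) (@tb_second_countable R n M)
    (@open_tb_cdom R n M) (@open_tb_cimg R n M)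
    (@tb_coord_cimg R n M) (@tb_cinv_cdom R n M)
    (@tb_coordK R n M) (@tb_cinvK R n M)
    (@tb_coord_continuous R n M) (@tb_cinv_continuous R n M)
    (fun p => chart_cover (tbase p)) (@tb_transition_smooth R n M).

Record vector_field {R : realType} {n} (M : manifold R n) := VectorField {
  vf_val :> forall x : M, tangent M x;
  vf_smooth : forall i : chart M,
    smooth_on (cimg i) (fun z => tcoord i (vf_val (cinv i z)))
}.

HB.instance Definition _ (R : realType) n (M : manifold R n) :=
  gen_eqMixin (vector_field M).
HB.instance Definition _ (R : realType) n (M : manifold R n) :=
  gen_choiceMixin (vector_field M).

Lemma vf0_smooth {R : realType} {n} (M : manifold R n) (i : chart M) :
  smooth_on (cimg i) (fun z => tcoord i (0 : tangent M (cinv i z))).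
Proof.
move=> k; apply: eq_Ck (Ck_cst k (cimg i) 0) => [|z _].
  exact: open_cimg.
by rewrite /tcoord linear0.
Qed.

Definition vf0 {R : realType} {n} (M : manifold R n) : vector_field M :=
  @VectorField R n M (fun=> 0) (@vf0_smooth R n M).

Definition vf_apply {R : realType} {n} {M : manifold R n} (X : vector_field M)
    (f : M -> R) : M -> R := fun x => dfun f (X x).

Definition complete_lift_fun {R : realType} {n} {M : manifold R n}
    (f : M -> R) : tangent_bundle M -> R := fun p => dfun f (tvec p).

Definition is_complete_lift {R : realType} {n} {M : manifold R n}
    (X : vector_field M) (Xc : vector_field (tangent_bundle M)) : Prop :=
  forall f : M -> R, smooth_fun f ->
    vf_apply Xc (complete_lift_fun f) = complete_lift_fun (vf_apply X f).

Definition complete_lift {R : realType} {n} {M : manifold R n}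
    (X : vector_field M) : vector_field (tangent_bundle M) :=
  xget (vf0 (tangent_bundle M)) [set Xc | is_complete_lift X Xc].

(* measurability with respect to the sigma-algebra of Lebesgue measurable
   sets, i.e., the domain of [completed_lebesgue_measure] *)
Definition lebesgue_measurable_fun {R : realType} (f : R -> R) : Prop :=
  @measurable_fun _ _ (caratheodory_type (wlength (@idfun R))^*%mu) R setT f.

Definition admissible_control {R : realType} {m} (U : set 'rV[R]_m)
    (u : R -> 'rV[R]_m) : Prop :=
  [/\ forall i, lebesgue_measurable_fun (fun t => u t 0 i),
      forall a b : R, exists K : R, forall t, a <= t <= b -> `|u t| <= K &
      forall t, U (u t)].

Definition abs_continuous_on {R : realType} {n} (a b : R)
    (g : R -> 'rV[R]_n) : Prop :=
  forall e : R, 0 < e -> exists2 d : R, 0 < d &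
    forall (N : nat) (s t : 'I_N -> R),
      (forall l, [/\ a <= s l, s l <= t l & t l <= b]) ->
      trivIset setT (fun l => `]s l, t l[%classic) ->
      \sum_(l < N) (t l - s l) < d -> \sum_(l < N) `|g (t l) - g (s l)| < e.

Definition abs_continuous_curve {R : realType} {n} {N : manifold R n}
    (J : set R) (gamma : R -> N) : Prop :=
  (forall t, J t -> {for t, continuous gamma}) /\
  (forall (i : chart N) a b, `[a, b]%classic `<=` J ->
     (forall t, a <= t <= b -> cdom i (gamma t)) ->
     abs_continuous_on a b (coord i \o gamma)).

(* the velocity vector of [gamma] at [t] exists and equals [v] *)
Definition has_velocity {R : realType} {n} {N : manifold R n}
    (gamma : R -> N) (t : R) (v : tangent N (gamma t)) : Prop :=
  is_derive t 1 (coord (chart_at (gamma t)) \o gamma) v.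

Definition control_field {R : realType} {n m} {N : manifold R n}
    (X0 : vector_field N) (X : 'I_m -> vector_field N) (w : 'rV[R]_m)
    (x : N) : tangent N x :=
  X0 x + \sum_(i < m) w 0 i *: X i x.

Definition solution {R : realType} {n m} {N : manifold R n}
    (X0 : vector_field N) (X : 'I_m -> vector_field N) (u : R -> 'rV[R]_m)
    (J : set R) (gamma : R -> N) : Prop :=
  [/\ open J, is_interval J, J 0, abs_continuous_curve J gamma &
      {ae lebesgue_measure, forall t : R, J t ->
         has_velocity (control_field X0 X (u t) (gamma t))}].

(* the times at which the solution starting at [x] at time 0 is defined *)
Definition flow_dom {R : realType} {n m} {N : manifold R n}
    (X0 : vector_field N) (X : 'I_m -> vector_field N) (u : R -> 'rV[R]_m)
    (x : N) : set R :=
  [set t | exists J gamma, [/\ solution X0 X u J gamma, gamma 0 = x & J t]].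

(* The value is irrelevant for [t] outside [flow_dom X0 X u x]. *)
Definition flow {R : realType} {n m} {N : manifold R n}
    (X0 : vector_field N) (X : 'I_m -> vector_field N) (u : R -> 'rV[R]_m)
    (t : R) (x : N) : N :=
  xget x [set y | exists J gamma,
    [/\ solution X0 X u J gamma, gamma 0 = x, J t & gamma t = y]].

(* Main.v *)
(* In a chart the system reads x' = sum_j w_j(t) f_j(x), with w measurable and
   locally bounded.  Picard iteration yields, for initial times and points near
   given ones, solutions on a common time interval, and a Gronwall inequality
   makes them unique.  By testing against the coordinate functions and their
   pairwise products, cut off by a bump function, the complete lift of X must
   be the field (x, v) |-> (F x, dF_x v), where F represents X; symmetry of
   second derivatives makes these local fields agree under changes of charts.
   Hence the local existence theorem, applied to the lifted system, produces
   the solutions of the variational equation along a given solution, and a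
   second-order Taylor estimate together with Gronwall identifies them with the
   derivative of the local flow in its initial point.  Uniqueness and gluing
   express the flow near a time c through its value at a time s near c followed
   by a local flow; continuous induction on the interval of definition then
   carries differentiability from time 0 to all times, and shows that Gamma is
   locally the lifted local flow applied to a fixed tangent vector. *)
From HB Require Import structures.
From mathcomp Require Import all_boot all_order all_algebra.
From mathcomp Require Import all_classical all_reals all_analysis.
From mathcomp Require Import measurable_realfun ring lra.
Require Import Defs.
Set Implicit Arguments.
Unset Strict Implicit.
Unset Printing Implicit Defensive.
Import Order.TTheory GRing.Theory Num.Theory.
Import numFieldNormedType.Exports.
Local Open Scope classical_set_scope.
Local Open Scope ring_scope.

(** * Absolute continuity and almost-everywhere statements *)

(** Solutions are merely absolutely continuous and satisfy the equation almost everywhere, so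
    pointwise mean value arguments do not apply to them. Their place is taken by [ac_bound]: an
    absolutely continuous curve whose derivative exists and is bounded by [K] almost everywhere
    moves at speed at most [K]. The Lipschitz regularity of solutions, the Picard contraction and
    the Gronwall estimate all rest on it. Every estimate is made on an interval where Lipschitz
    constant times length is at most 1/2; longer times are reached only by continuous induction.
    Both [complete_lift] and [flow] are choices made by [xget], so each has to be pinned down by an
    existence and a uniqueness statement. Since [flow] takes a default value outside its domain,
    differentiability in the initial point must be carried along together with the fact that
    neighbouring initial points still have a solution at that time. The drift enters as one more
    field with constant weight 1, which is why the system and, with the same weights, its lift both
    take the form [affine] in charts. *)

Section RealInduction.
Context {R : realType}.

(** Continuous induction. At the supremum [c] of the points reached, some reached [s] lies within
    [r] below [c], and the step passes from [s] over [c] to a point beyond it unless [c = b]. *)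
Lemma real_ind (P : R -> Prop) (a b : R) : a <= b -> P a ->
  (forall c : R, a <= c <= b -> exists2 r : R, 0 < r & forall s t : R,
     a <= s -> s <= c -> c <= t -> t <= b -> c - r < s -> t < c + r ->
     P s -> P t) ->
  P b.
Proof.
move=> ab Pa step.
pose S := [set t | a <= t <= b /\ P t].
have Sa : S a by split => //; rewrite lexx ab.
have hS : has_sup S by split; [exists a|exists b => t [/andP[_ ->]]].
have ac : a <= sup S by apply: ub_le_sup => //; case: hS.
have cb : sup S <= b by apply: ge_sup => [|t [/andP[]]]; first by exists a.
have [|r r0 hr] := step (sup S); first by rewrite ac cb.
have [s [/andP[as_ sb] Ps] cs] := sup_adherent r0 hS.
have sc : s <= sup S by apply: ub_le_sup; [case: hS|split => //; rewrite as_ sb].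
have [cb'|] := leP b (sup S).
  have e : sup S = b by apply/eqP; rewrite eq_le cb cb'.
  by apply: (hr s b) => //; rewrite e ltrDl.
move=> cb'; pose t := Num.min b (sup S + r / 2).
have ct : sup S < t by rewrite lt_min cb' ltrDl divr_gt0.
have Pt : P t.
  apply: (hr s t) => //; first exact: ltW.
    by rewrite ge_min lexx.
  by rewrite gt_min; apply/orP; right; lra.
suff : t <= sup S by rewrite leNgt ct.
apply: ub_le_sup; first by case: hS.
split => //; rewrite (le_trans ac (ltW ct)) /=.
by rewrite ge_min lexx.
Qed.

(** The form without quotient is the one that estimates can use directly: it includes [s = t] and
    adds up under the triangle inequality. *)
Lemma is_derive1P (V : normedModType R) (f : R -> V) (t : R) (d : V) :
  is_derive t 1 f d <->
  forall e : R, 0 < e -> exists2 r : R, 0 < r & forall s : R, `|s - t| < r ->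
    `|f s - f t - (s - t) *: d| <= e * `|s - t|.
Proof.
have key (h : R) (e : R) : h != 0 ->
    (`|d - h^-1 *: (f (h *: 1 + t) - f t)| <= e) =
    (`|f (h *: 1 + t) - f t - h *: d| <= e * `|h|).
  move=> h0; rewrite -[X in _ = (X <= _)]normrN opprB.
  have -> : h *: d - (f (h *: 1 + t) - f t) =
      h *: (d - h^-1 *: (f (h *: 1 + t) - f t)).
    by rewrite scalerBr scalerA divff // scale1r.
  by rewrite normrZ mulrC ler_pM2r // normr_gt0.
split.
  move=> [df ded] e e0.
  have : (fun h => h^-1 *: ((f \o shift t) (h *: 1) - f t)) @ 0^' --> d.
    by rewrite -ded; exact: df.
  move=> /cvgrPdist_le /(_ e e0) /= [r /= r0 hr]; exists r => // s st.
  have [->|st0] := eqVneq s t; first by rewrite !subrr scale0r subr0 !normr0 mulr0.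
  have := hr (s - t); rewrite /= sub0r normrN st key ?subr_eq0 // => /(_ isT st0).
  by rewrite [_ *: 1]mulr1 subrK.
move=> H.
have : (fun h => h^-1 *: ((f \o shift t) (h *: 1) - f t)) @ 0^' --> d.
  apply/cvgrPdist_le => /= e e0; have [r r0 hr] := H e e0.
  exists r => //= h; rewrite /= sub0r normrN => hh h0.
  rewrite key //; have := hr (h + t); rewrite addrK => /(_ hh).
  by rewrite [_ *: 1]mulr1.
move=> hd; split; first by apply/cvg_ex; exists d.
by apply/cvg_lim => //.
Qed.

Lemma nbhs_normedP (V : normedModType R) (x : V) (P : set V) :
  nbhs x P <-> exists2 r : R, 0 < r & forall y, `|y - x| < r -> P y.
Proof.
split; first by move=> /nbhs_ballP[r /= r0 hr]; exists r => // y yx;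
  apply: hr; rewrite -ball_normE /= distrC.
move=> [r r0 hr]; apply/nbhs_ballP; exists r => // y.
by rewrite -ball_normE /= distrC; exact: hr.
Qed.

Lemma cont_normP (V W : normedModType R) (f : V -> W) (x : V) :
  {for x, continuous f} <-> forall e : R, 0 < e -> exists2 r : R, 0 < r &
    forall y, `|y - x| < r -> `|f y - f x| < e.
Proof.
split; first by move=> /cvgrPdist_lt H e /H /nbhs_normedP[r r0 hr]; exists r => // y;
  rewrite (distrC (f y)); exact: hr.
move=> H; apply/cvgrPdist_lt => e /H[r r0 hr]; apply/nbhs_normedP.
by exists r => // y; rewrite (distrC (f x)); exact: hr.
Qed.

Lemma diff_near (V W : normedModType R) (f : V -> W) (x : V) :
  differentiable f x ->
  forall e : R, 0 < e -> exists2 r : R, 0 < r & forall y, `|y - x| < r ->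
    `|f y - f x - 'd f x (y - x)| <= e * `|y - x|.
Proof.
move=> /diff_locallyP[_ /eqaddoP H] e e0.
have /nbhs_normedP[r r0 hr] := H e e0; exists r => // y yx.
have := hr (y - x); rewrite subr0 => /(_ yx).
by rewrite !fctE /= subrK opprD addrA.
Qed.

Lemma diff_intro (V W : normedModType R) (f : V -> W) (x : V)
    (L : {linear V -> W}) : continuous L ->
  (forall e : R, 0 < e -> exists2 r : R, 0 < r & forall y, `|y - x| < r ->
    `|f y - f x - L (y - x)| <= e * `|y - x|) ->
  differentiable f x /\ 'd f x = L :> (V -> W).
Proof.
move=> cL H.
have E : f \o shift x = cst (f x) + L +o_ 0 id.
  apply/eqaddoP => e e0; have [r r0 hr] := H e e0.
  apply/nbhs_normedP; exists r => // y; rewrite subr0 => yr.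
  by have := hr (y + x); rewrite addrK !fctE /= opprD addrA; apply.
have dL := diff_unique cL E; split => //.
by apply/diff_locallyP; rewrite dL.
Qed.

Lemma is_derive_near (V : normedModType R) (f g : R -> V) (t r : R) (d : V) :
  0 < r -> (forall s, `|s - t| < r -> f s = g s) ->
  is_derive t 1 f d -> is_derive t 1 g d.
Proof.
move=> r0 fg; apply: near_eq_is_derive.
by exists r => // s /= ; rewrite distrC => /fg.
Qed.

Lemma negligible_set1 (a : R) : lebesgue_measure.-negligible [set a].
Proof. by apply/negligibleP => //; exact: lebesgue_measure_set1. Qed.

Lemma ae_imp (P Q : R -> Prop) : (forall t, P t -> Q t) ->
  {ae lebesgue_measure, forall t : R, P t} ->
  {ae lebesgue_measure, forall t : R, Q t}.
Proof. by move=> PQ; apply: negligibleS => t /= nQ Pt; apply/nQ/PQ. Qed.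

Lemma ae_and (P Q : R -> Prop) :
  {ae lebesgue_measure, forall t : R, P t} ->
  {ae lebesgue_measure, forall t : R, Q t} ->
  {ae lebesgue_measure, forall t : R, P t /\ Q t}.
Proof.
move=> hP hQ; apply: negligibleS (negligibleU hP hQ) => t /= /not_andP.
by case; [left|right].
Qed.

Lemma ae_fin (I : finType) (P : I -> R -> Prop) :
  (forall i, {ae lebesgue_measure, forall t : R, P i t}) ->
  {ae lebesgue_measure, forall t : R, forall i, P i t}.
Proof.
move=> hP; apply: negligibleS (_ : lebesgue_measure.-negligible
    (\big[setU/set0]_(i <- enum I) ~` [set t | P i t])).
  move=> t /= /existsNP[i nPi]; rewrite -bigcup_seq.
  by exists i => //=; rewrite mem_enum.
elim: (enum I) => [|i s IH]; first by rewrite big_nil; exact: negligible_set0.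
by rewrite big_cons; apply: negligibleU => //; exact: hP.
Qed.

Lemma negligible_open (N : set R) (d : R) :
  lebesgue_measure.-negligible N -> 0 < d ->
  exists O : set R, [/\ open O, N `<=` O & (lebesgue_measure O < d%:E)%E].
Proof.
move=> [A [mA A0 NA]] d0.
have [|O [oO AO hO]] := @lebesgue_regularity_outer R A d mA _ d0.
  by have /= -> := A0.
exists O; split => //; first exact: subset_trans AO.
have mO : measurable (O : set (measurableTypeR R)).
  by rewrite /measurable /=; apply: open_measurable.
have -> : O = A `|` (O `\` A) by rewrite setDUK.
apply: le_lt_trans hO; apply: le_trans (measureU2 _ _ _) _ => //.
  exact: measurableD.
by have /= -> := A0; rewrite add0e.
Qed.

Lemma itv_ball (c e r s : R) : c - e <= s <= c + e -> e < r -> `|s - c| < r.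
Proof. by rewrite -ler_distl; exact: le_lt_trans. Qed.

Lemma ball_itvW (c e s : R) : `|s - c| < e -> c - e <= s <= c + e.
Proof. by move=> /ltW; rewrite ler_distl. Qed.

Lemma half_lt (r : R) : 0 < r -> r / 2 < r.
Proof. by move=> r0; rewrite ltr_pdivrMr // ltr_pMr // ltr1n. Qed.

End RealInduction.

Section AbsolutelyContinuous.
Context {R : realType} {n : nat}.

Lemma disjoint_length (O : set R) (N : nat) (s t : 'I_N -> R) :
  open O -> (forall l, s l <= t l) -> (forall l, `]s l, t l[%classic `<=` O) ->
  trivIset setT (fun l => `]s l, t l[%classic) ->
  ((\sum_(l < N) (t l - s l))%:E <= lebesgue_measure O)%E.
Proof.
move=> oO st sO tr.
have mI l : measurable (`]s l, t l[%classic : set (measurableTypeR R)).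
  exact: measurable_itv.
have := @measure_bigsetU_ord _ _ _ (@lebesgue_measure R) N xpredT
  (fun l => `]s l, t l[%classic) mI tr.
move=> E; apply: (@le_trans _ _ (lebesgue_measure
    (\big[setU/set0]_(i < N) `]s i, t i[%classic))).
  rewrite E -sumEFin; apply: lee_sum => l _.
  have := lebesgue_measure_itv (`]s l, t l[ : interval R); rewrite /= lte_fin.
  by move=> ->; case: ltP => //; rewrite lee_fin subr_le0.
apply: le_measure; rewrite ?inE.
- exact: bigsetU_measurable.
- exact: open_measurable.
- by apply: (big_ind (fun A : set R => A `<=` O)) => // A B AO BO x [/AO|/BO].
Qed.

Lemma ler_dist_split (V : normedModType R) (x y z : V) :
  `|x - z| <= `|x - y| + `|y - z|.
Proof. by rewrite -(subrKA y) ler_normD. Qed.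

(** The times without a good derivative are enclosed in an open set [W] of small measure. Continuous
    induction crosses points outside [W] with slope [K + e], and collects the intervals used inside
    [W]; absolute continuity bounds the total increment over the latter by [e]. *)
Lemma ac_bound (f : R -> 'rV[R]_n) (a b K : R) : a <= b -> 0 <= K ->
  abs_continuous_on a b f ->
  {ae lebesgue_measure, forall t : R, a < t < b ->
     exists2 d, is_derive t 1 f d & `|d| <= K} ->
  `|f b - f a| <= K * (b - a).
Proof.
move=> ab K0 acf aef.
suff H (e : R) : 0 < e -> `|f b - f a| <= (K + e) * (b - a) + e.
  have [d d0 dE] : exists2 d : R, 0 < d & d = b - a + 1.
    by exists (b - a + 1) => //; lra.
  apply/ler_addgt0Pr => e e0; have := H (e / d) (divr_gt0 e0 d0).
  have -> : (K + e / d) * (b - a) + e / d = K * (b - a) + e / d * d.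
    by rewrite dE; ring.
  by rewrite divfK // gt_eqF.
move=> e0.
(* The endpoints join the exceptional set because the derivative hypothesis is silent there. *)
have negab : lebesgue_measure.-negligible
    ([set t | ~ (a < t < b -> exists2 d, is_derive t 1 f d & `|d| <= K)] `|`
    ([set a] `|` [set b])).
  by apply: negligibleU => //; apply: negligibleU; apply: negligible_set1.
have [d d0 hd] := acf e e0.
have [W [oW NW Wd]] := negligible_open negab d0.
(* New intervals are put at the head of the list, so it runs from right to left; [r] makes its
   members disjoint. *)
pose r (p q : R * R) := q.2 <= p.1.
pose valid t (l : seq (R * R)) := forall p, p \in l ->
  [/\ a <= p.1, p.1 <= p.2, p.2 <= t & `]p.1, p.2[%classic `<=` W].
pose P t := exists l : seq (R * R), [/\ valid t l, pairwise r l &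
  `|f t - f a| <= (K + e) * (t - a) + \sum_(p <- l) `|f p.2 - f p.1| ].
have : P b.
  apply: (@real_ind _ P a b ab).
    by exists [::]; split => //; rewrite big_nil !subrr normr0 mulr0 addr0.
  move=> c /andP[ac cb].
  have [cW|cW] := pselect (W c).
    have : nbhs c W by exact: open_nbhs_nbhs.
    move=> /nbhs_normedP[q q0 hq]; exists q => // s t as_ sc ct tb cs tc.
    move=> [l [vl pl hl]]; exists ((s, t) :: l); split.
    - move=> p; rewrite inE => /predU1P[->|/vl[? ? ? ?]].
        split => //=; first exact: le_trans ct.
        move=> x /=; rewrite in_itv /= => /andP[sx xt]; apply: hq.
        by rewrite ltr_norml; apply/andP; split; (clear - sx xt cs tc; lra).
      by split => //; lra.
    - rewrite /= pl andbT; apply/allP => p /vl[_ _ ps _]; exact: ps.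
    - rewrite big_cons /=; apply: le_trans (ler_dist_split _ (f s) _) _.
      rewrite addrCA lerD2l; apply: le_trans hl _; rewrite lerD2r.
      by apply: ler_wpM2l; lra.
  have [cab|cab] := boolP (a < c < b); last first.
    exfalso; apply: cW; apply: NW; right.
    move: cab; rewrite !lt_neqAle ac cb !andbT negb_and !negbK.
    by case/orP => /eqP <-; [left|right].
  have [d' dd' dK] : exists2 d, is_derive c 1 f d & `|d| <= K.
    apply: contrapT => h; apply: cW; apply: NW; left => /=.
    by move=> /(_ cab).
  have /is_derive1P/(_ e e0)[q q0 hq] := dd'.
  have hq' s : `|s - c| < q -> `|f s - f c| <= (K + e) * `|s - c|.
    move=> /hq h; rewrite -(subrK ((s - c) *: d') (f s - f c)).
    apply: le_trans (ler_normD _ _) _; rewrite normrZ mulrDl addrC lerD //.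
    by rewrite mulrC ler_wpM2r.
  exists q => // s t as_ sc ct tb cs tc [l [vl pl hl]]; exists l; split => //.
    by move=> p /vl[? ? ? ?]; split => //; lra.
  apply: le_trans (ler_dist_split _ (f s) _) _.
  have h1 : `|f t - f c| <= (K + e) * (t - c).
    have := hq' t; rewrite ger0_norm ?subr_ge0 //; apply; lra.
  have h2 : `|f c - f s| <= (K + e) * (c - s).
    have := hq' s; rewrite distrC [`|f s - _|]distrC ger0_norm ?subr_ge0 //.
    by apply; lra.
  have := ler_dist_split (f t) (f c) (f s).
  move: h1 h2 hl; set A := `|f t - f c|; set B := `|f c - f s|; set C := \sum_(_ <- _) _.
  set D := `|f t - f s|; set E := `|f s - f a|; nra.
move=> [l [vl pl hl]]; apply: le_trans hl _; rewrite lerD2l.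
apply: ltW; rewrite (big_nth (0, 0)) big_mkord.
have vi (i : 'I_(size l)) := vl _ (mem_nth (0, 0) (ltn_ord i)).
have tr : trivIset setT
    (fun i : 'I_(size l) => `](nth (0, 0) l i).1, (nth (0, 0) l i).2[%classic).
  have dis (i j : 'I_(size l)) x : (i < j)%N ->
      x \in `](nth (0, 0) l i).1, (nth (0, 0) l i).2[ ->
      x \in `](nth (0, 0) l j).1, (nth (0, 0) l j).2[ -> False.
    move=> ij; have /(pairwiseP (0, 0)) /(_ i j) := pl.
    move=> /(_ (ltn_ord i) (ltn_ord j) ij); rewrite /r => h.
    rewrite !in_itv /= => /andP[h1 _] /andP[_ h2].
    by have := lt_le_trans h2 (le_trans h (ltW h1)); rewrite ltxx.
  apply/trivIsetP => i j _ _ ij; apply/seteqP; split => // x [/= xi xj].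
  by have [h|h|/val_inj h] := ltngtP i j; [exact: dis h xi xj|
    exact: dis h xj xi|rewrite h eqxx in ij].
apply: (hd _ (fun i : 'I_(size l) => (nth (0, 0) l i).1)
             (fun i : 'I_(size l) => (nth (0, 0) l i).2)) => //.
  by move=> i; have [] := vi i.
rewrite -lte_fin; apply: le_lt_trans Wd; apply: disjoint_length => // i;
  by have [] := vi i.
Qed.

Lemma lip_ac (f : R -> 'rV[R]_n) (a b K : R) :
  (forall s t, a <= s -> s <= t -> t <= b -> `|f t - f s| <= K * (t - s)) ->
  abs_continuous_on a b f.
Proof.
move=> fK e e0; have K0 : 0 < `|K| + 1 by rewrite ltr_pwDr.
exists (e / (`|K| + 1)); first exact: divr_gt0.
move=> N s t st _; rewrite ltr_pdivlMr // => h.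
apply: le_lt_trans h; rewrite mulr_suml; apply: ler_sum => l _.
have [h1 h2 h3] := st l; apply: le_trans (fK _ _ h1 h2 h3) _.
rewrite mulrC; apply: ler_wpM2l; first by rewrite subr_ge0.
by apply: le_trans (ler_norm K) _; rewrite lerDl.
Qed.

Lemma local_lip (V : normedModType R) (f : R -> V) (a b K : R) : a <= b ->
  (forall c, a <= c <= b -> exists2 r : R, 0 < r & forall t, a <= t <= b ->
    `|t - c| < r -> `|f t - f c| <= K * `|t - c|) ->
  `|f b - f a| <= K * (b - a).
Proof.
move=> ab h.
apply: (@real_ind _ (fun t => `|f t - f a| <= K * (t - a)) a b ab).
  by rewrite !subrr normr0 mulr0.
move=> c cab; have [r r0 hr] := h c cab; exists r => // s t as_ sc ct tb cs tc hs.
have /andP[ac cb] := cab.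
have h1 : `|f t - f c| <= K * (t - c).
  have := hr t; rewrite [`|t - c|]ger0_norm ?subr_ge0 //; apply; last lra.
  by apply/andP; split; lra.
have h2 : `|f c - f s| <= K * (c - s).
  have := hr s; rewrite distrC [`|f s - _|]distrC [`|c - s|]ger0_norm ?subr_ge0 //.
  by apply; last lra; apply/andP; split; lra.
have := ler_dist_split (f t) (f c) (f s); have := ler_dist_split (f t) (f s) (f a).
lra.
Qed.

(** A Lindelof argument: each point of [J] lies in a ball of rational centre and radius [k.+1%:R^-1]
    on which [P] holds almost everywhere, and there are only countably many such balls. *)
Lemma ae_local (J : set R) (P : R -> Prop) :
  (forall t, J t -> exists2 r : R, 0 < r &
     {ae lebesgue_measure, forall s : R, `|s - t| < r -> P s}) ->
  {ae lebesgue_measure, forall t : R, J t -> P t}.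
Proof.
move=> H.
pose B (q : rat * nat) : set R := [set s | `|s - ratr q.1| < q.2.+1%:R^-1].
pose good (q : rat * nat) :=
  lebesgue_measure.-negligible [set s | ~ (B q s -> P s)].
(* Balls on which [P] fails on a non-negligible set contribute the empty set, so every [N q] is
   negligible. *)
pose N (q : rat * nat) : set R :=
  if pselect (good q) then [set s | ~ (B q s -> P s)] else set0.
have nN q : lebesgue_measure.-negligible (N q).
  by rewrite /N; case: pselect => [|_] //=; exact: negligible_set0.
have : lebesgue_measure.-negligible (\bigcup_q N q).
  have := @negligible_bigcup _ _ _ (@lebesgue_measure R)
     (fun k => if unpickle k is Some q then N q else set0).
  move=> h; apply: negligibleS (h _); last first.
    by move=> k; case: unpickle => // *; exact: negligible_set0.
  by move=> s [q _ Nq]; exists (pickle q); [by []|rewrite pickleK; exact: Nq].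
suff core (t : R) : J t -> ~ P t -> (\bigcup_q N q) t.
  by apply: negligibleS => t /= /not_implyP[]; exact: core.
move=> Jt nP; have [r r0 hr] := H t Jt.
have [k hk] : exists k : nat, k.+1%:R^-1 < r / 2.
  have e20 : 0 < r / 2 by rewrite divr_gt0.
  exists (Num.truncn (r / 2)^-1); rewrite invf_plt ?posrE //.
  exact: truncnS_gt.
have k0 : 0 < k.+1%:R^-1 :> R by rewrite invr_gt0.
have [q hq] : exists q : rat, `|t - ratr q| < k.+1%:R^-1.
  have : t - k.+1%:R^-1 < t + k.+1%:R^-1.
    by rewrite ltrBlDr -addrA ltrDl addr_gt0.
  move=> /rat_in_itvoo[q]; rewrite in_itv /= => h; exists q.
  by rewrite ltr_distlC.
exists (q, k) => //; rewrite /N; case: pselect => [_ /=|].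
  by move=> /(_ hq).
case; apply: negligibleS hr => s /= /not_implyP[Bs nPs] /(_ _)/nPs; apply.
apply: le_lt_trans (ler_dist_split s (ratr q) t) _.
by rewrite (splitr r) ltrD //; [|rewrite distrC]; apply: lt_trans hk.
Qed.

End AbsolutelyContinuous.

(** * Antiderivatives of measurable controls times continuous functions *)

Section Antiderivative.
Context {R : realType}.

(** Each superlevel set of [u] at a rational height is a Borel set up to a null Borel set. Setting
    [u] to 0 on the countable union [W] of these null sets makes all superlevel sets Borel. *)
Lemma lebesgue_borel (u : R -> R) : lebesgue_measurable_fun u ->
  exists2 v : R -> R, measurable_fun setT v &
    {ae lebesgue_measure, forall t : R, v t = u t}.
Proof.
move=> mu.
have H (q : rat) : exists B N : set R,
    [/\ measurable (B : set (measurableTypeR R)),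
        measurable (N : set (measurableTypeR R)), lebesgue_measure N = 0 &
        forall t, ~ N t -> (ratr q < u t <-> B t)].
  have mq : ((wlength (@idfun R))^*%mu).-cara.-measurable
      (u @^-1` `]ratr q, +oo[%classic).
    by rewrite -[_ @^-1` _]setTI; apply: mu => //; exact: measurable_itv.
  move: mq; rewrite -completed_caratheodory_measurable.
  rewrite g_sigma_completed_algebra_genE => -[A mA [N [B [mB B0 NB]] ABu]].
  exists A, B; split => // t nBt.
  have -> : (ratr q < u t) = (u @^-1` `]ratr q, +oo[%classic) t :> Prop.
    by rewrite /= in_itv /= andbT.
  by rewrite -ABu; split; [case=> // /NB|left].
have /choice[B /choice[N hBN]] := H.
pose W := \bigcup_q N q.
have mW : measurable (W : set (measurableTypeR R)).
  apply: bigcupT_measurable_rat => q; by have [] := hBN q.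
pose v t := if t \in W then 0 else u t.
exists v.
  apply: (measurability _ (RGenOInfty.measurableE R)) => //.
  move=> _ [_ [x ->] <-]; rewrite setTI.
  have -> : v @^-1` `]x, +oo[%classic =
      (\bigcup_(q in [set q : rat | x <= ratr q]) (B q `\` W)) `|`
      (if x < 0 then W else set0).
    apply/seteqP; split => t /=.
      rewrite in_itv /= andbT /v; case: ifPn => tW.
        by move=> ->; right; rewrite inE in tW.
      move=> xt; have [q] := rat_in_itvoo xt; rewrite in_itv /= => /andP[xq qt].
      rewrite notin_setE in tW.
      left; exists q; [exact: ltW|split => //].
      have [_ _ _ h] := hBN q; apply/h => //.
      by move=> Nqt; apply: tW; exists q.
    rewrite in_itv /= andbT /v => -[[q /= xq [Bqt nW]]|].
      rewrite memNset //; apply: le_lt_trans xq _.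
      have [_ _ _ h] := hBN q; apply/h => //.
      by move=> Nqt; apply: nW; exists q.
    by case: ifPn => // x0 Wt; rewrite mem_set.
  apply: measurableU; last by case: ifP.
  rewrite bigcup_mkcond; apply: bigcupT_measurable_rat => q.
  by case: ifP => // _; apply: measurableD => //; have [] := hBN q.
have nW : lebesgue_measure.-negligible W.
  have := @negligible_bigcup _ _ _ (@lebesgue_measure R)
     (fun k => if unpickle k is Some q then N q else set0).
  move=> h; apply: negligibleS (h _); last first.
    move=> k; case: unpickle => [q|]; last exact: negligible_set0.
    by have [_ m z _] := hBN q; apply/negligibleP.
  by move=> s [q _ Nq]; exists (pickle q); [by []|rewrite pickleK; exact: Nq].
apply: negligibleS nW => t /= vu; apply: contrapT => nWt.
by apply: vu; rewrite /v memNset.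
Qed.

Lemma antiderivative (u c : R -> R) (a b K : R) : a < b ->
  lebesgue_measurable_fun u -> continuous c ->
  (forall t, a <= t <= b -> `|u t * c t| <= K) ->
  exists G : R -> R,
    (forall s t, a <= s -> s <= t -> t <= b -> `|G t - G s| <= K * (t - s)) /\
    {ae lebesgue_measure, forall t : R, a < t < b -> is_derive t 1 G (u t * c t)}.
Proof.
move=> ab mu cc uK.
have K0 : 0 <= K by apply: le_trans (uK a _); rewrite // lexx ltW.
have [v mv vu] := lebesgue_borel mu.
have mc : measurable_fun setT c by exact: continuous_measurable_fun.
have mvc : measurable_fun setT (fun t => v t * c t) by exact: measurable_funM.
(* The bound [K] is known for [u] on [[a, b]] only, while [v] equals [u] merely almost everywhere.
   Cutting off by [\1_A] gives an integrand bounded everywhere without changing it almost everywhere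
   on [[a, b]]. *)
pose A := [set t | `|v t * c t| <= K].
have mA : measurable (A : set (measurableTypeR R)).
  have -> : A = (fun t => v t * c t) @^-1` `[- K, K]%classic.
    by apply/seteqP; split => t; rewrite /A /= in_itv /= ler_norml.
  by rewrite -[_ @^-1` _]setTI; apply: mvc => //; exact: measurable_itv.
pose g t := v t * c t * \1_A t.
have mg : measurable_fun setT g.
  by apply: measurable_funM => //; exact: measurable_indic.
have gK t : `|g t| <= K.
  rewrite /g indicE; case: (boolP (t \in A)) => [|_]; last by rewrite mulr0 normr0.
  by rewrite inE mulr1.
have ig (D : set R) : measurable (D : set (measurableTypeR R)) ->
    (lebesgue_measure D < +oo)%E -> lebesgue_measure.-integrable D (EFin \o g).
  move=> mD Dy; apply: measurable_bounded_integrable => //.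
    exact: measurable_funS mg.
  exists K; split; first exact: num_real.
  by move=> M KM t _; apply: le_trans (gK t) (ltW KM).
have ig_norm (D : set R) : measurable (D : set (measurableTypeR R)) ->
    (lebesgue_measure D < +oo)%E ->
    lebesgue_measure.-integrable D (EFin \o (fun x => `|g x|)).
  move=> mD Dy; apply: measurable_bounded_integrable => //.
    by apply: measurableT_comp => //; exact: measurable_funS mg.
  exists K; split; first exact: num_real.
  by move=> M KM t _; rewrite /= normr_id; apply: le_trans (gK t) (ltW KM).
have iI y : lebesgue_measure.-integrable `[a, y] (EFin \o g).
  apply: ig; first exact: measurable_itv.
  have := lebesgue_measure_itv (`[a, y] : interval R) => /= ->.
  by case: ifP => _ //; rewrite -EFinB ltry.
have lg : locally_integrable setT g.
  split => //; first exact: openT.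
  move=> D _ cD.
  have mD : measurable (D : set (measurableTypeR R)).
    exact: compact_measurable.
  have /integrableP[_] : lebesgue_measure.-integrable D (EFin \o g).
    by apply: ig => //; exact: compact_finite_measure.
  by [].
pose G y := \int[lebesgue_measure]_(t in `[a, y]) (g t).
exists G; split.
  move=> s t as_ st tb.
  rewrite /G (Rintegral_itvB (iI t)) //.
  have iJ : lebesgue_measure.-integrable `]s, t] (EFin \o g).
    by apply: integrableS (iI t) => //; apply: subset_itvr; rewrite bnd_simp.
  apply: le_trans (le_normr_Rintegral _ iJ) _ => //.
  have fin : (lebesgue_measure (`]s, t]%classic : set R) < +oo)%E.
    have := lebesgue_measure_itv (`]s, t] : interval R) => /= ->.
    by case: ifP => _ //; rewrite -EFinB ltry.
  apply: le_trans (@le_Rintegral _ _ _ _ _ _ (cst K) _ _ _ _) _ => //.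
  - apply: ig_norm; [exact: measurable_itv|exact: fin].
  - apply: measurable_bounded_integrable => //.
    exists `|K|; split; first exact: num_real.
    by move=> M KM x _; exact: ltW.
  rewrite Rintegral_cst //; apply: ler_wpM2l => //.
  have := lebesgue_measure_itv (`]s, t] : interval R) => /= ->.
  by case: ifP => _ //=; rewrite subr_ge0.
have := @FTC1 R g (BLeft a) iI lg.
move=> /(ae_and vu); apply: ae_imp => t [vut h] /andP[at_ tb].
have [dG G't] := h at_.
apply: DeriveDef => //; rewrite -derive1E.
transitivity (g t); first exact: G't.
by rewrite /g indicE mem_set ?mulr1 /A /= vut // uK // !ltW.
Qed.
End Antiderivative.

(** * Calculus in finite dimension *)

Section RowVectors.
Context {R : realType}.

Lemma rV_norm_le n (x : 'rV[R]_n) (e : R) :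
  0 <= e -> (forall i, `|x 0 i| <= e) -> `|x| <= e.
Proof.
move=> e0 xe; rewrite /Num.Def.normr /= mx_normrE.
by apply: bigmax_le => // -[i j] _ /=; rewrite ord1.
Qed.

Lemma rV_coord_le n (x : 'rV[R]_n) i : `|x 0 i| <= `|x|.
Proof.
rewrite [leRHS]/Num.Def.normr /= mx_normrE.
exact: (le_bigmax _ (fun ij => `|x ij.1 ij.2|) (0, i)).
Qed.

Lemma norm_row_mx_le n p (x : 'rV[R]_n) (y : 'rV[R]_p) (e : R) :
  `|x| <= e -> `|y| <= e -> `|row_mx x y| <= e.
Proof.
move=> xe ye; apply: rV_norm_le; first exact: le_trans xe.
move=> i; case: (split_ordP i) => j ->; rewrite ?row_mxEl ?row_mxEr.
  exact: le_trans (rV_coord_le _ _) xe.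
exact: le_trans (rV_coord_le _ _) ye.
Qed.

Lemma norm_lsubmx n p (z : 'rV[R]_(n + p)) : `|lsubmx z| <= `|z|.
Proof. by apply: rV_norm_le => // i; rewrite mxE; exact: rV_coord_le. Qed.

Lemma norm_rsubmx n p (z : 'rV[R]_(n + p)) : `|rsubmx z| <= `|z|.
Proof. by apply: rV_norm_le => // i; rewrite mxE; exact: rV_coord_le. Qed.

Lemma lin_bound n (W : normedModType R) (L : {linear 'rV[R]_n -> W}) v :
  `|L v| <= (\sum_i `|L (delta_mx 0 i)|) * `|v|.
Proof.
rewrite {1}(row_sum_delta v) linear_sum; apply: le_trans (ler_norm_sum _ _ _) _.
rewrite mulr_suml; apply: ler_sum => i _; rewrite linearZ normrZ mulrC.
by apply: ler_wpM2l => //; exact: rV_coord_le.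
Qed.

Lemma lin_sub_bound n (W : normedModType R) (L M : {linear 'rV[R]_n -> W}) v :
  `|L v - M v| <= (\sum_i `|L (delta_mx 0 i) - M (delta_mx 0 i)|) * `|v|.
Proof.
have E (N : {linear 'rV[R]_n -> W}) :
    N v = \sum_i v 0 i *: N (delta_mx 0 i).
  rewrite {1}(row_sum_delta v) linear_sum; apply: eq_bigr => i _.
  by rewrite linearZ.
rewrite (E L) (E M) -sumrB; apply: le_trans (ler_norm_sum _ _ _) _.
rewrite mulr_suml; apply: ler_sum => i _; rewrite -scalerBr normrZ mulrC.
by apply: ler_wpM2l => //; exact: rV_coord_le.
Qed.

Lemma lin_continuous n (W : normedModType R) (L : {linear 'rV[R]_n -> W}) :
  continuous L.
Proof.
apply: bounded_linear_continuous; apply/linear_boundedP.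
near=> M => v; apply: le_trans (lin_bound L v) _.
by apply: ler_wpM2r => //; near: M; exact: nbhs_pinfty_ge.
Unshelve. all: by end_near. Qed.

Lemma Ck_lin n (W : normedModType R) k (D : set 'rV[R]_n)
  (L : {linear 'rV[R]_n -> W}) : open D -> Ck k D L.
Proof.
move=> oD; case: k => [|k]; first by move=> x _; exact: lin_continuous.
split; first by move=> x _; apply: linear_differentiable; exact: lin_continuous.
move=> v; apply: eq_Ck (Ck_cst k D (L v)) => // x Dx.
by rewrite diff_lin //; exact: lin_continuous.
Qed.

End RowVectors.

Section MeanValue.
Context {R : realType}.
Implicit Types V W : normedModType R.

Lemma mean_value_ineq V (g : R -> V) (M : R) :
  (forall s : R, 0 <= s <= 1 -> exists2 A : V, is_derive s 1 g A & `|A| <= M) ->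
  `|g 1 - g 0| <= M.
Proof.
move=> H; apply/ler_addgt0Pr => e e0.
have := @local_lip R V g 0 1 (M + e) ler01.
rewrite subr0 mulr1; apply => c /H[A /is_derive1P/(_ e e0)[r r0 hr] AM].
exists r => // t _ /hr h; rewrite -(subrK ((t - c) *: A) (g t - g c)).
apply: le_trans (ler_normD _ _) _; rewrite mulrDl addrC lerD //.
by rewrite normrZ mulrC ler_wpM2r.
Qed.

Lemma is_derive_line V W (f : V -> W) (y v : V) (s : R) :
  differentiable f (y + s *: v) ->
  is_derive s 1 (fun t => f (y + t *: v)) ('d f (y + s *: v) v).
Proof.
move=> df; apply/is_derive1P => e e0.
have e'0 : 0 < e / (`|v| + 1) by rewrite divr_gt0 // ltr_wpDl.
have [r r0 hr] := diff_near df e'0.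
exists (r / (`|v| + 1)); first by rewrite divr_gt0 // ltr_wpDl.
move=> t; rewrite ltr_pdivlMr; last by rewrite ltr_wpDl.
move=> ts; have E : y + t *: v - (y + s *: v) = (t - s) *: v.
  by rewrite opprD addrACA subrr add0r scalerBl.
have := hr (y + t *: v); rewrite E linearZ normrZ => h.
apply: le_trans (h _) _.
  by apply: le_lt_trans ts; apply: ler_wpM2l => //; rewrite lerDl.
rewrite mulrAC -mulrA; apply: ler_wpM2l; first exact: ltW.
rewrite ler_pdivrMr; last by rewrite ltr_wpDl.
by apply: ler_wpM2l => //; rewrite lerDl.
Qed.

Lemma ball_segment V (z x y : V) (r s : R) : 0 <= s <= 1 ->
  `|x - z| < r -> `|y - z| < r -> `|y + s *: (x - y) - z| < r.
Proof.
move=> /andP[s0 s1] xr yr.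
have -> : y + s *: (x - y) - z = s *: (x - z) + (1 - s) *: (y - z).
  rewrite scalerBl scale1r addrCA -scalerBr.
  have -> : x - z - (y - z) = x - y by rewrite opprB addrA subrK.
  by rewrite addrAC.
apply: le_lt_trans (ler_normD _ _) _; rewrite !normrZ.
have s1' : 0 <= 1 - s by lra.
rewrite !ger0_norm //; have [->|s'] := eqVneq s 0; first by lra.
have s'' : 0 < s by rewrite lt_neqAle eq_sym s'.
nra.
Qed.

Section Lipschitz.
Context {n : nat} {W : normedModType R}.
Implicit Types (D : set 'rV[R]_n) (f : 'rV[R]_n -> W).

(** [Ck] gives continuity of the differential at each fixed vector only. In finite dimension the [n]
    basis vectors suffice for a bound [L] on the operator norm near [z], and segments of the ball
    turn it into a Lipschitz constant. *)
Lemma C1_bound D f z : open D -> Ck 1 D f -> D z ->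
  exists r L : R, [/\ 0 < r, 0 <= L,
    forall x, `|x - z| < r -> D x,
    forall x v, `|x - z| < r -> `|'d f x v| <= L * `|v| &
    forall x y, `|x - z| < r -> `|y - z| < r -> `|f x - f y| <= L * `|x - y| ].
Proof.
move=> oD [df ddf] Dz.
have H1 : nbhs z D by exact: open_nbhs_nbhs.
have H2 i : \forall x \near z, `|'d f x (delta_mx 0 i)| <
    `|'d f z (delta_mx 0 i)| + 1.
  have := ddf (delta_mx 0 i) z Dz => /cvgrPdist_lt /(_ 1 ltr01).
  apply: filterS => x h; rewrite -ltrBlDl; apply: le_lt_trans h.
  by rewrite distrC lerB_dist.
have /nbhs_normedP[r r0 hr] : nbhs z (fun x => D x /\ forall i,
    `|'d f x (delta_mx 0 i)| < `|'d f z (delta_mx 0 i)| + 1).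
  exact: filterI H1 (filter_forall _ H2).
pose L := \sum_i (`|'d f z (delta_mx 0 i)| + 1 : R).
have dL x v : `|x - z| < r -> `|'d f x v| <= L * `|v|.
  move=> /hr[_ h]; apply: le_trans (lin_bound _ _) _.
  by apply: ler_wpM2r => //; apply: ler_sum => i _; exact: ltW.
have L0 : 0 <= L by apply: sumr_ge0 => i _; rewrite addr_ge0.
exists r, L; split => // [x /hr[]//|x y xz yz].
have := @mean_value_ineq _ (fun s => f (y + s *: (x - y))) (L * `|x - y|).
rewrite scale1r scale0r addr0 subrKC; apply => s s01.
have seg := ball_segment s01 xz yz.
exists ('d f (y + s *: (x - y)) (x - y)); last exact: dL.
by apply: is_derive_line; apply: df; have [] := hr _ seg.
Qed.

Lemma C2_taylor D f z : open D -> Ck 2 D f -> D z ->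
  exists r C : R, [/\ 0 < r, 0 <= C,
    forall x, `|x - z| < r -> D x,
    forall x y v, `|x - z| < r -> `|y - z| < r ->
      `|'d f x v - 'd f y v| <= C * `|x - y| * `|v| &
    forall x y, `|x - z| < r -> `|y - z| < r ->
      `|f x - f y - 'd f y (x - y)| <= C * `|x - y| ^+ 2].
Proof.
move=> oD [df ddf] Dz.
have /choice[r /choice[L hrL]] i := C1_bound oD (ddf (delta_mx 0 i)) Dz.
have H0 : nbhs z D by exact: open_nbhs_nbhs.
have H i : \forall x \near z, `|x - z| < r i.
  by apply/nbhs_normedP; exists (r i) => //; have [] := hrL i.
have /nbhs_normedP[q q0 hq] : nbhs z (fun x => D x /\ forall i, `|x - z| < r i).
  exact: filterI H0 (filter_forall _ H).
pose C := \sum_i L i.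
have C0 : 0 <= C by apply: sumr_ge0 => i _; have [] := hrL i.
have dC x y v : `|x - z| < q -> `|y - z| < q ->
    `|'d f x v - 'd f y v| <= C * `|x - y| * `|v|.
  move=> /hq[Dx hx] /hq[Dy hy].
  apply: le_trans (lin_sub_bound _ _ _) _; apply: ler_wpM2r => //.
  rewrite /C mulr_suml; apply: ler_sum => i _.
  by have [_ _ _ _ ->] := hrL i.
exists q, C; split => // [x /hq[]//|x y xz yz].
(* Subtracting the linear part leaves a function of [s] whose derivative is a difference of
   differentials, already of first order in [x - y]. *)
have := @mean_value_ineq W (fun s => f (y + s *: (x - y)) - s *: 'd f y (x - y))
  (C * `|x - y| ^+ 2).
rewrite !scale1r !scale0r addr0 subr0 subrKC addrAC; apply => s s01.
have seg := ball_segment s01 xz yz.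
exists ('d f (y + s *: (x - y)) (x - y) - 'd f y (x - y)).
  apply: is_deriveB.
    by apply: is_derive_line; apply: df; have [] := hq _ seg.
  apply/is_derive1P => e e0; exists 1 => // t _.
  by rewrite -scalerBl subrr normr0 mulr_ge0 // ltW.
apply: le_trans (dC _ _ _ seg yz) _; rewrite expr2 mulrA.
apply: ler_wpM2r => //; apply: ler_wpM2l => //.
rewrite addrAC subrr add0r normrZ; case/andP: s01 => s0 s1.
by rewrite ger0_norm // ler_piMl.
Qed.

End Lipschitz.
End MeanValue.

Section Calculus.
Context {R : realType}.
Implicit Types V W : normedModType R.

Lemma second_difference (U : zmodType) (a b c d e : U) :
  a - b - c + d - e = a - b - e - (c - d).
Proof.
rewrite opprB [RHS]addrA [in LHS](addrAC _ (- c) d) [in RHS](addrAC _ (- e) d).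
exact: addrAC.
Qed.

Lemma sub_triangle (U : zmodType) (a b c d e : U) :
  a - c - d = (a - b - (d + e)) - (c - b - e).
Proof.
rewrite opprB (opprB c) opprD addrA (addrA (a - b)) subrK.
by rewrite (addrAC (a - b)) subrKA.
Qed.

(** The second difference of [f] along [s *: v] and [s *: w] is symmetric in [v] and [w], and
    [s ^+ 2] times either mixed derivative approximates it up to [e * s ^+ 2]. *)
Lemma diff_symmetric V W (D : set V) (f : V -> W) x v0 w0 : open D -> D x ->
  Ck 2 D f ->
  'd (fun y => 'd f y v0) x w0 = 'd (fun y => 'd f y w0) x v0.
Proof.
move=> oD Dx [df ddf].
have key (v w : V) (e : R) : 0 < e -> exists2 r : R, 0 < r & forall s : R, 0 < s < r ->
    `|f (x + s *: v + s *: w) - f (x + s *: v) - f (x + s *: w) + f x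
      - s ^+ 2 *: 'd (fun y => 'd f y v) x w| <= e * s ^+ 2.
  (* The differential is compared with its value at [x] at two points, whose distances to [x] add up
     to at most [s * N]; the summand 1 keeps [N] positive. *)
  move=> e0; pose N := 2 * (`|v| + `|w|) + 1.
  have N0 : 0 < N by rewrite ltr_pwDr // mulr_ge0 // addr_ge0.
  have [dG _] := ddf v; have := diff_near (dG x Dx) (divr_gt0 e0 N0).
  move=> [r1 r10 hr1].
  have /nbhs_normedP[r2 r20 hr2] : nbhs x D by exact: open_nbhs_nbhs.
  pose r := Num.min r1 r2.
  have r0 : 0 < r by rewrite lt_min r10 r20.
  exists (r / N); first exact: divr_gt0.
  move=> s /andP[s0]; rewrite ltr_pdivlMr // => sr.
  (* The increment of [g] from 0 to 1 is the error to be bounded; its derivative in [t] involves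
     first differentials of [f] only. *)
  pose g (t : R) := f (x + s *: w + t *: (s *: v)) - f (x + t *: (s *: v)) -
    t *: (s ^+ 2 *: 'd (fun y => 'd f y v) x w).
  have := @mean_value_ineq R W g (e * s ^+ 2).
  rewrite /g !scale1r !scale0r !addr0 subr0.
  rewrite [x + s *: w + _]addrAC => h.
  rewrite second_difference.
  apply: h => t /andP[t0 t1] {g}.
  have nv : `|t *: (s *: v)| <= s * `|v|.
    rewrite !normrZ !ger0_norm ?(ltW s0) // ler_piMl // mulr_ge0 //; exact: ltW.
  have sN : s * (`|v| + `|w|) < r.
    apply: le_lt_trans sr; apply: ler_wpM2l; first exact: ltW.
    rewrite /N mulr_natl mulr2n -addrA lerDl addr_ge0 // addr_ge0 //.
  have n1 : `|t *: (s *: v)| < r.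
    apply: le_lt_trans nv _; apply: le_lt_trans sN.
    by apply: ler_wpM2l; [exact: ltW|rewrite lerDl].
  have n2' : `|s *: w + t *: (s *: v)| <= s * (`|v| + `|w|).
    apply: le_trans (ler_normD _ _) _; rewrite mulrDr addrC lerD //.
    by rewrite normrZ ger0_norm // ltW.
  have n2 : `|s *: w + t *: (s *: v)| < r by exact: le_lt_trans sN.
  have xr y : `|y| < r -> `|x + y - x| < r1 /\ `|x + y - x| < r2.
    by rewrite addrAC subrr add0r lt_min => /andP[].
  have [a1 b1] := xr _ n1; have [a2 b2] := xr _ n2; rewrite addrA in a2 b2.
  exists ('d f (x + s *: w + t *: (s *: v)) (s *: v) -
      'd f (x + t *: (s *: v)) (s *: v) -
      s ^+ 2 *: 'd (fun y => 'd f y v) x w).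
    apply: is_deriveB.
      by apply: is_deriveB; apply: is_derive_line; apply/df/hr2.
    apply/is_derive1P => e' e'0; exists 1 => // t' _.
    by rewrite -scalerBl subrr normr0 mulr_ge0 // ltW.
  have := hr1 _ a1; have := hr1 _ a2.
  have -> : x + s *: w + t *: (s *: v) - x = s *: w + t *: (s *: v).
    by rewrite addrAC (addrAC x) subrr add0r.
  have -> : x + t *: (s *: v) - x = t *: (s *: v) by rewrite addrAC subrr add0r.
  rewrite linearD.
  have -> : 'd (fun y => 'd f y v) x (s *: w) = s *: 'd (fun y => 'd f y v) x w.
    exact: linearZ.
  set G1 := 'd f (_ + _) v; set G0 := 'd f x v; set G2 := 'd f (_ + _) v.
  set A := 'd _ x w; set B := 'd _ x _ => h1 h2.
  have -> : 'd f (x + s *: w + t *: (s *: v)) (s *: v) - 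
      'd f (x + t *: (s *: v)) (s *: v) - s ^+ 2 *: A =
     s *: ((G1 - G0 - (s *: A + B)) - (G2 - G0 - B)).
    have EZ p : 'd f p (s *: v) = s *: 'd f p v by exact: linearZ.
    by rewrite -sub_triangle !EZ -/G1 -/G2 expr2 -scalerA -!scalerBr.
  rewrite normrZ ger0_norm ?(ltW s0) // expr2 mulrA mulrC.
  rewrite ler_wpM2r ?(ltW s0) //; apply: le_trans (ler_normB _ _) _.
  apply: le_trans (lerD h1 h2) _.
  rewrite -mulrDr mulrAC ler_pdivrMr // -mulrA; apply: ler_wpM2l; first exact: ltW.
  apply: le_trans (lerD n2' nv) _; rewrite -mulrDr; apply: ler_wpM2l.
    exact: ltW.
  have := normr_ge0 v; have := normr_ge0 w; rewrite /N; clear; lra.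
apply/eqP; rewrite -subr_eq0 -normr_le0; apply/ler_addgt0Pr => e e0; rewrite add0r.
have e20 : 0 < e / 2 by rewrite divr_gt0.
have [r1 r10 h1] := key v0 w0 _ e20; have [r2 r20 h2] := key w0 v0 _ e20.
pose s := Num.min r1 r2 / 2.
have m0 : 0 < Num.min r1 r2 by rewrite lt_min r10.
have s0 : 0 < s by rewrite divr_gt0.
have sm : s < Num.min r1 r2 by rewrite /s; lra.
have s1 : 0 < s < r1 by rewrite s0 (lt_le_trans sm) // ge_min lexx.
have s2 : 0 < s < r2 by rewrite s0 (lt_le_trans sm) // ge_min lexx orbT.
have := h2 s s2; have := h1 s s1.
rewrite (addrAC x (s *: w0)).
rewrite (addrAC (f (x + s *: v0 + s *: w0)) (- f (x + s *: w0))).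
set Q := _ - _ - _ + f x; set A := 'd _ x w0; set B := 'd _ x v0 => H1 H2.
have s20 : 0 < s ^+ 2 by rewrite exprn_gt0.
rewrite -(ler_pM2l s20) -[X in X * `|_|](gtr0_norm s20) -normrZ scalerBr.
have -> : s ^+ 2 *: A - s ^+ 2 *: B = (Q - s ^+ 2 *: B) - (Q - s ^+ 2 *: A).
  by rewrite opprB [RHS]addrC subrKA.
apply: le_trans (ler_normB _ _) _; apply: le_trans (lerD H2 H1) _.
by rewrite -mulrDl -splitr mulrC.
Qed.

End Calculus.

Section CkMore.
Context {R : realType}.
Implicit Types V W : normedModType R.

Lemma Ck_local V W k (D : set V) (f : V -> W) :
  (forall x, D x -> exists D', [/\ open D', D' x & Ck k D' f]) -> Ck k D f.
Proof.
elim: k f => [|k IH] f H; first by move=> x /H[D' [_ D'x]]; apply.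
split; first by move=> x /H[D' [_ D'x [df _]]]; exact: df.
by move=> v; apply: IH => x /H[D' [oD' D'x [_ ddf]]]; exists D'; split => //; exact: ddf.
Qed.

Lemma Ck_cont V W k (D : set V) (f : V -> W) : Ck k D f ->
  forall x, D x -> {for x, continuous f}.
Proof.
by elim: k f => [|k IH] f // => /CkS; exact: IH.
Qed.

(** The chain rule is expanded over the basis: every differential of [f] then acts on a fixed
    vector, so that the induction hypothesis applies to it. *)
Lemma Ck_comp V n k (D : set V) (E : set 'rV[R]_n) (g : V -> 'rV[R]_n)
    (f : 'rV[R]_n -> R) : open D -> (forall x, D x -> E (g x)) ->
  Ck k D g -> Ck k E f -> Ck k D (f \o g).
Proof.
move=> oD DE; elim: k g f DE => [|k IH] g f DE cg cf.
  by move=> x Dx; apply: continuous_comp; [exact: cg|apply/cf/DE].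
have [dg ddg] := cg; have [df ddf] := cf; split.
  by move=> x Dx; apply: differentiable_comp; [exact: dg|apply/df/DE].
move=> v.
apply: (@eq_Ck _ _ _ _ _ (fun x => \sum_(j < n) 'd g x v 0 j *
    ((fun y => 'd f y (delta_mx 0 j)) \o g) x)) => //.
  move=> x Dx.
  have H := diff_comp (dg x Dx) (df _ (DE _ Dx)).
  rewrite [RHS](congr1 (fun h : V -> R => h v) H) /=.
  rewrite {2}(row_sum_delta ('d g x v)) linear_sum; apply: eq_bigr => j _.
  by rewrite linearZ.
apply: Ck_sum => // j; apply: Ck_mul => //.
  by apply: Ck_coord => //; exact: ddg.
by apply: (IH g (fun y => 'd f y (delta_mx 0 j)) DE (CkS cg)); exact: ddf.
Qed.

Lemma Ck_sub V k (D : set V) (f g : V -> R) : open D ->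
  Ck k D f -> Ck k D g -> Ck k D (fun x => f x - g x).
Proof.
move=> oD cf cg; have H := Ck_mul oD (Ck_cst k D (-1 : R)) cg.
apply: eq_Ck (Ck_add oD cf H) => // x _.
by rewrite mulN1r.
Qed.

Lemma coordinate_linear n (i : 'I_n) : exists L : {linear 'rV[R]_n -> R},
  forall x, L x = x 0 i.
Proof.
have h : linear (fun x : 'rV[R]_n => x 0 i : R).
  by move=> a u v; rewrite !mxE.
pose M := GRing.isLinear.Build _ _ _ _ _ h.
by exists (HB.pack (fun x : 'rV[R]_n => x 0 i : R) M : {linear _ -> _}).
Qed.

Lemma Ck_coordinate n k (D : set 'rV[R]_n) (i : 'I_n) : open D ->
  Ck k D (fun x : 'rV[R]_n => x 0 i).
Proof.
move=> oD; have [L LE] := coordinate_linear i.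
by apply: eq_Ck (Ck_lin k L oD).
Qed.

Lemma is_derive_coord n (f : R -> 'rV[R]_n) (t : R) d :
  is_derive t 1 f d <-> forall i, is_derive t 1 (fun s : R => f s 0 i : R) (d 0 i).
Proof.
split.
  move=> /is_derive1P H i; apply/is_derive1P => e /H[r r0 hr].
  exists r => // s /hr; apply: le_trans.
  by have := rV_coord_le (f s - f t - (s - t) *: d) i; rewrite !mxE.
move=> H; apply/is_derive1P => e e0.
have /choice[r hr] i : exists r : R, 0 < r /\ forall s : R, `|s - t| < r ->
    `|f s 0 i - f t 0 i - (s - t) *: d 0 i| <= e * `|s - t|.
  by have /is_derive1P/(_ e e0)[r r0 hr] := H i; exists r.
have near_i i : nbhs t (fun s : R => `|s - t| < r i).
  by apply/nbhs_normedP; exists (r i) => //; have [] := hr i.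
have /nbhs_normedP[q q0 hq] : nbhs t (fun s : R => forall i, `|s - t| < r i).
  exact: filter_forall _ near_i.
exists q => // s st.
apply: rV_norm_le => [|i]; first by rewrite mulr_ge0 // ltW.
by have [_ h] := hr i; have := h s (hq s st i); rewrite !mxE.
Qed.

End CkMore.

(** * Smooth bump functions *)

Section Flat.
Context {R : realType}.

(** The power of [x^-1] makes the family closed under differentiation up to linear combinations, so
    smoothness follows by one induction over all [n] at once. *)
Definition flat (n : nat) (x : R) : R :=
  if 0 < x then x^-1 ^+ n * expR (- x^-1) else 0.

Lemma flat_le0 n (x : R) : x <= 0 -> flat n x = 0.
Proof. by rewrite /flat leNgt => /negbTE ->. Qed.

Lemma flat_gt0 n (x : R) : 0 < x -> 0 < flat n x.
Proof. by move=> x0; rewrite /flat x0 mulr_gt0 ?expR_gt0 // exprn_gt0 ?invr_gt0. Qed.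

(** With [y = x^-1], the term of order [n.+2] of the exponential series is below [expR y]; this is
    the origin of the factorial. A quadratic bound yields derivative 0 at the origin. *)
Lemma flat_bound n : exists2 C : R, 0 <= C & forall x, `|flat n x| <= C * `|x| ^+ 2.
Proof.
exists (n.+2)`!%:R => // x; have [x0|x0] := ltP 0 x; last first.
  by rewrite flat_le0 // normr0 mulr_ge0.
rewrite !gtr0_norm ?flat_gt0 // /flat x0.
pose y := x^-1; have y0 : 0 < y by rewrite invr_gt0.
have f0 : 0 < (n.+2)`!%:R :> R by rewrite ltr0n fact_gt0.
have H : y ^+ n.+2 / (n.+2)`!%:R <= expR y.
  by apply: le_trans (expR_ge1Dxn n.+1 (ltW y0)); rewrite lerDr.
rewrite expRN -/y ler_pdivrMr ?expR_gt0 //.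
apply: le_trans (ler_wpM2l _ H); last by rewrite mulr_ge0 ?sqr_ge0 // ltW.
have -> : x = y^-1 by rewrite invrK.
have yn0 : y != 0 by rewrite gt_eqF.
have fn0 : (n.+2)`!%:R != 0 :> R by rewrite gt_eqF.
rewrite (exprS y n.+1) (exprS y n) expr2 le_eqVlt; apply/orP; left; apply/eqP.
by field; rewrite yn0 fn0.
Qed.

Lemma is_derive_flat n (x : R) :
  is_derive x 1 (flat n) (flat n.+2 x - n%:R * flat n.+1 x).
Proof.
have [x0|x0|x0] := ltgtP 0 x.
- have E y : `|y - x| < x -> y^-1 ^+ n * expR (- y^-1) = flat n y.
    by rewrite ltr_norml => /andP[h _]; rewrite /flat; case: ltP => // ?; lra.
  apply: (is_derive_near x0 E).
  rewrite /flat x0.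
  have xn0 : x != 0 by rewrite gt_eqF.
  have d1 : is_derive x 1 (fun y : R => y^-1) (- x ^- 2).
    by have := is_deriveV xn0 (is_derive_id x (1 : R)); rewrite [_ *: 1]mulr1.
  have d2 := is_deriveX n d1.
  have d3 := is_deriveN d1.
  have d4 := @is_derive1_comp _ expR (fun y : R => - y^-1) x _ _ (is_derive_expR _) d3.
  have E2 : (fun y : R => y^-1) ^+ n = (fun y => y^-1 ^+ n).
    by apply/funext => y; rewrite exprfctE.
  rewrite E2 in d2; have d5 := is_deriveM d2 d4.
  have d6 : is_derive x 1 (fun y : R => y^-1 ^+ n * expR (- y^-1))
    (x^-1 ^+ n *: (expR (- x^-1) * - - x ^- 2) +
     (expR (- x^-1)) *: ((n%:R * x^-1 ^+ n.-1) *: - x ^- 2)) := d5.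
  apply: is_derive_eq; rewrite /GRing.scale /= opprK.
  clear; case: n => [|n].
    by rewrite mul0r !mul0r subr0 mulr0 addr0 expr0 mul1r mulrC exprVn.
  rewrite /= -!exprVn !exprS; set y := x^-1; set e := expR _.
  by rewrite expr0; ring.
- apply: (@is_derive_near _ _ (cst 0) _ x (- x)); first by rewrite oppr_gt0.
    move=> y; rewrite ltr_norml => /andP[_ h]; rewrite flat_le0 //; lra.
  by rewrite !flat_le0 ?(ltW x0) // mulr0 subr0; exact: is_derive_cst.
rewrite -x0 !flat_le0 // mulr0 subr0; apply/is_derive1P => e e0.
have [C C0 hC] := flat_bound n.
exists (e / (C + 1)); first by rewrite divr_gt0 // ltr_wpDl.
move=> y; rewrite !subr0 ltr_pdivlMr ?ltr_wpDl // scaler0 (flat_le0 n (lexx 0)).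
rewrite !subr0 => h.
apply: le_trans (hC y) _; rewrite expr2 mulrA; apply: ler_wpM2r => //.
apply: le_trans (ltW h); rewrite mulrC; apply: ler_wpM2l => //.
by rewrite lerDl.
Qed.

End Flat.

Section Bump.
Context {R : realType}.

Lemma Ck_flat_comp (V : normedModType R) k (D : set V) (q : V -> R) n : open D ->
  smooth_on D q -> Ck k D (flat n \o q).
Proof.
move=> oD sq; elim: k n => [|k IH] n.
  move=> x Dx; apply: continuous_comp; first exact: (sq 0%N).
  apply/differentiable_continuous/derivable1_diffP.
  by have [] := is_derive_flat n (q x).
have dq x : D x -> differentiable q x by exact: smooth_differentiable.
have dfl (y : R) : differentiable (flat n) y.
  by apply/derivable1_diffP; have [] := is_derive_flat n y.
split.
  by move=> x Dx; apply: differentiable_comp; [exact: dq|exact: dfl].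
move=> v; apply: (@eq_Ck _ _ _ _ _
  (fun x => ((flat n.+2 \o q) x + (- n%:R) * (flat n.+1 \o q) x) * 'd q x v)) => //.
  move=> x Dx.
  have H := diff_comp (dq x Dx) (dfl (q x)).
  rewrite [RHS](congr1 (fun h : V -> R => h v) H) /=.
  rewrite diff1E // derive1E (@derive_val _ _ _ _ _ _ _ (is_derive_flat n (q x))).
  by rewrite /GRing.scale /= mulrC mulNr.
apply: Ck_mul => //; last first.
  by have [_ ddq] := sq k.+1; exact: ddq.
by apply: Ck_add => //; apply: Ck_mul => //; exact: Ck_cst.
Qed.

(** [flat 0] is applied twice: the inner use is constant outside a ball, and the outer one makes the
    result constant near [c] too. Squared Euclidean distance gives a smooth [q], while the norm is
    the maximum norm; beyond [r] in one coordinate already forces [q x <= 0]. *)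
Lemma exists_bump n (c : 'rV[R]_n) (r : R) : 0 < r ->
  exists B : 'rV[R]_n -> R, [/\ smooth_on setT B,
    forall x, r < `|x - c| -> B x = 0 &
    \forall x \near c, B x = 1].
Proof.
move=> r0.
pose q (x : 'rV[R]_n) : R := r ^+ 2 - \sum_i (x 0 i - c 0 i) * (x 0 i - c 0 i).
have oT := @openT 'rV[R]_n.
have sq : smooth_on setT q.
  move=> k; apply: Ck_sub => //; first exact: Ck_cst.
  apply: Ck_sum => // i.
  by apply: Ck_mul => //; apply: Ck_sub => //; solve [exact: Ck_cst|exact: Ck_coordinate].
have qc : q c = r ^+ 2.
  by rewrite /q big1 ?subr0 // => i _; rewrite subrr mulr0.
have r20 : 0 < r ^+ 2 by rewrite exprn_gt0.
(* This [K] gives [p c = -1], while [p = 1] wherever [q <= 0]. The constant [e] below then makes the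
   bump vanish where [p = 1]; where [p <= 0] it equals 1. *)
pose K := 2 / flat 0 (r ^+ 2).
pose p x := 1 - K * (flat 0 \o q) x.
have sp : smooth_on setT p.
  move=> k; apply: Ck_sub => //; first exact: Ck_cst.
  by apply: Ck_mul => //; [exact: Ck_cst|exact: Ck_flat_comp].
pose e := (flat 0 (1 : R))^-1.
have f1 : flat 0 (1 : R) != 0 by rewrite gt_eqF // flat_gt0.
exists (fun x => 1 - e * (flat 0 \o p) x); split.
- move=> k; apply: Ck_sub => //; first exact: Ck_cst.
  by apply: Ck_mul => //; [exact: Ck_cst|exact: Ck_flat_comp].
- move=> x rx; have q0 : q x <= 0.
    have [i hi] : exists i, r < `|x 0 i - c 0 i|.
      apply: contrapT => /forallNP h; move: rx; apply/negP; rewrite -leNgt.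
      apply: rV_norm_le; first exact: ltW.
      by move=> i; rewrite !mxE leNgt; apply/negP => /h.
    rewrite /q subr_le0 (bigD1 i) //=.
    apply: (@le_trans _ _ ((x 0 i - c 0 i) * (x 0 i - c 0 i))).
      rewrite -expr2 -[leRHS]real_normK ?num_real //.
      by rewrite ler_pXn2r ?nnegrE // ltW.
    by rewrite lerDl sumr_ge0 // => j _; rewrite -expr2 sqr_ge0.
  by rewrite /= /p /= (flat_le0 _ q0) mulr0 subr0 mulVf // subrr.
- have pc : p c = -1.
    rewrite /p /= qc /K divfK; first by ring.
    by rewrite gt_eqF // flat_gt0.
  have /cvgrPdist_lt/(_ 1 ltr01) : {for c, continuous p}.
    exact: Ck_cont (sp 0%N) _ _.
  apply: filterS => x; rewrite pc ltr_norml => /andP[h _].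
  by rewrite /= flat_le0 ?mulr0 ?subr0 //; lra.
Qed.

End Bump.

(** * Caratheodory equations *)

Section ShortIntervals.
Context {R : realType}.

(** The retraction onto [[a, b]]. Composing with it makes a curve controlled only on [[a, b]]
    continuous or Lipschitz on the whole line. *)
Definition clamp (a b t : R) : R := Num.max a (Num.min t b).

Lemma clamp_in (a b t : R) : a <= b -> a <= clamp a b t <= b.
Proof.
by move=> ab; rewrite /clamp le_max lexx /= ge_max ab ge_min lexx orbT.
Qed.

Lemma clamp_id (a b t : R) : a <= t <= b -> clamp a b t = t.
Proof. by move=> /andP[at_ tb]; rewrite /clamp (min_idPl tb); apply/max_idPr. Qed.

Lemma clamp_lip (a b s t : R) : `|clamp a b t - clamp a b s| <= `|t - s|.
Proof.
rewrite /clamp; have [tb|tb] := leP t b; have [sb|sb] := leP s b.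
- have [at_|at_] := leP a t; have [as_|as_] := leP a s.
  + by [].
  + by rewrite ger0_norm ?ger0_norm; lra.
  + by rewrite distrC (distrC t) ger0_norm ?ger0_norm; lra.
  + by rewrite subrr normr0.
- have [at_|at_] := leP a t; have [ab|ab] := leP a b.
  + by rewrite distrC (distrC t) ger0_norm ?ger0_norm; lra.
  + lra.
  + by rewrite distrC (distrC t) ger0_norm ?ger0_norm; lra.
  + by rewrite subrr normr0.
- have [ab|ab] := leP a b; have [as_|as_] := leP a s.
  + by rewrite ger0_norm ?ger0_norm; lra.
  + by rewrite ger0_norm ?ger0_norm; lra.
  + lra.
  + by rewrite subrr normr0.
- by rewrite subrr normr0.
Qed.

Lemma lip_continuous (V : normedModType R) (f : R -> V) (K : R) :
  (forall s t, `|f t - f s| <= K * `|t - s|) -> continuous f.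
Proof.
move=> fK t; apply/cont_normP => e e0.
have K0 : 0 < `|K| + 1 by rewrite ltr_wpDl.
exists (e / (`|K| + 1)); first exact: divr_gt0.
move=> s; rewrite ltr_pdivlMr // => h; apply: le_lt_trans (fK _ _) _.
apply: le_lt_trans h; rewrite mulrC; apply: ler_wpM2l => //.
by apply: le_trans (ler_norm K) _; rewrite lerDl.
Qed.

Context {n : nat}.
Implicit Types f g : R -> 'rV[R]_n.

Lemma ac_dominated p (f : R -> 'rV[R]_n) (g : R -> 'rV[R]_p) (a b C : R) : 0 < C ->
  (forall s t, `|g t - g s| <= C * `|f t - f s|) ->
  abs_continuous_on a b f -> abs_continuous_on a b g.
Proof.
move=> C0 gf acf e e0; have [d d0 hd] := acf _ (divr_gt0 e0 C0).
exists d => // N s t h1 h2 h3; have := hd N s t h1 h2 h3.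
rewrite ltr_pdivlMr //; apply: le_lt_trans; rewrite mulr_suml.
by apply: ler_sum => l _; rewrite mulrC; exact: gf.
Qed.

Lemma ac_add f g a b : abs_continuous_on a b f -> abs_continuous_on a b g ->
  abs_continuous_on a b (fun t => f t + g t).
Proof.
move=> acf acg e e0; have e20 : 0 < e / 2 by rewrite divr_gt0.
have [d d0 hd] := acf _ e20; have [d' d'0 hd'] := acg _ e20.
exists (Num.min d d'); first by rewrite lt_min d0.
move=> N s t h1 h2; rewrite lt_min => /andP[h3 h4].
have := hd N s t h1 h2 h3; have := hd' N s t h1 h2 h4 => l1 l2.
rewrite (splitr e); apply: le_lt_trans (ltrD l2 l1); rewrite -big_split /=.
by apply: ler_sum => l _; rewrite opprD addrACA ler_normD.
Qed.

Lemma ac_scale f (c : R) a b : abs_continuous_on a b f ->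
  abs_continuous_on a b (fun t => c *: f t).
Proof.
apply: (@ac_dominated _ _ _ _ _ (`|c| + 1)) => [|s t]; first by rewrite ltr_wpDl.
by rewrite -scalerBr normrZ ler_wpM2r // lerDl.
Qed.

Lemma ac_sub f g a b : abs_continuous_on a b f -> abs_continuous_on a b g ->
  abs_continuous_on a b (fun t => f t - g t).
Proof.
move=> acf acg; have := ac_add acf (ac_scale (-1) acg).
by under eq_fun do rewrite scaleN1r.
Qed.

Lemma ac_sum m (f : 'I_m -> R -> 'rV[R]_n) a b :
  (forall k, abs_continuous_on a b (f k)) ->
  abs_continuous_on a b (fun t => \sum_k f k t).
Proof.
elim: m f => [|m IH] f acf.
  under eq_fun do rewrite big_ord0.
  by move=> e e0; exists 1 => // N s t _ _ _; rewrite big1 // => l _; rewrite subrr normr0.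
have -> : (fun t => \sum_k f k t) =
    (fun t => \sum_(i < m) f (widen_ord (leqnSn m) i) t + f ord_max t).
  by apply/funext => t; rewrite big_ord_recr.
by apply: ac_add => //; apply: IH.
Qed.

Lemma ac_subset f a b c d : a <= c -> d <= b ->
  abs_continuous_on a b f -> abs_continuous_on c d f.
Proof.
move=> ac db acf e e0; have [r r0 hr] := acf e e0; exists r => // N s t h.
by apply: hr => l; have [h1 h2 h3] := h l; split => //; lra.
Qed.

Lemma ac_bound2 f (a b K : R) : 0 <= K -> abs_continuous_on a b f ->
  {ae lebesgue_measure, forall t : R, a < t < b ->
     exists2 d, is_derive t 1 f d & `|d| <= K} ->
  forall s t, a <= s <= b -> a <= t <= b -> `|f t - f s| <= K * `|t - s|.
Proof.
move=> K0 acf aef.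
have H s t : a <= s -> s <= t -> t <= b -> `|f t - f s| <= K * (t - s).
  move=> as_ st tb; apply: ac_bound => //; first exact: ac_subset acf.
  by apply: ae_imp aef => r h sr; apply: h; lra.
move=> s t /andP[as_ sb] /andP[at_ tb]; have [st|ts] := leP s t.
  by rewrite [`|t - s|]ger0_norm ?subr_ge0 //; exact: H.
by rewrite distrC (distrC t) [`|s - t|]gtr0_norm ?subr_gt0 //; apply: H => //; exact: ltW.
Qed.

Lemma ac_clamp_continuous f a b : a <= b -> abs_continuous_on a b f ->
  continuous (f \o clamp a b).
Proof.
move=> ab acf t; apply/cont_normP => e e0; have [d d0 hd] := acf e e0.
exists d => // s st.
have H x y : a <= x -> x <= y -> y <= b -> y - x < d -> `|f y - f x| < e.
  move=> ax xy yb xyd.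
  have := hd 1%N (fun=> x) (fun=> y); rewrite !big_ord1; apply => //.
  by apply/trivIsetP => i j _ _; rewrite !ord1 eqxx.
have cst := le_lt_trans (clamp_lip a b t s) st.
have /andP[a1 b1] := clamp_in s ab; have /andP[a2 b2] := clamp_in t ab.
rewrite /=; have [le|/ltW le] := leP (clamp a b t) (clamp a b s).
  by apply: H => //; apply: le_lt_trans cst; rewrite ler_norm.
by rewrite distrC; apply: H => //; apply: le_lt_trans cst; rewrite distrC ler_norm.
Qed.

(* A Gronwall inequality without exponentials: on an interval so short that
   [L * (b - a) <= 1/2], the maximum of [`|f|] absorbs half of itself. *)
Lemma short_gronwall f (a b L eta t0 : R) : 0 <= L -> 0 <= eta ->
  L * (b - a) <= 2^-1 -> abs_continuous_on a b f ->
  {ae lebesgue_measure, forall t : R, a < t < b ->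
     exists2 d, is_derive t 1 f d & `|d| <= L * `|f t| + eta} ->
  a <= t0 <= b ->
  forall t, a <= t <= b -> `|f t| <= 2 * (`|f t0| + eta * (b - a)).
Proof.
move=> L0 eta0 Lab acf aef t0ab.
have /andP[at0 t0b] := t0ab; have ab := le_trans at0 t0b.
have cf : continuous (fun t => `|f (clamp a b t)|).
  move=> t; apply: (@continuous_comp _ _ _ (f \o clamp a b) Num.norm).
    exact: ac_clamp_continuous.
  exact: norm_continuous.
have [c cab hc] := @EVT_max _ _ a b ab (continuous_subspaceT cf).
rewrite in_itv /= in cab.
have hM t : a <= t <= b -> `|f t| <= `|f c|.
  move=> tab; have := hc t; rewrite in_itv /= => /(_ tab).
  by rewrite !clamp_id.
set M := `|f c| in hM.
have M0 : 0 <= M by exact: normr_ge0.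
have K0 : 0 <= L * M + eta by rewrite addr_ge0 // mulr_ge0.
have aeK : {ae lebesgue_measure, forall t : R, a < t < b ->
     exists2 d, is_derive t 1 f d & `|d| <= L * M + eta}.
  apply: ae_imp aef => t h /[dup] tab /h[d dd dL]; exists d => //.
  apply: le_trans dL _; rewrite lerD2r; apply: ler_wpM2l => //.
  by apply: hM; case/andP: tab => *; rewrite !ltW.
have := ac_bound2 K0 acf aeK t0ab cab.
have cl : `|c - t0| <= b - a.
  by case/andP: cab => *; rewrite ler_norml; apply/andP; split; lra.
have E1 : M <= `|f t0| + `|f c - f t0|.
  by have := ler_dist_split (f c) (f t0) 0; rewrite !subr0 addrC.
have E2 : (L * M + eta) * `|c - t0| <= (L * M + eta) * (b - a) by exact: ler_wpM2l.
have E3 : L * (b - a) * M <= 2^-1 * M by exact: ler_wpM2r.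
move=> E4 t /hM; move: E1 E2 E3 E4; nra.
Qed.

End ShortIntervals.

(** * Picard iteration *)

Section Picard.
Context {R : realType} {n : nat}.

Lemma le_half_pow (A B C : R) : 0 <= C ->
  (forall k : nat, A <= B + C * 2^-1 ^+ k) -> A <= B.
Proof.
move=> C0 H; apply/ler_addgt0Pr => e e0.
have [k hk] : exists k : nat, C / e < 2 ^+ k.
  exists (Num.truncn (C / e)).+1.
  have := truncnS_gt (C / e) => h; apply: lt_trans h _.
  have := ltn_expl (Num.truncn (C / e)).+1 (isT : (1 < 2)%N).
  by rewrite -(ltr_nat R) natrX.
apply: le_trans (H k) _; rewrite lerD2l exprVn ler_pdivrMr ?exprn_gt0 //.
by rewrite mulrC -ler_pdivrMr //; exact: ltW.
Qed.

Lemma half_cauchy_limit (x : nat -> 'rV[R]_n) (C : R) :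
  (forall k, `|x k.+1 - x k| <= C * 2^-1 ^+ k) ->
  exists l, forall k, `|l - x k| <= 2 * C * 2^-1 ^+ k.
Proof.
move=> xC.
have C0 : 0 <= C.
  by have := xC 0%N; rewrite expr0 mulr1; exact: le_trans.
have H k j : `|x (k + j)%N - x k| <= 2 * C * (2^-1 ^+ k - 2^-1 ^+ (k + j)).
  elim: j => [|j IH]; first by rewrite addn0 !subrr normr0 mulr0.
  rewrite addnS; apply: le_trans (ler_dist_split _ (x (k + j)%N) _) _.
  by move: IH (xC (k + j)%N); rewrite exprS; set y := 2^-1 ^+ (k + j); lra.
have H' k j : (k <= j)%N -> `|x j - x k| <= 2 * C * 2^-1 ^+ k.
  move=> /subnKC <-; apply: le_trans (H k _) _; apply: ler_wpM2l; first lra.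
  by rewrite gerBl exprn_ge0.
have cx : cvgn x.
  apply/cauchy_cvgP/cauchy_exP => e e0.
  have [k hk] : exists k : nat, 2 * C * 2^-1 ^+ k < e.
    apply: contrapT => /forallNP h.
    have : e <= 0.
      apply: (@le_half_pow _ _ (2 * C)) => [|k]; first lra.
      by rewrite add0r leNgt; apply/negP/h.
    by rewrite leNgt e0.
  exists (x k); exists k => // j /= kj; rewrite -ball_normE /= distrC.
  exact: le_lt_trans (H' _ _ kj) hk.
exists (lim (x @ \oo)) => k; apply/ler_addgt0Pr => e e0.
have /cvgrPdist_le/(_ e e0)[N _ hN] := cx.
have h1 := hN (maxn N k) (leq_maxl _ _).
have h2 := H' k (maxn N k) (leq_maxr _ _).
rewrite [leRHS]addrC; apply: le_trans (ler_dist_split _ (x (maxn N k)) _) _.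
exact: lerD.
Qed.

Definition solves (F : R -> 'rV[R]_n -> 'rV[R]_n) (a b : R) (x : R -> 'rV[R]_n) :=
  {ae lebesgue_measure, forall t : R, a < t < b -> is_derive t 1 x (F t (x t))}.

Lemma in_itv_near (a b s t : R) : a < t < b ->
  `|s - t| < Num.min (t - a) (b - t) -> a < s < b.
Proof.
move=> /andP[at_ tb]; rewrite lt_min !ltr_norml => /andP[/andP[? ?] /andP[? ?]].
by apply/andP; split; lra.
Qed.

Lemma is_derive_clamp (f : R -> 'rV[R]_n) (a b t : R) (c d : 'rV[R]_n) :
  a < t < b -> is_derive t 1 f d -> is_derive t 1 (fun s => c + f (clamp a b s)) d.
Proof.
move=> tab fd; have /andP[at_ tb] := tab.
apply: (@is_derive_near _ _ (fun s => c + f s) _ t (Num.min (t - a) (b - t))).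
- by rewrite lt_min !subr_gt0 at_.
- move=> s /(in_itv_near tab) /andP[h1 h2].
  by rewrite clamp_id // !ltW.
- have := is_deriveD (is_derive_cst c t (1 : R)) fd.
  by rewrite add0r.
Qed.

(** No integral appears: the last hypothesis supplies some antiderivative along each continuous
    curve in the ball. Two choices of it are compared through [ac_bound2], which only sees
    derivatives, so [T] is a contraction of factor 1/2 whichever antiderivatives are chosen. *)
Lemma picard (F : R -> 'rV[R]_n -> 'rV[R]_n) (a b rho L K t0 : R)
    (z y : 'rV[R]_n) :
  a <= t0 <= b -> 0 <= L -> 0 <= K -> L * (b - a) <= 2^-1 ->
  K * (b - a) <= rho / 2 -> `|y - z| <= rho / 2 ->
  (forall t x, a <= t <= b -> `|x - z| <= rho -> `|F t x| <= K) ->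
  (forall t x x', a <= t <= b -> `|x - z| <= rho -> `|x' - z| <= rho ->
     `|F t x - F t x'| <= L * `|x - x'|) ->
  (forall c : R -> 'rV[R]_n, continuous c -> (forall t, `|c t - z| <= rho) ->
     exists G : R -> 'rV[R]_n, abs_continuous_on a b G /\
       {ae lebesgue_measure, forall t : R, a < t < b ->
          is_derive t 1 G (F t (c t))}) ->
  exists x : R -> 'rV[R]_n, [/\ x t0 = y, forall t, `|x t - z| <= rho,
    forall s t, `|x t - x s| <= K * `|t - s| & solves F a b x].
Proof.
move=> t0ab L0 K0 Lab Kab yz FK FL FI.
have /andP[at0 t0b] := t0ab; have ab := le_trans at0 t0b.
pose Good (c : R -> 'rV[R]_n) := continuous c /\ forall t, `|c t - z| <= rho.
(* [P] has to be a total function; curves outside [Good] get themselves as a dummy value. *)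
have /choice[P hP] : forall c : R -> 'rV[R]_n, exists G : R -> 'rV[R]_n, Good c ->
    abs_continuous_on a b G /\ {ae lebesgue_measure, forall t : R, a < t < b ->
      is_derive t 1 G (F t (c t))}.
  move=> c; have [[cc cz]|nG] := pselect (Good c).
    by have [G hG] := FI c cc cz; exists G.
  by exists c.
pose T c t := (y - P c t0) + P c (clamp a b t).
have T0 c : T c t0 = y by rewrite /T clamp_id // subrK.
have PK c : Good c -> forall s t, a <= s <= b -> a <= t <= b ->
    `|P c t - P c s| <= K * `|t - s|.
  move=> Gc; have [acP aeP] := hP c Gc; apply: ac_bound2 => //.
  apply: ae_imp aeP => t h /[dup] tab /h d; exists (F t (c t)) => //.
  by apply: FK; [case/andP: tab => *; rewrite !ltW|case: Gc].
have TK c : Good c -> forall s t, `|T c t - T c s| <= K * `|t - s|.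
  move=> Gc s t; rewrite /T opprD addrACA subrr add0r.
  apply: le_trans (PK c Gc _ _ (clamp_in s ab) (clamp_in t ab)) _.
  by apply: ler_wpM2l => //; exact: clamp_lip.
have clab s : `|clamp a b s - t0| <= b - a.
  have /andP[h1 h2] := clamp_in s ab; rewrite ler_norml.
  by clear - h1 h2 t0ab; case/andP: t0ab => *; apply/andP; split; lra.
have Ty c : Good c -> forall t, `|T c t - y| <= K * (b - a).
  move=> Gc t; have -> : T c t - y = P c (clamp a b t) - P c t0.
    by rewrite /T addrAC (addrAC y) subrr add0r addrC.
  by apply: le_trans (PK c Gc _ _ t0ab (clamp_in t ab)) _; exact: ler_wpM2l.
have Tz c : Good c -> forall t, `|T c t - z| <= rho.
  move=> Gc t; apply: le_trans (ler_dist_split _ y _) _.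
  have := Ty c Gc t; move: Kab yz; clear; lra.
have GT c : Good c -> Good (T c).
  by move=> Gc; split; [exact: lip_continuous (TK c Gc)|exact: Tz].
have Tcontr c c' (d : R) : Good c -> Good c' -> (forall t, `|c t - c' t| <= d) ->
    forall t, `|T c t - T c' t| <= d * 2^-1.
  move=> Gc Gc' cd t; have d0 : 0 <= d by exact: le_trans (cd a).
  have [acP aeP] := hP c Gc; have [acP' aeP'] := hP c' Gc'.
  have -> : T c t - T c' t = (P c (clamp a b t) - P c' (clamp a b t)) -
      (P c t0 - P c' t0).
    rewrite /T !opprD !addrA opprK.
    have -> : y - P c t0 + P c (clamp a b t) - y = P c (clamp a b t) - P c t0.
      by rewrite addrAC (addrAC y) subrr add0r addrC.
    by rewrite addrAC (addrAC (P c _) (- P c t0)).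
  have Ld : 0 <= L * d by exact: mulr_ge0.
  apply: le_trans (@ac_bound2 _ _ (fun s => P c s - P c' s) a b (L * d) Ld _ _ _ _
    t0ab (clamp_in t ab)) _.
  - exact: ac_sub.
  - apply: ae_imp (ae_and aeP aeP') => s [h1 h2] sab.
    exists (F s (c s) - F s (c' s)); first by apply: is_deriveB; [exact: h1|exact: h2].
    case: Gc Gc' => _ Gc [_ Gc'].
    apply: le_trans (FL _ _ _ _ (Gc s) (Gc' s)) _; last exact: ler_wpM2l.
    by case/andP: sab => *; rewrite !ltW.
  have := ler_wpM2l Ld (clab t); have := ler_wpM2r d0 Lab; clear; lra.
have Gy : Good (cst y).
  split; first by move=> ?; exact: cst_continuous.
  have r0 : 0 <= rho / 2 by exact: le_trans yz.
  by move=> t; apply: le_trans yz _; (clear - r0; lra).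
pose x_ k := iter k T (cst y).
have Gx k : Good (x_ k) by elim: k => //= k; exact: GT.
pose C := K * (b - a).
have C0 : 0 <= C by rewrite mulr_ge0 // subr_ge0.
have xC k t : `|x_ k.+1 t - x_ k t| <= C * 2^-1 ^+ k.
  elim: k t => [|k IH] t.
    by rewrite expr0 mulr1; exact: Ty.
  by rewrite exprSr mulrA; exact: (Tcontr (x_ k.+1) (x_ k)).
have /choice[x xl] t := half_cauchy_limit (xC ^~ t).
have xz t : `|x t - z| <= rho.
  apply: (@le_half_pow _ _ (2 * C)) => [|k]; first by clear - C0; lra.
  apply: le_trans (ler_dist_split _ (x_ k t) _) _; rewrite addrC lerD //.
  by have [_] := Gx k.
have xK s t : `|x t - x s| <= K * `|t - s|.
  apply: (@le_half_pow _ _ (4 * C)) => [|k]; first by clear - C0; lra.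
  have h3 : `|x_ k.+1 t - x_ k.+1 s| <= K * `|t - s| by exact: TK.
  have := ler_dist_split (x t) (x_ k.+1 t) (x s).
  have := ler_dist_split (x_ k.+1 t) (x_ k.+1 s) (x s).
  have := xl t k.+1; have := xl s k.+1; rewrite (distrC (x s)) !exprS.
  have : 0 <= C * 2^-1 ^+ k by rewrite mulr_ge0 // exprn_ge0.
  move: h3; set y1 := 2^-1 ^+ k; clear; lra.
have Gxx : Good x by split; [exact: lip_continuous xK|].
(* At step [k], the distance from [T x] to [x_ k.+1 = T (x_ k)] and that from [x_ k.+1] to [x] are
   each at most [C * 2^-1 ^+ k]. *)
have Tx : T x = x.
  apply/funext => t; apply/eqP; rewrite -subr_eq0 -normr_le0.
  apply: (@le_half_pow _ _ (2 * C)) => [|k]; first by clear - C0; lra.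
  rewrite add0r.
  have := Tcontr x (x_ k) (2 * C * 2^-1 ^+ k) Gxx (Gx k) (fun s => xl s k) t.
  have := xl t k.+1; rewrite exprS.
  have := ler_dist_split (T x t) (x_ k.+1 t) (x t).
  rewrite (distrC (x_ k.+1 t)).
  have -> : T (x_ k) t = x_ k.+1 t by [].
  set y1 := 2^-1 ^+ k; clear; lra.
exists x; split => //; first by rewrite -Tx T0.
have [acP aeP] := hP x Gxx.
apply: ae_imp aeP => t h /[dup] tab /h d.
by rewrite -{1}Tx; exact: is_derive_clamp.
Qed.

End Picard.

(** * Control-affine right-hand sides and their linearisations *)

Section ControlAffine.
Context {R : realType} {m : nat}.
Implicit Types w : R -> 'I_m -> R.

Definition affine n (f : 'I_m -> 'rV[R]_n -> 'rV[R]_n) w (t : R) (x : 'rV[R]_n) :=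
  \sum_j w t j *: f j x.

Definition daffine n (f : 'I_m -> 'rV[R]_n -> 'rV[R]_n) w (t : R)
  (x v : 'rV[R]_n) := \sum_j w t j *: 'd (f j) x v.

(** One formula with two roles: for a vector field [f] it is the complete lift in induced
    coordinates, and for a change of coordinates [f] it is the tangent map. *)
Definition lift_field n (f : 'rV[R]_n -> 'rV[R]_n) (z : 'rV[R]_(n + n)) :
  'rV[R]_(n + n) := row_mx (f (lsubmx z)) ('d f (lsubmx z) (rsubmx z)).

Lemma lift_field_smooth n (D : set 'rV[R]_n) f : open D -> smooth_on D f ->
  smooth_on (lsubmx @^-1` D) (lift_field f).
Proof.
move=> oD sf k.
have lcont : continuous (lsubmx : 'rV[R]_(n + n) -> 'rV[R]_n).
  exact: continuous_lsubmx.
have oT : open (lsubmx @^-1` D : set 'rV[R]_(n + n)).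
  by apply: open_comp => // z _; exact: lcont.
apply: CkP => // l; case: (split_ordP l) => a ->.
  under [X in Ck _ _ X]eq_fun do rewrite row_mxEl.
  by apply: Ck_coord => //; exact: Ck_comp_lin oD lcont (sf k).
(* Expanding the fibre part over the basis leaves only differentials at fixed vectors, which is what
   [Ck] controls. *)
have E (z : 'rV[R]_(n + n)) : lift_field f z 0 (rshift n a) =
    \sum_(b < n) z 0 (rshift n b) * 'd f (lsubmx z) (delta_mx 0 b) 0 a.
  rewrite row_mxEr {1}(row_sum_delta (rsubmx z)) linear_sum summxE.
  by apply: eq_bigr => b _; rewrite linearZ /= !mxE.
rewrite (funext E); apply: Ck_sum => // b; apply: Ck_mul => //.
  exact: Ck_coordinate.
apply: Ck_coord => //; have [_ ds] := sf k.+1.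
exact: Ck_comp_lin oD lcont (ds (delta_mx 0 b)).
Qed.

Lemma affine_lift n (f : 'I_m -> 'rV[R]_n -> 'rV[R]_n) w t z :
  affine (fun j => lift_field (f j)) w t z =
  row_mx (affine f w t (lsubmx z)) (daffine f w t (lsubmx z) (rsubmx z)).
Proof.
apply/rowP => i; rewrite summxE; case: (split_ordP i) => j ->.
  by rewrite row_mxEl summxE; apply: eq_bigr => k _; rewrite [LHS]mxE [RHS]mxE row_mxEl.
by rewrite row_mxEr summxE; apply: eq_bigr => k _; rewrite [LHS]mxE [RHS]mxE row_mxEr.
Qed.

Lemma sum_scale_bound n (w : 'I_m -> R) (v : 'I_m -> 'rV[R]_n) (W A : R) :
  (forall j, `|w j| <= W) -> (forall j, `|v j| <= A) ->
  `|\sum_j w j *: v j| <= m%:R * (W * A).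
Proof.
move=> hw hv; apply: le_trans (ler_norm_sum _ _ _) _.
apply: (@le_trans _ _ (\sum_(j < m) W * A)).
  by apply: ler_sum => j _; rewrite normrZ ler_pM.
by rewrite sumr_const card_ord mulr_natl.
Qed.

Lemma affine_antiderivative n (f : 'I_m -> 'rV[R]_n -> 'rV[R]_n) w (a b W A : R)
    (c : R -> 'rV[R]_n) : a < b -> 0 <= W -> 0 <= A ->
  (forall j, lebesgue_measurable_fun (w ^~ j)) ->
  (forall t j, a <= t <= b -> `|w t j| <= W) ->
  (forall j, continuous (f j \o c)) -> (forall j t, `|f j (c t)| <= A) ->
  exists G : R -> 'rV[R]_n, abs_continuous_on a b G /\
    {ae lebesgue_measure, forall t : R, a < t < b ->
       is_derive t 1 G (affine f w t (c t))}.
Proof.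
move=> ab W0 A0 mw wW cf fA.
have bnd j (l : 'I_n) t : a <= t <= b -> `|w t j * (f j (c t) 0 l)| <= W * A.
  move=> tab; rewrite normrM ler_pM //; first exact: wW.
  exact: le_trans (rV_coord_le _ _) (fA j t).
have cc j (l : 'I_n) : continuous (fun t => f j (c t) 0 l : R).
  move=> t; apply: (@continuous_comp _ _ _ (f j \o c) (fun x : 'rV[R]_n => x 0 l : R)).
    exact: cf.
  exact: coord_continuous.
have /choice[G hG] (p : 'I_m * 'I_n) := antiderivative ab (mw p.1) (@cc p.1 p.2) (bnd p.1 p.2).
exists (fun t => \row_l \sum_j G (j, l) t); split.
  apply: (@lip_ac _ _ _ _ _ (m%:R * (W * A))) => s t as_ st tb.
  have WA : 0 <= m%:R * (W * A) by rewrite !mulr_ge0.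
  apply: rV_norm_le => [|l]; first by rewrite mulr_ge0 // subr_ge0.
  rewrite !mxE -sumrB; apply: le_trans (ler_norm_sum _ _ _) _.
  apply: (@le_trans _ _ (\sum_(j < m) W * A * (t - s))).
    by apply: ler_sum => j _; have [h _] := hG (j, l); exact: h.
  by rewrite sumr_const card_ord -[leLHS]mulr_natl !mulrA.
have H (p : 'I_m * 'I_n) : {ae lebesgue_measure, forall t : R, a < t < b ->
    is_derive t 1 (G p) (w t p.1 * f p.1 (c t) 0 p.2)} by have [] := hG p.
apply: ae_imp (ae_fin H) => t h tab; apply/is_derive_coord => l.
rewrite summxE.
have -> : (fun s : R => (\row_l \sum_j G (j, l) s) 0 l : R) = \sum_j G (j, l).
  by apply/funext => s; rewrite mxE fct_sumE.
have -> : \sum_j (w t j *: f j (c t)) 0 l = \sum_j w t j * f j (c t) 0 l.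
  by apply: eq_bigr => j _; rewrite mxE.
by apply: is_derive_sum => j; exact: (h (j, l)).
Qed.

Lemma affine_bounds n (f : 'I_m -> 'rV[R]_n -> 'rV[R]_n) (D : set 'rV[R]_n) z :
  open D -> D z -> (forall j, Ck 1 D (f j)) -> forall W : R, 0 <= W ->
  exists rho L K A : R, [/\ 0 < rho, 0 <= L, 0 <= K /\ 0 <= A,
    forall x, `|x - z| < rho -> D x /\ forall j, `|f j x| <= A &
    forall w t, (forall j, `|w t j| <= W) ->
      [/\ forall x, `|x - z| < rho -> `|affine f w t x| <= K,
          forall x y, `|x - z| < rho -> `|y - z| < rho ->
            `|affine f w t x - affine f w t y| <= L * `|x - y| &
          forall x v, `|x - z| < rho -> `|daffine f w t x v| <= L * `|v| ] ].
Proof.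
move=> oD Dz cf W W0.
have /choice[r /choice[L hrL]] j := C1_bound oD (cf j) Dz.
have H0 : nbhs z D by exact: open_nbhs_nbhs.
have H j : nbhs z (fun x => `|x - z| < r j /\ `|f j x| <= `|f j z| + L j * r j).
  have [r0 L0 _ _ hL] := hrL j.
  apply/nbhs_normedP; exists (r j) => // x xr.
  split => //; have := hL x z xr; rewrite subrr normr0 => /(_ r0) h.
  have := ler_dist_split (f j x) (f j z) 0; rewrite !subr0 => /le_trans; apply.
  rewrite addrC lerD2l; apply: le_trans h _; apply: ler_wpM2l => //; exact: ltW.
have /nbhs_normedP[q q0 hq] : nbhs z (fun x => D x /\ forall j, `|x - z| < r j /\
    `|f j x| <= `|f j z| + L j * r j).
  exact: filterI H0 (filter_forall _ H).
pose LL := \sum_j L j; pose A := \sum_j (`|f j z| + L j * r j).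
have L0 j : 0 <= L j by have [] := hrL j.
have r0 j : 0 <= r j by have [/ltW] := hrL j.
have LLj j : L j <= LL.
  by rewrite /LL (bigD1 j) //= lerDl sumr_ge0.
have Aj j : `|f j z| + L j * r j <= A.
  rewrite /A (bigD1 j) //= lerDl sumr_ge0 // => i _.
  by rewrite addr_ge0 // mulr_ge0.
have LL0 : 0 <= LL by exact: sumr_ge0.
have A0 : 0 <= A by apply: sumr_ge0 => j _; rewrite addr_ge0 // mulr_ge0.
exists q, (m%:R * (W * LL)), (m%:R * (W * A)), A; split => //.
- by rewrite mulr_ge0 // mulr_ge0.
- by rewrite mulr_ge0 // mulr_ge0.
- move=> x /hq[Dx h]; split => // j.
  by have [_ h'] := h j; exact: le_trans (Aj j).
move=> w t hw; split.
- move=> x /hq[_ h]; apply: sum_scale_bound => // j.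
  by have [_ h'] := h j; exact: le_trans (Aj j).
- move=> x y /hq[_ hx] /hq[_ hy]; rewrite -sumrB.
  under eq_bigr do rewrite -scalerBr.
  rewrite -!mulrA; apply: sum_scale_bound => // j.
  have [xr _] := hx j; have [yr _] := hy j; have [_ _ _ _ h] := hrL j.
  by apply: le_trans (h _ _ xr yr) _; exact: ler_wpM2r.
- move=> x v /hq[_ hx]; rewrite -!mulrA; apply: sum_scale_bound => // j.
  have [xr _] := hx j; have [_ _ _ h _] := hrL j.
  by apply: le_trans (h _ _ xr) _; exact: ler_wpM2r.
Qed.

Lemma affine_taylor n (f : 'I_m -> 'rV[R]_n -> 'rV[R]_n) (D : set 'rV[R]_n) z :
  open D -> D z -> (forall j, Ck 2 D (f j)) -> forall W : R, 0 <= W ->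
  exists rho C : R, [/\ 0 < rho, 0 <= C &
    forall w t, (forall j, `|w t j| <= W) ->
      forall x y, `|x - z| < rho -> `|y - z| < rho ->
        `|affine f w t x - affine f w t y - daffine f w t y (x - y)| <=
          C * `|x - y| ^+ 2 ].
Proof.
move=> oD Dz cf W W0.
have /choice[r /choice[C hrC]] j := C2_taylor oD (cf j) Dz.
have H j : nbhs z (fun x => `|x - z| < r j).
  by apply/nbhs_normedP; exists (r j) => //; have [] := hrC j.
have /nbhs_normedP[q q0 hq] : nbhs z (fun x => forall j, `|x - z| < r j).
  exact: filter_forall _ H.
pose CC := \sum_j C j.
have C0 j : 0 <= C j by have [] := hrC j.
have CCj j : C j <= CC by rewrite /CC (bigD1 j) //= lerDl sumr_ge0.
have CC0 : 0 <= CC by exact: sumr_ge0.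
exists q, (m%:R * (W * CC)); split => //; first by rewrite mulr_ge0 // mulr_ge0.
move=> w t hw x y /hq hx /hq hy; rewrite /affine /daffine -!sumrB.
under eq_bigr do rewrite -!scalerBr.
rewrite -!mulrA; apply: sum_scale_bound => // j.
have [_ _ _ _ h] := hrC j.
by apply: le_trans (h _ _ (hx j) (hy j)) _; apply: ler_wpM2r => //; exact: sqr_ge0.
Qed.

End ControlAffine.

(** * The local flow and its derivative in the initial point *)

Section LocalFlow.
Context {R : realType} {m : nat}.

Lemma is_derive_row_mx n p (f : R -> 'rV[R]_n) (g : R -> 'rV[R]_p) (t : R) d e :
  is_derive t 1 f d -> is_derive t 1 g e ->
  is_derive t 1 (fun s => row_mx (f s) (g s)) (row_mx d e).
Proof.
move=> /is_derive_coord fd /is_derive_coord ge; apply/is_derive_coord => i.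
case: (split_ordP i) => j ->.
  by rewrite row_mxEl; under eq_fun do rewrite row_mxEl.
by rewrite row_mxEr; under eq_fun do rewrite row_mxEr.
Qed.

Lemma is_derive_lsubmx n p (f : R -> 'rV[R]_(n + p)) (t : R) d :
  is_derive t 1 f d -> is_derive t 1 (fun s => lsubmx (f s)) (lsubmx d).
Proof.
move=> /is_derive_coord fd; apply/is_derive_coord => i.
by rewrite mxE; under eq_fun do rewrite mxE.
Qed.

Lemma is_derive_rsubmx n p (f : R -> 'rV[R]_(n + p)) (t : R) d :
  is_derive t 1 f d -> is_derive t 1 (fun s => rsubmx (f s)) (rsubmx d).
Proof.
move=> /is_derive_coord fd; apply/is_derive_coord => i.
by rewrite mxE; under eq_fun do rewrite mxE.
Qed.

Section Local.
Context {n : nat}.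
Variables (f : 'I_m -> 'rV[R]_n -> 'rV[R]_n) (D : set 'rV[R]_n) (z : 'rV[R]_n).
Variables (w : R -> 'I_m -> R) (t1 W : R).
Hypotheses (oD : open D) (Dz : D z).
Hypothesis mw : forall j, lebesgue_measurable_fun (w ^~ j).
Hypothesis wW : forall t j, `|t - t1| <= 1 -> `|w t j| <= W.

Hypothesis W0 : 0 <= W.

Lemma local_bounds : (forall j, Ck 1 D (f j)) ->
  exists rho L K : R, [/\ 0 < rho, 0 <= L, 0 <= K,
    forall x, `|x - z| <= rho -> D x &
    forall t, `|t - t1| <= 1 ->
      [/\ forall x, `|x - z| <= rho -> `|affine f w t x| <= K,
          forall x y, `|x - z| <= rho -> `|y - z| <= rho ->
            `|affine f w t x - affine f w t y| <= L * `|x - y| &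
          forall x v, `|x - z| <= rho -> `|daffine f w t x v| <= L * `|v| ] ].
Proof.
move=> cf; have [rho [L [K [A [r0 L0 [K0 _] hD hF]]]]] := affine_bounds oD Dz cf W0.
have lt x : `|x - z| <= rho / 2 -> `|x - z| < rho by move=> h; lra.
exists (rho / 2), L, K; split => //; first by rewrite divr_gt0.
  by move=> x /lt /hD[].
move=> t tt; have [|h1 h2 h3] := hF w t; first by move=> j; exact: wW.
split.
- by move=> x /lt; exact: h1.
- by move=> x y /lt xr /lt yr; exact: h2.
- by move=> x v /lt; exact: h3.
Qed.

(** The constants are fixed before [r] and [eps], so that both can be shrunk later, and one time
    interval serves all initial times in it and all initial points of the half ball. *)
Lemma local_existence : (forall j, Ck 1 D (f j)) ->
  exists rho L K : R, [/\ 0 < rho, 0 <= L, 0 <= K,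
    forall x, `|x - z| <= rho -> D x &
    forall r eps t0 y, 0 < r <= rho -> 0 < eps <= 1 ->
      L * (2 * eps) <= 2^-1 -> K * (2 * eps) <= r / 2 ->
      t1 - eps <= t0 <= t1 + eps -> `|y - z| <= r / 2 ->
      exists x : R -> 'rV[R]_n, [/\ x t0 = y, forall t, `|x t - z| <= r,
        forall s t, `|x t - x s| <= K * `|t - s| &
        solves (affine f w) (t1 - eps) (t1 + eps) x] ].
Proof.
move=> cf; have [rho [L [K [A [r0 L0 [K0 A0] hD hF]]]]] := affine_bounds oD Dz cf W0.
have lt x : `|x - z| <= rho / 2 -> `|x - z| < rho by move=> h; lra.
exists (rho / 2), L, K; split => //; first by rewrite divr_gt0.
  by move=> x /lt /hD[].
move=> r eps t0 y /andP[rp rr] /andP[eps0 eps1] Le Ke t0ab yr.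
have ltr x : `|x - z| <= r -> `|x - z| < rho by move=> h; apply: lt; exact: le_trans rr.
have E : t1 + eps - (t1 - eps) = 2 * eps by ring.
have tt t : t1 - eps <= t <= t1 + eps -> forall j, `|w t j| <= W.
  by move=> h j; apply: wW; apply: le_trans eps1; rewrite ler_distl.
apply: (@picard _ _ (affine f w) _ _ r L K) => //; rewrite ?E //.
- by move=> t x /tt h /ltr xr; have [h1 _ _] := hF w t h; exact: h1.
- move=> t x x' /tt h /ltr xr /ltr xr'.
  by have [_ h2 _] := hF w t h; exact: h2.
move=> c cc cz; apply: (@affine_antiderivative _ _ _ f w _ _ W A) => //.
- lra.
- by move=> t j /tt.
- move=> j t; apply: continuous_comp; first exact: cc.
  by apply: (Ck_cont (cf j)); have [] := hD _ (ltr _ (cz t)).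
- by move=> j t; have [_] := hD _ (ltr _ (cz t)).
Qed.

Lemma local_uniqueness : (forall j, Ck 1 D (f j)) ->
  exists eps rho K : R, [/\ 0 < eps, 0 < rho, 0 <= K,
    forall a b x, t1 - eps <= a -> b <= t1 + eps ->
      abs_continuous_on a b x -> solves (affine f w) a b x ->
      (forall t, a <= t <= b -> `|x t - z| <= rho) ->
      forall s t, a <= s <= b -> a <= t <= b -> `|x t - x s| <= K * `|t - s| &
    forall a b x x' t0, t1 - eps <= a -> b <= t1 + eps -> a <= t0 <= b ->
      abs_continuous_on a b x -> abs_continuous_on a b x' ->
      solves (affine f w) a b x -> solves (affine f w) a b x' ->
      (forall t, a <= t <= b -> `|x t - z| <= rho /\ `|x' t - z| <= rho) ->
      x t0 = x' t0 -> forall t, a <= t <= b -> x t = x' t ].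
Proof.
move=> /local_bounds[rho [L [K [r0 L0 K0 hD hF]]]].
(* Chosen so that [L] times the length [2 * eps] is at most 1/2, as [short_gronwall] requires;
   [L + 1] also covers [L = 0]. *)
pose eps : R := Num.min 1 (4^-1 / (L + 1)).
have L1 : 0 < L + 1 by lra.
have eps0 : 0 < eps by rewrite lt_min ltr01 divr_gt0.
have eps1 : eps <= 1 by rewrite ge_min lexx.
have epsL : L * (2 * eps) <= 2^-1.
  have : eps <= 4^-1 / (L + 1) by rewrite ge_min lexx orbT.
  rewrite ler_pdivlMr // => h.
  have : L * eps <= eps * (L + 1) by rewrite mulrC; apply: ler_wpM2l; lra.
  lra.
have tt a b t : t1 - eps <= a -> b <= t1 + eps -> a < t < b -> `|t - t1| <= 1.
  move=> h1 h2 /andP[h3 h4]; apply: le_trans eps1.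
  by rewrite ler_distl (le_trans h1 (ltW h3)) (le_trans (ltW h4) h2).
have ltle (a b t : R) : a < t < b -> a <= t <= b by case/andP => *; rewrite !ltW.
exists eps, rho, K; split => //.
  move=> a b x ha hb acx sx xr; apply: ac_bound2 => //.
  apply: ae_imp sx => t h /[dup] tab /h d; exists (affine f w t (x t)) => //.
  by have [h1 _ _] := hF t (tt _ _ _ ha hb tab); apply/h1/xr/ltle.
move=> a b x x' t0 ha hb t0ab acx acx' sx sx' xr e t tab.
have /andP[at0 t0b] := t0ab.
have := @short_gronwall _ _ (fun s => x s - x' s) a b L 0 t0 L0 (lexx 0).
rewrite e subrr normr0 mul0r addr0 mulr0 => h.
apply/eqP; rewrite -subr_eq0 -normr_le0; apply: h => //.
- by apply: le_trans epsL; apply: ler_wpM2l => //; lra.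
- exact: ac_sub.
apply: ae_imp (ae_and sx sx') => s [h1 h2] sab.
exists (affine f w s (x s) - affine f w s (x' s)).
  by apply: is_deriveB; [exact: h1|exact: h2].
rewrite addr0; have [_ hl _] := hF s (tt _ _ _ ha hb sab).
by have [xr1 xr2] := xr s (ltle _ _ _ sab); exact: hl.
Qed.

End Local.

Lemma affine_lsubmx n (f : 'I_m -> 'rV[R]_n -> 'rV[R]_n) w t z :
  lsubmx (affine (fun j => lift_field (f j)) w t z) = affine f w t (lsubmx z).
Proof. by rewrite affine_lift row_mxKl. Qed.

Lemma affine_rsubmx n (f : 'I_m -> 'rV[R]_n -> 'rV[R]_n) w t z :
  rsubmx (affine (fun j => lift_field (f j)) w t z) =
  daffine f w t (lsubmx z) (rsubmx z).
Proof. by rewrite affine_lift row_mxKr. Qed.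

Lemma daffine_sum n (f : 'I_m -> 'rV[R]_n -> 'rV[R]_n) w t x (h : 'rV[R]_n)
    (W : 'I_n -> 'rV[R]_n) :
  daffine f w t x (\sum_k h 0 k *: W k) = \sum_k h 0 k *: daffine f w t x (W k).
Proof.
rewrite /daffine; under eq_bigr do rewrite linear_sum scaler_sumr.
rewrite exchange_big; apply: eq_bigr => k _; rewrite scaler_sumr.
by apply: eq_bigr => j _; rewrite linearZ /= !scalerA mulrC.
Qed.

Lemma daffineB n (f : 'I_m -> 'rV[R]_n -> 'rV[R]_n) w t x (u v : 'rV[R]_n) :
  daffine f w t x (u - v) = daffine f w t x u - daffine f w t x v.
Proof.
by rewrite /daffine -sumrB; apply: eq_bigr => j _; rewrite linearB scalerBr.
Qed.

Lemma daffineZ n (f : 'I_m -> 'rV[R]_n -> 'rV[R]_n) w t x c (v : 'rV[R]_n) :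
  daffine f w t x (c *: v) = c *: daffine f w t x v.
Proof.
rewrite /daffine scaler_sumr; apply: eq_bigr => j _.
by rewrite linearZ /= !scalerA mulrC.
Qed.

(** The lifted system is solved from [(y, lam e_k)] for each basis vector. The base parts all
    coincide with [xi], and the fibre parts, rescaled, are the columns of a linear map [wh]. The
    remainder [xi (y + h) - xi y - wh h] starts at 0 and satisfies a Gronwall inequality with source
    quadratic in [h], so [wh] is the differential. *)
Lemma local_flow n (f : 'I_m -> 'rV[R]_n -> 'rV[R]_n) (D : set 'rV[R]_n)
    (z : 'rV[R]_n) (w : R -> 'I_m -> R) (t1 W : R) : open D -> D z ->
  (forall j, lebesgue_measurable_fun (w ^~ j)) ->
  (forall t j, `|t - t1| <= 1 -> `|w t j| <= W) -> 0 <= W ->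
  (forall j, smooth_on D (f j)) ->
  exists (eps del : R) (xi : R -> 'rV[R]_n -> R -> 'rV[R]_n),
  [/\ 0 < eps, 0 < del & forall t0 y, t1 - eps <= t0 <= t1 + eps -> `|y - z| < del ->
    [/\ xi t0 y t0 = y, forall t, D (xi t0 y t),
      exists K, forall s t, `|xi t0 y t - xi t0 y s| <= K * `|t - s|,
      solves (affine f w) (t1 - eps) (t1 + eps) (xi t0 y) &
      (forall t, t1 - eps <= t <= t1 + eps ->
        differentiable (fun y' => xi t0 y' t) y) /\
      forall v, let g t := row_mx (xi t0 y t) ('d (fun y' => xi t0 y' t) y v) in
        (exists K, forall s t, t1 - eps <= s <= t1 + eps ->
           t1 - eps <= t <= t1 + eps -> `|g t - g s| <= K * `|t - s|) /\
        solves (affine (fun j => lift_field (f j)) w) (t1 - eps) (t1 + eps) g ]].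
Proof.
move=> oD Dz mw wW W0 sf.
pose DD : set 'rV[R]_(n + n) := lsubmx @^-1` D.
pose zz : 'rV[R]_(n + n) := row_mx z 0.
have oDD : open DD.
  by apply: open_comp => // x _; exact: continuous_lsubmx.
have DDz : DD zz by rewrite /DD /zz /= row_mxKl.
have [r1 [L1 [K1 [r10 L10 K10 hDD hex]]]] := local_existence oDD DDz mw wW W0
  (fun j => lift_field_smooth oD (sf j) 1%N).
have [r2 [L2 [K2 [r20 L20 K20 hD hF]]]] := local_bounds oD Dz wW W0
  (fun j => sf j 1%N).
have [r3 [C [r30 C0 hC]]] := affine_taylor oD Dz (fun j => sf j 2%N) W0.
(* Halving [r3] turns the strict ball of the Taylor estimate into one containing the closed ball of
   radius [r]. *)
pose r := Num.min r1 (Num.min r2 (r3 / 2)).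
have r0 : 0 < r by rewrite !lt_min r10 r20 divr_gt0.
have rr1 : r <= r1 by rewrite ge_min lexx.
have rr2 : r <= r2 by rewrite !ge_min lexx orbT.
have rr3 : r < r3.
  have : r <= r3 / 2 by rewrite !ge_min lexx !orbT.
  by clear - r30; lra.
(* One summand for each smallness condition on [eps = 4^-1 / N]: both Lipschitz constants times the
   length stay below 1/2, solutions travel at most [r / 2], and [eps <= 1]. *)
pose N := L1 + L2 + (K1 + 1) / r + 1.
have Kr0 : 0 <= (K1 + 1) / r by rewrite divr_ge0 // ?ltW //; by clear - K10; lra.
have N0 : 0 < N by rewrite /N; clear - L10 L20 Kr0; lra.
pose eps : R := 4^-1 / N.
have eps0 : 0 < eps by rewrite divr_gt0.
have epsN : eps * N = 4^-1 by rewrite /eps divfK // gt_eqF.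
have eps1 : eps <= 1 by rewrite /eps ler_pdivrMr // /N; clear - L10 L20 Kr0; lra.
have epsL1 : L1 * (2 * eps) <= 2^-1.
  have : eps * L1 <= eps * N by apply: ler_wpM2l; [exact: ltW|rewrite /N; clear - L10 L20 Kr0; lra].
  by clear - epsN; lra.
have epsL2 : L2 * (2 * eps) <= 2^-1.
  have : eps * L2 <= eps * N by apply: ler_wpM2l; [exact: ltW|rewrite /N; clear - L10 L20 Kr0; lra].
  by clear - epsN; lra.
have epsK1 : K1 * (2 * eps) <= r / 2.
  have : eps * ((K1 + 1) / r) <= eps * N by apply: ler_wpM2l; [exact: ltW|rewrite /N; clear - L10 L20 Kr0; lra].
  rewrite epsN mulrA ler_pdivrMr // => h; clear - h eps0; lra.
have E : t1 + eps - (t1 - eps) = 2 * eps by ring.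
have r2p : 0 < r / 2 by rewrite divr_gt0.
pose inI t := t1 - eps <= t <= t1 + eps.
pose good (p : R * 'rV[R]_n * 'rV[R]_n) := [/\ inI p.1.1, `|p.1.2 - z| <= r / 2 &
  `|p.2| <= r / 2].
have /choice[X hX] : forall p : R * 'rV[R]_n * 'rV[R]_n,
    exists x : R -> 'rV[R]_(n + n), good p ->
    [/\ x p.1.1 = row_mx p.1.2 p.2, forall t, `|x t - zz| <= r,
        forall s t, `|x t - x s| <= K1 * `|t - s| &
        solves (affine (fun j => lift_field (f j)) w) (t1 - eps) (t1 + eps) x].
  move=> p; have [[pI py pv]|ng] := pselect (good p); last by exists (fun=> 0).
  have [|||||| x hx] := hex r eps p.1.1 (row_mx p.1.2 p.2) => //.
  - by rewrite r0.
  - by rewrite eps0.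
  - rewrite /zz opp_row_mx add_row_mx subr0; exact: norm_row_mx_le.
  by exists x.
pose xi t0 y t := lsubmx (X (t0, y, 0) t).
(* Existence holds only for initial data near [(z, 0)], so basis vectors are scaled down to norm at
   most [r / 2]; linearity in the fibre allows scaling back by [lam^-1] in [Wk]. *)
pose lam := r / 2.
have dlt (k : 'I_n) : `|lam *: (delta_mx 0 k : 'rV[R]_n)| <= r / 2.
  rewrite normrZ gtr0_norm // -[leRHS]mulr1; apply: ler_wpM2l; first exact: ltW.
  by apply: rV_norm_le => // i; rewrite mxE; case: (_ && _); rewrite ?normr1 ?normr0.
pose Wk t0 y t k := lam^-1 *: rsubmx (X (t0, y, lam *: delta_mx 0 k) t).
have lsub_z (x : 'rV[R]_(n + n)) : `|x - zz| <= r -> `|lsubmx x - z| <= r.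
  move=> h; apply: le_trans h; apply: le_trans (norm_lsubmx (x - zz)).
  by rewrite linearB /= row_mxKl.
have lsub_lip p : good p -> forall s t,
    `|lsubmx (X p t) - lsubmx (X p s)| <= K1 * `|t - s|.
  move=> gp s t; have [_ _ h _] := hX p gp; apply: le_trans (h s t).
  by apply: le_trans (norm_lsubmx (X p t - X p s)); rewrite linearB.
have rsub_lip p : good p -> forall s t,
    `|rsubmx (X p t) - rsubmx (X p s)| <= K1 * `|t - s|.
  move=> gp s t; have [_ _ h _] := hX p gp; apply: le_trans (h s t).
  by apply: le_trans (norm_rsubmx (X p t - X p s)); rewrite linearB.
have lsub_ac p : good p ->
    abs_continuous_on (t1 - eps) (t1 + eps) (fun t => lsubmx (X p t)).
  move=> gp; apply: (@lip_ac _ _ _ _ _ K1) => s t _ st _.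
  by have := lsub_lip p gp s t; rewrite (ger0_norm (_ : 0 <= t - s)) // subr_ge0.
have rsub_ac p : good p ->
    abs_continuous_on (t1 - eps) (t1 + eps) (fun t => rsubmx (X p t)).
  move=> gp; apply: (@lip_ac _ _ _ _ _ K1) => s t _ st _.
  by have := rsub_lip p gp s t; rewrite (ger0_norm (_ : 0 <= t - s)) // subr_ge0.
have lsub_solves p : good p ->
    solves (affine f w) (t1 - eps) (t1 + eps) (fun t => lsubmx (X p t)).
  move=> gp; have [_ _ _ h] := hX p gp; apply: ae_imp h => t h tI.
  by rewrite -affine_lsubmx; exact/is_derive_lsubmx/h.
have ltI t : t1 - eps < t < t1 + eps -> inI t.
  by case/andP => *; rewrite /inI !ltW.
have I1 t : inI t -> `|t - t1| <= 1.
  by rewrite /inI -ler_distl => /le_trans; exact.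
have gron p q : good p -> good q -> p.1.1 = q.1.1 -> forall t, inI t ->
    `|lsubmx (X p t) - lsubmx (X q t)| <= 2 * `|p.1.2 - q.1.2|.
  move=> gp gq pq t tI.
  have [Xp xpr _ _] := hX p gp; have [Xq xqr _ _] := hX q gq.
  have := @short_gronwall _ _ (fun s => lsubmx (X p s) - lsubmx (X q s))
    (t1 - eps) (t1 + eps) L2 0 p.1.1 L20 (lexx 0).
  rewrite -pq in Xq; rewrite Xp Xq !row_mxKl mul0r addr0 E; apply => //.
  - by apply: ac_sub; exact: lsub_ac.
  - apply: ae_imp (ae_and (lsub_solves p gp) (lsub_solves q gq)) => s [h1 h2] sI.
    exists (affine f w s (lsubmx (X p s)) - affine f w s (lsubmx (X q s))).
      by apply: is_deriveB; [exact: h1|exact: h2].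
    rewrite addr0; have [_ h _] := hF s (I1 s (ltI s sI)).
    by apply: h; apply: le_trans rr2; apply: lsub_z.
  by case: gp.
have good0 t0 y : inI t0 -> `|y - z| <= r / 2 -> good (t0, y, 0).
  by move=> h1 h2; split => //=; rewrite normr0 ltW.
have goodk t0 y k : inI t0 -> `|y - z| <= r / 2 ->
    good (t0, y, lam *: delta_mx 0 k).
  by move=> h1 h2; split => //=; exact: dlt.
(* The base part of the lifted system does not involve the fibre, so the estimate [gron] with equal
   starting points forces equality. *)
have xik t0 y k t : inI t0 -> `|y - z| <= r / 2 -> inI t ->
    lsubmx (X (t0, y, lam *: delta_mx 0 k) t) = xi t0 y t.
  move=> h1 h2 tI; apply/eqP; rewrite -subr_eq0 -normr_le0.
  have := gron _ _ (goodk t0 y k h1 h2) (good0 t0 y h1 h2) erefl t tI.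
  by rewrite subrr normr0 mulr0.
exists eps, (r / 2), xi; split => // t0 y t0I yr'; have yr := ltW yr'.
have g0 := good0 t0 y t0I yr; have gk k := goodk t0 y k t0I yr.
have [X0 X0r _ _] := hX _ g0.
have xi0 : xi t0 y t0 = y by rewrite /xi X0 row_mxKl.
pose wh (h : 'rV[R]_n) t := \sum_k h 0 k *: Wk t0 y t k.
have wh_lin t : linear (wh ^~ t).
  move=> a u v; rewrite /wh scaler_sumr -big_split /=; apply: eq_bigr => k _.
  by rewrite !mxE scalerDl scalerA.
have wh_solves h : {ae lebesgue_measure, forall t : R, t1 - eps < t < t1 + eps ->
    is_derive t 1 (wh h) (daffine f w t (xi t0 y t) (wh h t))}.
  have H k : {ae lebesgue_measure, forall t : R, t1 - eps < t < t1 + eps ->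
      is_derive t 1 (fun s => Wk t0 y s k) (daffine f w t (xi t0 y t) (Wk t0 y t k))}.
    have [_ _ _ hk] := hX _ (gk k); apply: ae_imp hk => t hk tI.
    rewrite /Wk daffineZ -(xik t0 y k t t0I yr (ltI t tI)) -affine_rsubmx.
    by apply: is_deriveZ; exact/is_derive_rsubmx/hk.
  apply: ae_imp (ae_fin H) => t hk tI; rewrite /wh daffine_sum.
  have -> : (fun t => \sum_k h 0 k *: Wk t0 y t k) =
      \sum_k (fun t => h 0 k *: Wk t0 y t k).
    by apply/funext => s; rewrite fct_sumE.
  by apply: is_derive_sum => k; apply: is_deriveZ; exact: hk.
have wh_ac h : abs_continuous_on (t1 - eps) (t1 + eps) (wh h).
  by apply: ac_sum => k; do 2 apply: ac_scale; exact: rsub_ac.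
have wh_t0 h : wh h t0 = h.
  rewrite {2}(row_sum_delta h); apply: eq_bigr => k _; congr (_ *: _).
  rewrite /Wk; have [-> _ _ _] := hX _ (gk k); rewrite row_mxKr scalerA mulVf ?scale1r //.
  by rewrite gt_eqF.
(* By [gron] the two base solutions stay within [2 * |h|], so the Taylor error is at most
   [4 * C * |h| ^+ 2]. Gronwall multiplies it by 2 and by the length [2 * eps], which gives 16. *)
have rem h t : inI t -> `|y + h - z| <= r / 2 ->
    `|xi t0 (y + h) t - xi t0 y t - wh h t| <= 16 * C * eps * `|h| ^+ 2.
  move=> tI hr; have g1 := good0 t0 (y + h) t0I hr; have [X1 X1r _ _] := hX _ g1.
  have eta0 : 0 <= 4 * C * `|h| ^+ 2 by rewrite !mulr_ge0 ?sqr_ge0.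
  have := @short_gronwall _ _ (fun s => xi t0 (y + h) s - xi t0 y s - wh h s)
    (t1 - eps) (t1 + eps) L2 (4 * C * `|h| ^+ 2) t0 L20 eta0.
  have -> : xi t0 (y + h) t0 = y + h by rewrite /xi X1 row_mxKl.
  rewrite xi0 wh_t0 (_ : y + h - y - h = 0); last by rewrite (addrC y) addrK subrr.
  rewrite normr0 add0r E.
  have -> : 2 * (4 * C * `|h| ^+ 2 * (2 * eps)) = 16 * C * eps * `|h| ^+ 2 by ring.
  apply => //.
  - by apply: ac_sub; [apply: ac_sub; exact: lsub_ac|].
  - apply: ae_imp (ae_and (ae_and (lsub_solves _ g1) (lsub_solves _ g0)) (wh_solves h)).
    move=> s [[h1 h2] h3] sI; have sI' := ltI s sI.
    exists (affine f w s (xi t0 (y + h) s) - affine f w s (xi t0 y s) -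
            daffine f w s (xi t0 y s) (wh h s)).
      by apply: is_deriveB; [apply: is_deriveB; [exact: h1|exact: h2]|exact: h3].
    set x1 := xi t0 (y + h) s; set x0 := xi t0 y s.
    have x1r : `|x1 - z| <= r by exact: lsub_z.
    have x0r : `|x0 - z| <= r by exact: lsub_z.
    have [_ _ hl] := hF s (I1 s sI').
    have T1 := hl x0 (x1 - x0 - wh h s) (le_trans x0r rr2).
    have T2 : `|affine f w s x1 - affine f w s x0 - daffine f w s x0 (x1 - x0)| <=
        C * `|x1 - x0| ^+ 2.
      apply: hC; [|exact: le_lt_trans rr3|exact: le_lt_trans rr3].
      by move=> j; apply/wW/I1.
    have T3 : `|x1 - x0| <= 2 * `|h|.
      have := gron _ _ g1 g0 erefl s sI'.
      by rewrite /= (_ : y + h - y = h) // addrAC subrr add0r.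
    have -> : affine f w s x1 - affine f w s x0 - daffine f w s x0 (wh h s) =
        daffine f w s x0 (x1 - x0 - wh h s) +
        (affine f w s x1 - affine f w s x0 - daffine f w s x0 (x1 - x0)).
      rewrite (daffineB _ _ _ _ (x1 - x0) (wh h s)) [RHS]addrC [RHS]addrA subrK.
      by [].
    apply: le_trans (ler_normD _ _) (lerD T1 _); apply: le_trans T2 _.
    rewrite (mulrC 4) -mulrA; apply: ler_wpM2l => //.
    have -> : 4 * `|h| ^+ 2 = (2 * `|h|) ^+ 2 by ring.
    by rewrite ler_pXn2r ?nnegrE // mulr_ge0.
have dxi t : inI t -> differentiable (fun y' => xi t0 y' t) y /\
    'd (fun y' => xi t0 y' t) y = wh ^~ t :> ('rV[R]_n -> 'rV[R]_n).
  move=> tI.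
  pose Lm := GRing.isLinear.Build _ _ _ _ _ (wh_lin t).
  pose L : {linear 'rV[R]_n -> 'rV[R]_n} := HB.pack (wh ^~ t) Lm.
  have := @diff_intro R _ _ (fun y' => xi t0 y' t) y L (@lin_continuous _ _ _ L).
  apply => e e0; pose M := 16 * C * eps.
  have M0 : 0 <= M by apply: mulr_ge0; [exact: mulr_ge0|exact: ltW].
  exists (Num.min (r / 2 - `|y - z|) (e / (M + 1))).
    by rewrite lt_min subr_gt0 yr' divr_gt0 // ltr_wpDl.
  move=> y'; rewrite lt_min => /andP[h1 h2].
  have h3 : `|y' - z| <= r / 2.
    apply: le_trans (ler_dist_split y' y z) _.
    by rewrite -lerBrDr ltW.
  have := rem (y' - y) t tI; rewrite (addrC y) subrK => /(_ h3) h.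
  apply: le_trans h _; rewrite -/M expr2 mulrA; apply: ler_wpM2r => //.
  move: h2; rewrite ltr_pdivlMr ?ltr_wpDl // => h2; apply: le_trans (ltW h2).
  by rewrite mulrC; apply: ler_wpM2l => //; rewrite lerDl.
split.
- exact: xi0.
- by move=> t; apply: hD; apply: le_trans rr2; exact: lsub_z.
- by exists K1; exact: lsub_lip.
- exact: lsub_solves.
split=> [t /dxi[]//|v g].
have gE t : inI t -> g t = row_mx (xi t0 y t) (wh v t).
  by move=> /dxi[_ dE]; rewrite /g dE.
pose Kv := \sum_k `|v 0 k| * (lam^-1 * K1).
have lam0 : 0 <= lam^-1 by rewrite invr_ge0 ltW.
have Kv0 : 0 <= Kv by apply: sumr_ge0 => k _; rewrite !mulr_ge0.
split.
  exists (K1 + Kv) => s t sI tI; rewrite !gE // opp_row_mx add_row_mx.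
  apply: norm_row_mx_le.
    by apply: le_trans (lsub_lip _ g0 s t) _; rewrite mulrDl lerDl mulr_ge0.
  apply: (@le_trans _ _ (Kv * `|t - s|)); last first.
    by rewrite mulrDl lerDr mulr_ge0.
  rewrite /wh -sumrB; apply: le_trans (ler_norm_sum _ _ _) _.
  rewrite /Kv mulr_suml; apply: ler_sum => k _.
  rewrite -scalerBr normrZ -mulrA; apply: ler_wpM2l => //.
  rewrite /Wk -scalerBr normrZ ger0_norm // -mulrA; apply: ler_wpM2l => //.
  exact: rsub_lip.
apply: ae_imp (ae_and (lsub_solves _ g0) (wh_solves v)) => t [h1 h2] tI.
rewrite affine_lift (gE t (ltI t tI)) row_mxKl row_mxKr.
apply: (@is_derive_near _ _ (fun s => row_mx (xi t0 y s) (wh v s)) _ t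
  (Num.min (t - (t1 - eps)) (t1 + eps - t))).
- by case/andP: tI => h3 h4; rewrite lt_min !subr_gt0 h3.
- by move=> s /(in_itv_near tI) sI; rewrite gE //; exact: ltI.
by apply: is_derive_row_mx; [exact: h1|exact: h2].
Qed.

End LocalFlow.

(** * Complete lifts in charts *)

Section TangentMap.
Context {R : realType}.

Lemma diff_row_mx (V : normedModType R) n p (f : V -> 'rV[R]_n)
    (g : V -> 'rV[R]_p) (x : V) : differentiable f x -> differentiable g x ->
  differentiable (fun y => row_mx (f y) (g y)) x /\
  'd (fun y => row_mx (f y) (g y)) x =
    (fun v => row_mx ('d f x v) ('d g x v)) :> (V -> 'rV[R]_(n + p)).
Proof.
move=> df dg.
have h : linear (fun v => row_mx ('d f x v) ('d g x v) : 'rV[R]_(n + p)).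
  by move=> a u v; rewrite !linearP scale_row_mx add_row_mx.
pose Lm := GRing.isLinear.Build _ _ _ _ _ h.
pose L : {linear V -> 'rV[R]_(n + p)} :=
  HB.pack (fun v => row_mx ('d f x v) ('d g x v)) Lm.
have cL : continuous L.
  move=> v; apply/cont_normP => e e0.
  have /cont_normP/(_ e e0)[r r0 hr] : {for v, continuous ('d f x)}.
    exact: diff_continuous.
  have /cont_normP/(_ e e0)[q q0 hq] : {for v, continuous ('d g x)}.
    exact: diff_continuous.
  exists (Num.min r q / 2); first by rewrite divr_gt0 // lt_min r0.
  move=> y yv; have m0 : 0 < Num.min r q by rewrite lt_min r0.
  have : `|y - v| < Num.min r q by lra.
  rewrite lt_min => /andP[/hr h1 /hq h2].
  apply: (@le_lt_trans _ _ (Num.max `|'d f x y - 'd f x v| `|'d g x y - 'd g x v|)).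
    rewrite opp_row_mx add_row_mx; apply: norm_row_mx_le.
      by rewrite le_max lexx.
    by rewrite le_max lexx orbT.
  by rewrite gt_max h1.
apply: (@diff_intro R _ _ (fun y => row_mx (f y) (g y)) x L cL) => e e0.
have [r r0 hr] := diff_near df e0; have [q q0 hq] := diff_near dg e0.
exists (Num.min r q); first by rewrite lt_min r0.
move=> y; rewrite lt_min => /andP[/hr h1 /hq h2].
rewrite /L /= opp_row_mx add_row_mx opp_row_mx add_row_mx.
exact: norm_row_mx_le.
Qed.

Lemma diff_graph n p (F : 'rV[R]_n -> 'rV[R]_p) (x : 'rV[R]_n) :
  differentiable F x ->
  differentiable (fun y => row_mx y (F y)) x /\
  'd (fun y => row_mx y (F y)) x =
    (fun v => row_mx v ('d F x v)) :> ('rV[R]_n -> 'rV[R]_(n + p)).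
Proof.
move=> dF; have [|dk kE] := @diff_row_mx _ _ _ id F x _ dF; first exact: ex_diff.
split => //; rewrite kE; apply/funext => v.
by have -> : 'd (@id 'rV[R]_n) x v = v by rewrite diff_val.
Qed.

Lemma linear_lrsubmx n p (W : normedModType R) (A : {linear 'rV[R]_n -> W})
    (B : {linear 'rV[R]_p -> W}) :
  linear (fun c : 'rV[R]_(n + p) => A (lsubmx c) + B (rsubmx c)).
Proof.
move=> a u v.
have -> : lsubmx (a *: u + v) = a *: lsubmx u + lsubmx v.
  by apply/rowP => i; rewrite !mxE.
have -> : rsubmx (a *: u + v) = a *: rsubmx u + rsubmx v.
  by apply/rowP => i; rewrite !mxE.
by rewrite (linearP A) (linearP B) scalerDr addrACA.
Qed.

Lemma tangent_remainder n (W : normedModType R) (G0 G1 : {linear 'rV[R]_n -> W})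
    (A : W) (u v : 'rV[R]_n) :
  G1 v - G0 u - (A + G0 (v - u)) =
  (G1 u - G0 u - A) + (G1 (v - u) - G0 (v - u)).
Proof.
rewrite (linearB G1) opprD addrA [RHS]addrA; congr (_ - _).
by rewrite [RHS]addrC addrA subrKA.
Qed.

(** The remainder splits by [tangent_remainder] into that of the base variable with the vector
    frozen, small by differentiability, and a change of differential applied to a change of vector,
    quadratic by [C2_taylor]. *)
Lemma diff_tangent_map n (W : normedModType R) (g : 'rV[R]_n -> W)
    (D : set 'rV[R]_n) (z : 'rV[R]_(n + n)) :
  open D -> Ck 2 D g -> D (lsubmx z) ->
  differentiable (fun z' : 'rV[R]_(n + n) => 'd g (lsubmx z') (rsubmx z')) z /\
  forall c : 'rV[R]_(n + n),
    'd (fun z' : 'rV[R]_(n + n) => 'd g (lsubmx z') (rsubmx z')) z c =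
    'd (fun y => 'd g y (rsubmx z)) (lsubmx z) (lsubmx c) +
    'd g (lsubmx z) (rsubmx c).
Proof.
move=> oD cg Dz; have [dg ddg] := cg; have [dgv _] := ddg (rsubmx z).
have h := linear_lrsubmx ('d (fun y => 'd g y (rsubmx z)) (lsubmx z))
  ('d g (lsubmx z)).
pose Lm := GRing.isLinear.Build _ _ _ _ _ h.
pose L : {linear 'rV[R]_(n + n) -> W} := HB.pack (fun c : 'rV[R]_(n + n) =>
    'd (fun y => 'd g y (rsubmx z)) (lsubmx z) (lsubmx c) +
    'd g (lsubmx z) (rsubmx c)) Lm.
suff [d1 d2] : differentiable (fun z' : 'rV[R]_(n + n) => 'd g (lsubmx z') (rsubmx z')) z /\
  'd (fun z' : 'rV[R]_(n + n) => 'd g (lsubmx z') (rsubmx z')) z = L :> ('rV[R]_(n + n) -> W).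
  by split => // c; rewrite d2.
apply: diff_intro; first exact: lin_continuous.
move=> e e0; have e20 : 0 < e / 2 by rewrite divr_gt0.
have [r [C [r0 C0 hD hC _]]] := C2_taylor oD cg Dz.
have [q q0 hq] := diff_near (dgv _ Dz) e20.
have C1 : 0 < C + 1 by rewrite ltr_wpDl.
exists (Num.min r (Num.min q (e / 2 / (C + 1)))).
  by rewrite !lt_min r0 q0 divr_gt0.
move=> y; rewrite !lt_min => /and3P[yr yq ye].
have lyz : `|lsubmx y - lsubmx z| <= `|y - z| by rewrite -linearB; exact: norm_lsubmx.
have ryz : `|rsubmx y - rsubmx z| <= `|y - z| by rewrite -linearB; exact: norm_rsubmx.
have T1 := hq _ (le_lt_trans lyz yq).
have zz : `|lsubmx z - lsubmx z| < r by rewrite subrr normr0.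
have T2 := hC _ _ (rsubmx y - rsubmx z) (le_lt_trans lyz yr) zz.
have lB : lsubmx (y - z) = lsubmx y - lsubmx z by rewrite linearB.
have rB : rsubmx (y - z) = rsubmx y - rsubmx z by rewrite linearB.
rewrite /L /= lB rB tangent_remainder.
apply: le_trans (ler_normD _ _) _; rewrite [leRHS](_ : _ = e / 2 * `|y - z| + e / 2 * `|y - z|); last by rewrite -mulrDl -splitr.
apply: lerD; first by apply: le_trans T1 _; apply: ler_wpM2l => //; exact: ltW.
apply: le_trans T2 _; apply: ler_pM => //; first by rewrite mulr_ge0.
apply: (@le_trans _ _ (C * `|y - z|)); first exact: ler_wpM2l.
move: ye; rewrite ltr_pdivlMr // => ye; apply: le_trans (ltW ye).
by rewrite mulrC; apply: ler_wpM2l => //; rewrite lerDl.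
Qed.

End TangentMap.

Section LiftField.
Context {R : realType} {n : nat}.

Lemma lsub_lift_field (f : 'rV[R]_n -> 'rV[R]_n) z :
  lsubmx (lift_field f z) = f (lsubmx z).
Proof. exact: row_mxKl. Qed.

Lemma rsub_lift_field (f : 'rV[R]_n -> 'rV[R]_n) z :
  rsubmx (lift_field f z) = 'd f (lsubmx z) (rsubmx z).
Proof. exact: row_mxKr. Qed.

(* The second-order terms on both sides agree because second derivatives are
   symmetric. *)
Lemma lift_field_conjugate (D : set 'rV[R]_n) (T F G : 'rV[R]_n -> 'rV[R]_n)
    (z : 'rV[R]_(n + n)) : open D -> Ck 2 D T -> D (lsubmx z) ->
  differentiable F (lsubmx z) -> differentiable G (T (lsubmx z)) ->
  (forall y, D y -> G (T y) = 'd T y (F y)) ->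
  differentiable (lift_field T) z /\
  'd (lift_field T) z (lift_field F z) = lift_field G (lift_field T z).
Proof.
move=> oD cT Dz dF dG GT; have [dT' _] := cT; have dT := dT' _ Dz.
have [dt dtE] := diff_tangent_map oD cT Dz.
have lcont : continuous (lsubmx : 'rV[R]_(n + n) -> 'rV[R]_n).
  exact: continuous_lsubmx.
have dl : differentiable (fun y : 'rV[R]_(n + n) => T (lsubmx y)) z.
  by apply: differentiable_comp; [exact: linear_differentiable|exact: dT].
have lE : 'd (fun y : 'rV[R]_(n + n) => T (lsubmx y)) z =
    (fun c : 'rV[R]_(n + n) => 'd T (lsubmx z) (lsubmx c)) :> ('rV[R]_(n + n) -> 'rV[R]_n).
  apply: etrans (diff_comp (linear_differentiable z lcont) dT) _.
  by apply/funext => c /=; rewrite diff_lin.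
have [dr rE] := diff_row_mx dl dt.
split => //.
apply: etrans (congr1 (fun l : 'rV[R]_(n + n) -> 'rV[R]_(n + n) => l _) rE) _.
rewrite -[RHS]/(row_mx (G (lsubmx (lift_field T z)))
  ('d G (lsubmx (lift_field T z)) (rsubmx (lift_field T z)))).
rewrite lsub_lift_field rsub_lift_field.
apply: (@congr2 _ _ _ (@row_mx R 1 n n)).
  apply: etrans (congr1 (fun l : 'rV[R]_(n + n) -> 'rV[R]_n => l _) lE) _.
  by rewrite lsub_lift_field GT.
apply: etrans (dtE _) _; rewrite lsub_lift_field rsub_lift_field.
pose k y : 'rV[R]_(n + n) := row_mx y (F y).
have [dk kE] := diff_graph dF.
pose h (y : 'rV[R]_(n + n)) := 'd T (lsubmx y) (rsubmx y).
have Dk : D (lsubmx (k (lsubmx z))) by rewrite row_mxKl.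
have [dh hE] := diff_tangent_map oD cT Dk.
have E2 y : D y -> (G \o T) y = (h \o k) y.
  by move=> Dy; rewrite /= /h row_mxKl row_mxKr; exact: GT.
have [_ d3] := eq_differentiable_on oD Dz E2 (differentiable_comp dT dG).
have L1 := congr1 (fun l : 'rV[R]_n -> 'rV[R]_n => l (rsubmx z)) (diff_comp dT dG).
have L2 := congr1 (fun l : 'rV[R]_n -> 'rV[R]_n => l (rsubmx z)) d3.
have L3 := congr1 (fun l : 'rV[R]_n -> 'rV[R]_n => l (rsubmx z)) (diff_comp dk dh).
have L4 := congr1 (fun l : 'rV[R]_n -> 'rV[R]_(n + n) => l (rsubmx z)) kE.
apply: esym; apply: etrans (esym L1) _; apply: etrans (esym L2) _; apply: etrans L3 _.
apply: etrans (congr1 ('d h (k (lsubmx z))) L4) _.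
apply: etrans (hE _) _.
rewrite !row_mxKl !row_mxKr.
have S := diff_symmetric (F (lsubmx z)) (rsubmx z) oD Dz cT.
exact (congr1 (fun a => a + 'd T (lsubmx z) ('d F (lsubmx z) (rsubmx z))) S).
Qed.

Lemma diff_linear_fun (f : 'rV[R]_n -> R) (x w : 'rV[R]_n) : linear f -> 'd f x w = f w.
Proof.
move=> lf; pose Lm := GRing.isLinear.Build _ _ _ _ _ lf.
pose L : {linear 'rV[R]_n -> R} := HB.pack f Lm.
have := @diff_lin _ _ _ L x (@lin_continuous _ _ _ L).
by move=> h; exact (congr1 (fun l : 'rV[R]_n -> R => l w) h).
Qed.

Lemma diff_coord_mul (k l : 'I_n) (y w : 'rV[R]_n) :
  'd (fun y : 'rV[R]_n => y 0 k * y 0 l : R) y w = y 0 k * w 0 l + y 0 l * w 0 k.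
Proof.
have [Lk kE] := @coordinate_linear R n k; have [Ll lE] := @coordinate_linear R n l.
have -> : (fun y : 'rV[R]_n => y 0 k * y 0 l : R) = (Lk : 'rV[R]_n -> R) * Ll.
  by apply/funext => u; rewrite -kE -lE.
have dk : differentiable Lk y by apply: linear_differentiable; exact: lin_continuous.
have dl : differentiable Ll y by apply: linear_differentiable; exact: lin_continuous.
apply: etrans (congr1 (fun h : 'rV[R]_n -> R => h w) (diffM dk dl)) _.
rewrite -!kE -!lE; apply: (@congr2 _ _ _ (fun a b : R => Lk y * a + Ll y * b)).
  by rewrite diff_lin //; exact: lin_continuous.
by rewrite diff_lin //; exact: lin_continuous.
Qed.

End LiftField.

(** * Differentials in charts and extension of functions *)

Section ManifoldCalculus.
Context {R : realType} {n : nat} {M : manifold R n}.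
Implicit Types (i j : chart M) (x : M) (f : M -> R).

Lemma diff_eq (V W : normedModType R) (g : V -> W) (a b u v : V) :
  a = b -> u = v -> 'd g a u = 'd g b v.
Proof. by move=> -> ->. Qed.

Lemma coord_overlap i j x : cdom i x -> cdom j x ->
  (cimg i `&` cinv i @^-1` cdom j) (coord i x).
Proof. by move=> ix jx; split; [exact: coord_cimg|rewrite /= coordK]. Qed.

Lemma dfun_chart f i x (v : tangent M x) : cdom i x ->
  differentiable (f \o cinv i) (coord i x) ->
  dfun f v = 'd (f \o cinv i) (coord i x) (tcoord i v).
Proof.
move=> ix df; pose c := chart_at x; have cx := chart_at_cdom x.
have oc := coord_overlap cx ix.
have E y : (cimg c `&` cinv c @^-1` cdom i) y ->
    ((f \o cinv i) \o transition c i) y = (f \o cinv c) y.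
  by move=> [cy iy]; rewrite /transition /= coordK.
have Tx : transition c i (coord c x) = coord i x by rewrite /transition /= coordK.
have dT := transition_diff cx ix.
have df' : differentiable (f \o cinv i) (transition c i (coord c x)) by rewrite Tx.
have [_ H] := eq_differentiable_on (open_overlap (i:=c) (j:=i)) oc E
  (differentiable_comp dT df').
transitivity ('d ((f \o cinv i) \o transition c i) (coord c x) v).
  exact (congr1 (fun h : 'rV[R]_n -> R => h v) H).
have H2 := diff_comp dT df'; rewrite -Tx.
exact (congr1 (fun h : 'rV[R]_n -> R => h v) H2).
Qed.

(** The cut-off product is extended by 0. Its support lies in [K], the image of a closed ball, which
    is compact and hence closed because [M] is Hausdorff. So every point has a neighbourhood where
    the function is either the product read in chart [i] or zero. *)
Lemma smooth_fun_extend i x (q : 'rV[R]_n -> R) : cdom i x ->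
  smooth_on setT q ->
  exists f : M -> R, smooth_fun f /\
    \forall z \near coord i x, (f \o cinv i) z = q z.
Proof.
move=> ix sq; set c := coord i x.
have ic : cimg i c by exact: coord_cimg.
have /nbhs_normedP[r0 r00 hr0] : nbhs c (cimg i).
  by apply: open_nbhs_nbhs; split => //; exact: open_cimg.
pose r := r0 / 2; have rp : 0 < r by rewrite divr_gt0.
have [B [sB B0 B1]] := exists_bump c rp.
pose f y := if y \in cdom i then B (coord i y) * q (coord i y) else 0.
pose K := cinv i @` [set z | `|z - c| <= r].
have Ksub z : `|z - c| <= r -> cimg i z.
  by move=> h; apply: hr0; apply: le_lt_trans h _; rewrite /r; lra.
have cK : closed K.
  apply: compact_closed; first exact: mhausdorff.
  apply: continuous_compact.
    apply/continuous_in_subspaceT => z; rewrite inE /= => /Ksub iz.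
    exact: cinv_continuous_at.
  apply: bounded_closed_compact.
    exists (`|c| + r); split; first exact: num_real.
    move=> m mr z /= zr; apply: le_trans (ltW mr).
    have := ler_dist_split z c 0; rewrite !subr0 => /le_trans; apply.
    by rewrite addrC lerD2l.
  have -> : [set z | `|z - c| <= r] = closed_ball c r.
    rewrite closed_ballE //; apply/seteqP; split => z; rewrite /closed_ball_ /= distrC //.
  exact: closed_ball_closed.
have f0 y : ~ K y -> f y = 0.
  move=> nK; rewrite /f; case: ifPn => // /set_mem iy.
  rewrite B0 ?mul0r // ltNge; apply/negP => h; apply: nK.
  by exists (coord i y) => //; rewrite coordK.
exists f; split.
  move=> j k; apply: Ck_local => z jz.
  have [iz|niz] := pselect (cdom i (cinv j z)).
    exists (cimg j `&` cinv j @^-1` cdom i); split; [exact: open_overlap|by []|].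
    apply: (@eq_Ck _ _ _ _ _ ((fun y => B y * q y) \o transition j i)).
    - exact: open_overlap.
    - by move=> y [jy iy]; rewrite /f /= mem_set.
    apply: (@Ck_comp _ _ _ _ _ setT) => //; first exact: open_overlap.
      exact: transition_smooth.
    by apply: Ck_mul; [exact: openT|exact: sB|exact: sq].
  have nK : ~ K (cinv j z).
    by move=> [y /= /Ksub iy yz]; apply: niz; rewrite -yz; exact: cinv_cdom.
  exists (cimg j `&` cinv j @^-1` (~` K)); split => //.
    rewrite openE => y [jy Ky]; apply: filterI.
      by apply: open_nbhs_nbhs; split => //; exact: open_cimg.
    apply: (cinv_continuous_at jy); apply: open_nbhs_nbhs; split => //.
    exact: closed_openC.
  apply: eq_Ck (Ck_cst k _ 0) => [|y [jy Ky]]; last by rewrite /= f0.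
  rewrite openE => y [jy Ky]; apply: filterI.
    by apply: open_nbhs_nbhs; split => //; exact: open_cimg.
  apply: (cinv_continuous_at jy); apply: open_nbhs_nbhs; split => //.
  exact: closed_openC.
have ni : nbhs c (cimg i) by apply: open_nbhs_nbhs; split => //; exact: open_cimg.
apply: filterS (filterI B1 ni) => z [Bz iz].
by rewrite /f /= mem_set ?cinvK ?Bz ?mul1r //; exact: cinv_cdom.
Qed.

Definition local_field i (X : vector_field M) (z : 'rV[R]_n) : 'rV[R]_n :=
  tcoord i (X (cinv i z)).

Lemma local_field_smooth i (X : vector_field M) :
  smooth_on (cimg i) (local_field i X).
Proof. exact: vf_smooth. Qed.

Lemma tcoord_transition i j x (v : tangent M x) : cdom i x -> cdom j x ->
  tcoord j v = 'd (transition i j) (coord i x) (tcoord i v).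
Proof.
by move=> ix jx; exact: esym (transition_cocycle v (chart_at_cdom x) ix jx).
Qed.

End ManifoldCalculus.

(** * Existence, uniqueness and chart expression of the complete lift *)

Section CompleteLift.
Context {R : realType} {n : nat} {M : manifold R n}.
Implicit Types (i j : chart M) (x : M) (f : M -> R).

(* [f^c] in induced coordinates is [(x, v) |-> dg_x v], where [g] represents
   [f]. *)
Lemma complete_lift_fun_chart i f (z : 'rV[R]_(n + n)) : smooth_fun f ->
  tb_cimg i z ->
  complete_lift_fun f (tb_cinv i z) = 'd (f \o cinv i) (lsubmx z) (rsubmx z).
Proof.
move=> sf iz; have iz' : cdom i (cinv i (lsubmx z)) by exact: cinv_cdom.
have df : differentiable (f \o cinv i) (coord i (cinv i (lsubmx z))).
  by apply: (smooth_differentiable (sf i)); exact: coord_cimg.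
have E2 : tcoord i (tvec (tb_cinv i z)) = rsubmx z := tangent_of_coordK _ iz'.
apply: etrans (dfun_chart (tvec (tb_cinv i z)) iz' df) _.
exact: diff_eq (cinvK iz) E2.
Qed.

Lemma vf_apply_chart i (X : vector_field M) f (z : 'rV[R]_n) : smooth_fun f ->
  cimg i z -> vf_apply X f (cinv i z) = 'd (f \o cinv i) z (local_field i X z).
Proof.
move=> sf iz; have iz' : cdom i (cinv i z) by exact: cinv_cdom.
have df : differentiable (f \o cinv i) (coord i (cinv i z)).
  by apply: (smooth_differentiable (sf i)); exact: coord_cimg.
apply: etrans (dfun_chart (X (cinv i z)) iz' df) _.
exact: diff_eq (cinvK iz) erefl.
Qed.

Lemma Ck_tangent_map i f : smooth_fun f ->
  smooth_on (tb_cimg i)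
    (fun z : 'rV[R]_(n + n) => 'd (f \o cinv i) (lsubmx z) (rsubmx z)).
Proof.
move=> sf k; have oi := @open_cimg _ _ M i.
have E (z : 'rV[R]_(n + n)) : 'd (f \o cinv i) (lsubmx z) (rsubmx z) =
    \sum_(b < n) z 0 (rshift n b) * 'd (f \o cinv i) (lsubmx z) (delta_mx 0 b).
  rewrite {1}(row_sum_delta (rsubmx z)) linear_sum.
  by apply: eq_bigr => b _; rewrite linearZ /= !mxE.
have oT := open_tb_cimg (M:=M) (i:=i).
rewrite (funext E); apply: Ck_sum => // b; apply: Ck_mul => //.
  exact: Ck_coordinate.
have [_ ds] := sf i k.+1.
have lcont : continuous (lsubmx : 'rV[R]_(n + n) -> 'rV[R]_n).
  exact: continuous_lsubmx.
exact: Ck_comp_lin oi lcont (ds (delta_mx 0 b)).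
Qed.

(* [diff_tangent_map] evaluates both sides of [X^c (f^c) = (X f)^c]: writing
   [tb_coord i p = (x, v)], the right-hand side is the differential of [f^c] at
   [(x, X x)] along [(v, dX_x v)]. *)
Lemma lift_identity i (X : vector_field M) (Y : vector_field (tangent_bundle M))
    f p : smooth_fun f -> tb_cdom i p ->
  let h := fun z : 'rV[R]_(n + n) => 'd (f \o cinv i) (lsubmx z) (rsubmx z) in
  let x := coord i (tbase p) in
  let F := local_field i X in
  vf_apply Y (complete_lift_fun f) p =
    'd h (tb_coord i p) (@tcoord R _ (tangent_bundle M) i p (Y p)) /\
  complete_lift_fun (vf_apply X f) p =
    'd h (row_mx x (F x)) (row_mx (tcoord i (tvec p)) ('d F x (tcoord i (tvec p)))).
Proof.
move=> sf ip h x F.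
have ix : cimg i x by exact: coord_cimg.
have oi := @open_cimg _ _ M i.
have oT := open_tb_cimg (M:=M) (i:=i).
have iz := tb_coord_cimg ip.
have sh : smooth_on (tb_cimg i) h by exact: Ck_tangent_map.
have dh z : tb_cimg i z -> differentiable h z.
  by move=> iz'; exact: smooth_differentiable sh iz'.
split.
  have E z : tb_cimg i z -> h z = (complete_lift_fun f \o tb_cinv i) z.
    by move=> iz'; rewrite /= complete_lift_fun_chart.
  have [d1 d2] := eq_differentiable_on oT iz E (dh _ iz).
  apply: etrans (@dfun_chart R _ (tangent_bundle M) (complete_lift_fun f) i p (Y p) ip d1) _.
  exact (congr1 (fun l : 'rV[R]_(n + n) -> R => l _) d2).
have dF : differentiable F x by exact: smooth_differentiable (local_field_smooth i X) ix.
pose k y : 'rV[R]_(n + n) := row_mx y (F y).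
have [dk kE] := diff_graph dF.
have kx : tb_cimg i (k x) by rewrite /tb_cimg /= row_mxKl.
have dhk := dh _ kx.
have E y : cimg i y -> (h \o k) y = (vf_apply X f \o cinv i) y.
  by move=> iy; rewrite /= vf_apply_chart // /h row_mxKl row_mxKr.
have [d1 d2] := eq_differentiable_on oi ix E (differentiable_comp dk dhk).
apply: etrans (dfun_chart (tvec p) ip d1) _.
apply: etrans (congr1 (fun l : 'rV[R]_n -> R => l (tcoord i (tvec p))) d2) _.
apply: etrans (congr1 (fun l : 'rV[R]_n -> R => l (tcoord i (tvec p))) (diff_comp dk dhk)) _.
apply: diff_eq => //.
exact (congr1 (fun l : 'rV[R]_n -> 'rV[R]_(n + n) => l (tcoord i (tvec p))) kE).
Qed.

Lemma local_field_transition i j (X : vector_field M) z : cimg i z ->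
  cdom j (cinv i z) ->
  local_field j X (transition i j z) = 'd (transition i j) z (local_field i X z).
Proof.
move=> iz jz; have iz' : cdom i (cinv i z) by exact: cinv_cdom.
rewrite /local_field /transition /= coordK //.
apply: etrans (tcoord_transition (X (cinv i z)) iz' jz) _.
exact: diff_eq (cinvK iz) erefl.
Qed.

(** The transition between induced charts is itself [lift_field] of the base transition, so
    [lift_field_conjugate] applies with the two local expressions of [X], which the base transition
    relates. *)
Lemma lift_field_transition i j (X : vector_field M) (p : tangent_point M) :
  tb_cdom i p -> tb_cdom j p ->
  'd (@transition R _ (tangent_bundle M) i j) (tb_coord i p)
    (lift_field (local_field i X) (tb_coord i p)) =
  lift_field (local_field j X) (tb_coord j p).
Proof.
move=> ip jp.
have iz : tb_cimg i (tb_coord i p) by exact: tb_coord_cimg.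
have Dz : (cimg i `&` cinv i @^-1` cdom j) (lsubmx (tb_coord i p)).
  by rewrite row_mxKl; exact: coord_overlap.
have jT : cimg j (transition i j (lsubmx (tb_coord i p))).
  by apply: coord_cimg; case: Dz.
have oTD := open_tb_overlap (M:=M) (i:=i) (j:=j).
have zD : (tb_cimg i `&` tb_cinv i @^-1` tb_cdom j) (tb_coord i p) by [].
have E y : (tb_cimg i `&` tb_cinv i @^-1` tb_cdom j) y ->
    lift_field (transition i j) y = @transition R _ (tangent_bundle M) i j y.
  by move=> [iy jy]; exact: esym (tb_transitionE iy jy).
have [dl lE] := lift_field_conjugate (open_overlap (i:=i) (j:=j))
  (transition_smooth i j 2%N) Dz
  (smooth_differentiable (local_field_smooth i X) iz)
  (smooth_differentiable (local_field_smooth j X) jT)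
  (fun y Dy => local_field_transition X (proj1 Dy) (proj2 Dy)).
have [_ d2] := eq_differentiable_on oTD zD E dl.
apply: etrans (congr1 (fun l : 'rV[R]_(n + n) -> 'rV[R]_(n + n) => l _) d2) _.
apply: etrans lE _; apply: congr1.
apply: etrans (E _ zD) _.
exact (congr1 (@tb_coord R n M j) (tb_coordK ip)).
Qed.

(** The chart chosen at [p] in [tangent_bundle M] is by conversion the one chosen at [tbase p], so
    these components are a tangent vector as they stand. *)
Definition lift_val (X : vector_field M) (p : tangent_bundle M) :
    tangent (tangent_bundle M) p :=
  lift_field (local_field (chart_at (tbase p)) X) (tb_coord (chart_at (tbase p)) p).

Lemma tcoord_lift_val i (X : vector_field M) (p : tangent_point M) :
  tb_cdom i p ->
  @tcoord R _ (tangent_bundle M) i p (lift_val X p) =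
  lift_field (local_field i X) (tb_coord i p).
Proof. by move=> ip; exact: lift_field_transition (chart_at_cdom _) ip. Qed.

Lemma lift_val_smooth (X : vector_field M) (i : chart (tangent_bundle M)) :
  smooth_on (cimg i)
    (fun z => @tcoord R _ (tangent_bundle M) i _ (lift_val X (cinv i z))).
Proof.
move=> k; apply: (@eq_Ck _ _ _ _ _ (lift_field (local_field (i : chart M) X))).
- exact: open_tb_cimg.
- move=> z iz; apply: esym.
  apply: etrans (tcoord_lift_val X (tb_cinv_cdom iz)) _.
  exact: congr1 (tb_cinvK iz).
exact (@lift_field_smooth R n (cimg (i : chart M)) _ (@open_cimg _ _ M i)
  (local_field_smooth (M := M) i X) k).
Qed.

Definition lift_vf (X : vector_field M) : vector_field (tangent_bundle M) :=
  @VectorField R _ (tangent_bundle M) (lift_val X) (lift_val_smooth X).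

(** Expanded by [lift_identity] and [diff_tangent_map], the two sides differ only in the order of
    the directions [v] and [X x] in the second derivative of the function. *)
Lemma lift_vf_is_complete_lift (X : vector_field M) :
  is_complete_lift X (lift_vf X).
Proof.
move=> f sf; apply/funext => p; pose i := chart_at (tbase p).
have ip : tb_cdom i p by exact: chart_at_cdom.
have [e1 e2] := lift_identity X (lift_vf X) sf ip.
apply: etrans e1 _; apply: esym; apply: etrans e2 _.
have oi := @open_cimg _ _ M i.
have cg := sf i 2%N.
set x := coord i (tbase p); set v := tcoord i (tvec p).
have ix : cimg i x by exact: coord_cimg.
have [_ h1] := diff_tangent_map (z := row_mx x (local_field i X x)) oi cg
  (eq_ind_r (cimg i) ix (row_mxKl _ _)).
have [_ h2] := diff_tangent_map (z := row_mx x v) oi cg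
  (eq_ind_r (cimg i) ix (row_mxKl _ _)).
apply: etrans (h1 _) _; apply: esym.
apply: etrans (congr1 _ (tcoord_lift_val X ip)) _.
apply: etrans (h2 _) _.
rewrite lsub_lift_field rsub_lift_field /tb_coord !row_mxKl !row_mxKr -/x -/v.
apply: (@congr2 _ _ _ (fun a b : R => a + b)); last by [].
exact: (diff_symmetric _ _ oi ix cg).
Qed.

(** The defining property tests only functions on all of [M]; since just first and second
    derivatives at one point enter, a function agreeing with [q] near that point is enough. *)
Lemma complete_lift_identity i (X : vector_field M)
    (Y : vector_field (tangent_bundle M)) (p : tangent_point M)
    (q : 'rV[R]_n -> R) :
  is_complete_lift X Y -> tb_cdom i p -> smooth_on setT q ->
  let c := @tcoord R _ (tangent_bundle M) i p (Y p) : 'rV[R]_(n + n) in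
  let x := coord i (tbase p) in
  let v := tcoord i (tvec p) in
  let F := local_field i X in
  'd (fun y => 'd q y v) x (lsubmx c) + 'd q x (rsubmx c) =
  'd (fun y => 'd q y (F x)) x v + 'd q x ('d F x v).
Proof.
move=> XY ip sq c x v F.
have [f [sf fq]] := smooth_fun_extend ip sq.
have /nbhs_normedP[r r0 hr] := fq.
pose B := [set y : 'rV[R]_n | `|y - x| < r].
have oB : open B.
  have -> : B = ball x r.
    by apply/seteqP; split => y; rewrite -ball_normE /B /= distrC.
  exact: ball_open.
have Bx : B x by rewrite /B /= subrr normr0.
have dq y : differentiable q y by exact: smooth_differentiable sq _.
have dqv w y : differentiable (fun y => 'd q y w) y.
  by have [_ h] := sq 2%N; have [dd _] := h w; exact: dd.
have E y : B y -> q y = (f \o cinv i) y by move=> /hr.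
have E1 w y : B y -> 'd q y w = 'd (f \o cinv i) y w.
  move=> By; have [_ d] := eq_differentiable_on oB By E (dq y).
  exact (esym (congr1 (fun l : 'rV[R]_n -> R => l w) d)).
have E2 w u : 'd (fun y => 'd (f \o cinv i) y w) x u = 'd (fun y => 'd q y w) x u.
  have [_ d] := eq_differentiable_on oB Bx (E1 w) (dqv w x).
  exact (congr1 (fun l : 'rV[R]_n -> R => l u) d).
have [e1 e2] := lift_identity X Y sf ip.
have oi := @open_cimg _ _ M i.
have cg := sf i 2%N.
have ix : cimg i x by exact: coord_cimg.
have [_ h1] := diff_tangent_map (z := row_mx x (F x)) oi cg
  (eq_ind_r (cimg i) ix (row_mxKl _ _)).
have [_ h2] := diff_tangent_map (z := row_mx x v) oi cg
  (eq_ind_r (cimg i) ix (row_mxKl _ _)).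
have H := etrans (esym e1) (etrans (congr1 (fun g => g p) (XY f sf)) e2).
have H' := etrans (esym (h2 c)) (etrans H (h1 _)).
move: H'; rewrite !row_mxKl !row_mxKr => H'.
apply: etrans (esym (congr2 (fun a b : R => a + b) (E2 v (lsubmx c)) (esym (E1 (rsubmx c) x Bx)))) _.
apply: etrans H' _.
exact (congr2 (fun a b : R => a + b) (E2 (F x) v) (esym (E1 _ x Bx))).
Qed.

Lemma complete_lift_unique i (X : vector_field M)
    (Y : vector_field (tangent_bundle M)) (p : tangent_point M) :
  is_complete_lift X Y -> tb_cdom i p ->
  @tcoord R _ (tangent_bundle M) i p (Y p) =
  lift_field (local_field i X) (tb_coord i p).
Proof.
move=> XY.
have lin1 k : linear (fun y : 'rV[R]_n => y 0 k : R).
  by move=> a u v; rewrite !mxE.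
have s1 k : smooth_on setT (fun y : 'rV[R]_n => y 0 k : R).
  by move=> j; apply: Ck_coordinate; exact: openT.
pose C (p' : tangent_point M) : 'rV[R]_(n + n) :=
  @tcoord R _ (tangent_bundle M) i p' (Y p').
set F := local_field i X.
(* For a coordinate function both second-order terms vanish, which leaves exactly the fibre
   component. *)
have rE (p' : tangent_point M) : tb_cdom i p' ->
    rsubmx (C p') = 'd F (coord i (tbase p')) (tcoord i (tvec p')).
  move=> ip; set x := coord i (tbase p'); set v := tcoord i (tvec p').
  apply/rowP => k; pose q (y : 'rV[R]_n) : R := y 0 k.
  have h : 'd (fun y => 'd q y v) x (lsubmx (C p')) + 'd q x (rsubmx (C p')) =
      'd (fun y => 'd q y (F x)) x v + 'd q x ('d F x v).
    exact: complete_lift_identity XY ip (s1 k).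
  have E w : (fun y => 'd q y w) = cst (w 0 k).
    by apply/funext => y; exact: diff_linear_fun (lin1 k).
  have E0 (a : R) (u : 'rV[R]_n) : 'd (cst a : 'rV[R]_n -> R) x u = 0.
    by rewrite diff_cst.
  have A a b : 'd (fun y => 'd q y a) x b = 0.
    exact (etrans (congr1 (fun l : 'rV[R]_n -> R => 'd l x b) (E a)) (E0 (a 0 k) b)).
  have {}h : 'd q x (rsubmx (C p')) = 'd q x ('d F x v).
    have h0 a b c d : a = 0 -> b = 0 -> a + c = b + d :> R -> c = d.
      by move=> -> ->; rewrite !add0r.
    exact: h0 (A v _) (A (F x) _) h.
  move: h; by rewrite (diff_linear_fun x (rsubmx (C p')) (lin1 k))
    (diff_linear_fun x ('d F x v) (lin1 k)).
have lE (p' : tangent_point M) : tb_cdom i p' -> tcoord i (tvec p') != 0 ->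
    lsubmx (C p') = F (coord i (tbase p')).
  move=> ip; set v := tcoord i (tvec p').
  set x := coord i (tbase p'); set c := C p' => v0.
  have [k vk] : exists k, v 0 k != 0.
    by apply/existsP; apply: contra_neqT v0; rewrite negb_exists => /forallP h;
      apply/rowP => k; rewrite mxE; apply/eqP; have := h k; rewrite negbK.
  (* The product of coordinates [a] and [b], after the fibre terms cancel by [rE]. Taking
     [a = b = k] with [v 0 k != 0] and then [a = k] settles every component. *)
  have H a b : v 0 a * (lsubmx c 0 b - F x 0 b) + v 0 b * (lsubmx c 0 a - F x 0 a) = 0.
    pose q (y : 'rV[R]_n) : R := y 0 a * y 0 b.
    have sab : smooth_on setT q.
      by move=> j; apply: Ck_mul; [exact: openT|exact: s1|exact: s1].
    have h : 'd (fun y => 'd q y v) x (lsubmx c) + 'd q x (rsubmx c) =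
        'd (fun y => 'd q y (F x)) x v + 'd q x ('d F x v).
      exact: complete_lift_identity XY ip sab.
    have E w : (fun y => 'd q y w) =
        (fun y : 'rV[R]_n => y 0 a * w 0 b + y 0 b * w 0 a).
      by apply/funext => y; exact: diff_coord_mul.
    have lw (w : 'rV[R]_n) : linear (fun y : 'rV[R]_n => y 0 a * w 0 b + y 0 b * w 0 a : R).
      by move=> t u u'; rewrite !mxE /GRing.scale /=; ring.
    move: h; rewrite (E v) (E (F x)) (rE p' ip) -/x -/v => /addIr.
    rewrite (diff_linear_fun x (lsubmx c) (lw v)) (diff_linear_fun x v (lw (F x))).
    by set l := lsubmx c; set f := F x; lra.
  have Hk : lsubmx c 0 k - F x 0 k = 0.
    have := H k k; rewrite -mulr2n => /eqP; rewrite mulrn_eq0 /= mulf_eq0 (negbTE vk) /=.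
    by move/eqP.
  apply/rowP => l; apply/eqP; rewrite -subr_eq0; apply/eqP.
  have := H k l; rewrite Hk mulr0 addr0 => /eqP; rewrite mulf_eq0 (negbTE vk) /=.
  by move/eqP.
move=> ip; pose x := coord i (tbase p).
suff cE : lsubmx (C p) = F x.
  rewrite -[LHS]hsubmxK /lift_field /tb_coord row_mxKl row_mxKr.
  exact: congr2 cE (rE p ip).
(* On the zero section these tests say nothing about the base component. It is recovered by
   continuity of [Y] along the nonzero vectors [s *: e] over the same base point, which exist once
   [n > 0]. *)
have [v0|] := eqVneq (tcoord i (tvec p)) 0; last exact: lE.
have [n0|n_gt0] := posnP n.
  by apply/rowP => k; exfalso; have := ltn_ord k; rewrite {2}n0.
pose e : 'rV[R]_n := delta_mx 0 (Ordinal n_gt0).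
have e1 : `|e| <= 1.
  by apply: rV_norm_le => // k; rewrite mxE; case: (_ && _); rewrite ?normr1 ?normr0.
have ix : cimg i x by exact: coord_cimg.
have iz (s : R) : tb_cimg i (row_mx x (s *: e)) by rewrite /tb_cimg /= row_mxKl.
have z0 : tb_coord i p = row_mx x 0 by rewrite /tb_coord v0.
have cont : {for tb_coord i p, continuous (C \o tb_cinv i)}.
  have := @vf_smooth R _ _ Y i 0%N (tb_coord i p); apply.
  exact: tb_coord_cimg.
apply/eqP; rewrite -subr_eq0 -normr_le0; apply/ler_addgt0Pr => d d0; rewrite add0r.
have /cont_normP/(_ d d0)[r r0 hr] := cont.
pose s := r / 2; have s0 : 0 < s by rewrite divr_gt0.
have zr : `|row_mx x (s *: e) - tb_coord i p| < r.
  rewrite z0 opp_row_mx add_row_mx subrr subr0.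
  apply: (@le_lt_trans _ _ s); last by rewrite /s; lra.
  apply: norm_row_mx_le; first by rewrite normr0 ltW.
  by rewrite normrZ gtr0_norm // ler_piMr // ltW.
have ps := tb_cinvK (iz s).
have vs : tcoord i (tvec (tb_cinv i (row_mx x (s *: e)))) = s *: e.
  by have := congr1 rsubmx ps; rewrite /tb_coord !row_mxKr.
have xs : coord i (tbase (tb_cinv i (row_mx x (s *: e)))) = x.
  by have := congr1 lsubmx ps; rewrite /tb_coord !row_mxKl.
have en0 : s *: e != 0.
  rewrite scaler_eq0 gt_eqF //=; apply/eqP => /rowP/(_ (Ordinal n_gt0)).
  by rewrite !mxE !eqxx /= => /eqP; rewrite oner_eq0.
have L := lE _ (tb_cinv_cdom (iz s)).
rewrite vs xs in L; have {}L := L en0.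
have := hr _ zr => /=.
rewrite tb_coordK //; set c1 := C (tb_cinv i _) => h.
have L' : lsubmx c1 = F x by exact: L.
rewrite -L' distrC -linearB; apply: le_trans (ltW h); exact: norm_lsubmx.
Qed.

(** [lift_vf] shows that [xget] does not fall back on its default, and uniqueness identifies
    whatever it picks. *)
Lemma complete_lift_chart i (X : vector_field M) (p : tangent_point M) :
  tb_cdom i p ->
  @tcoord R _ (tangent_bundle M) i p (complete_lift X p) =
  lift_field (local_field i X) (tb_coord i p).
Proof.
apply: complete_lift_unique; rewrite /complete_lift.
by case: xgetP => [Y -> //|/(_ (lift_vf X))]; case; exact: lift_vf_is_complete_lift.
Qed.

End CompleteLift.

(** * Solutions and flows on manifolds *)

Section RealInduction.
Context {R : realType}.

(** Solutions run in both time directions from 0; the backward case is [real_ind] after the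
    reflection of time. *)
Lemma interval_ind (J : set R) (P : R -> Prop) : is_interval J ->
  (forall c, J c -> exists2 r : R, 0 < r & forall s t : R, J s -> J t ->
     `|s - c| < r -> `|t - c| < r -> P s -> P t) ->
  forall s t : R, J s -> J t -> P s -> P t.
Proof.
move=> iJ step s t Js Jt Ps; have [st|ts] := leP s t.
  apply: (real_ind st Ps) => c sct; have Jc : J c by exact: (iJ s t).
  have [r r0 hr] := step c Jc; exists r => // s' t' h1 h2 h3 h4 h5 h6.
  apply: hr.
  - by apply: (iJ s c) => //; rewrite h1 h2.
  - by apply: (iJ c t) => //; rewrite h3 h4.
  - by rewrite distrC ger0_norm ?subr_ge0 //; lra.
  - by rewrite ger0_norm ?subr_ge0 //; lra.
have nst : - s <= - t by rewrite lerN2 ltW.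
rewrite -(opprK t); apply: (@real_ind _ (fun x => P (- x)) (- s) (- t) nst).
  by rewrite opprK.
move=> c hc; have Jc : J (- c) by apply: (iJ t s) => //; apply/andP; split; lra.
have [r r0 hr] := step _ Jc; exists r => // s' t' h1 h2 h3 h4 h5 h6.
apply: hr.
- by apply: (iJ (- c) s) => //; apply/andP; split; lra.
- by apply: (iJ t (- c)) => //; apply/andP; split; lra.
- by rewrite ger0_norm; lra.
- by rewrite distrC ger0_norm; lra.
Qed.

Lemma locally_lipschitz (V : normedModType R) (f : R -> V) (a b : R) : a <= b ->
  (forall c, a <= c <= b -> exists r K : R, 0 < r /\ forall s t,
     a <= s <= b -> a <= t <= b -> `|s - c| < r -> `|t - c| < r ->
     `|f t - f s| <= K * `|t - s|) ->
  exists K : R, forall s t, a <= s -> s <= t -> t <= b ->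
    `|f t - f s| <= K * (t - s).
Proof.
move=> ab H.
apply: (@real_ind _ (fun x => exists K : R, forall s t, a <= s -> s <= t ->
  t <= x -> `|f t - f s| <= K * (t - s)) _ _ ab).
  exists 0 => s t as_ st ta; have -> : t = s by lra.
  by rewrite !subrr normr0 mulr0.
move=> c cab; have [r [K [r0 hr]]] := H c cab; exists r => //.
move=> s t as_ sc ct tb cs tc [K' hs]; exists (Num.max K K') => x y ax xy yt.
have hK x' y' : s <= x' -> x' <= y' -> y' <= t -> `|f y' - f x'| <= Num.max K K' * (y' - x').
  move=> h1 h2 h3; have := hr x' y'; rewrite [`|y' - x'|]ger0_norm ?subr_ge0 // => h.
  apply: le_trans (h _ _ _ _) _; try by (clear - h1 h2 h3 sc ct cs tc; rewrite ltr_norml; apply/andP; split; lra).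
  - by clear - h1 h2 h3 as_ tb; apply/andP; split; lra.
  - by clear - h1 h2 h3 as_ tb; apply/andP; split; lra.
  - by apply: ler_wpM2r; rewrite ?subr_ge0 // le_max lexx.
have hK' x' y' : a <= x' -> x' <= y' -> y' <= s -> `|f y' - f x'| <= Num.max K K' * (y' - x').
  move=> h1 h2 h3; apply: le_trans (hs _ _ h1 h2 h3) _.
  by apply: ler_wpM2r; rewrite ?subr_ge0 // le_max lexx orbT.
have [ys|sy] := leP y s; first exact: hK'.
have [sx|xs] := leP s x; first exact: hK.
apply: le_trans (ler_dist_split _ (f s) _) _.
have h1 := hK' x s ax (ltW xs) (lexx s); have h2 := hK s y (lexx s) (ltW sy) yt.
apply: (@le_trans _ _ (Num.max K K' * (y - s) + Num.max K K' * (s - x))).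
  exact: lerD.
by rewrite -mulrDr subrKA.
Qed.

Lemma is_derive1_comp n (W : normedModType R) (g : R -> 'rV[R]_n)
    (F : 'rV[R]_n -> W) (t : R) (v : 'rV[R]_n) :
  differentiable F (g t) -> is_derive t 1 g v ->
  is_derive t 1 (fun s => F (g s)) ('d F (g t) v).
Proof.
move=> dF [dg gv].
have dg' : differentiable g t by apply/derivable1_diffP.
have dFg : differentiable (F \o g) t by exact: differentiable_comp.
split; first exact: diff_derivable.
rewrite deriveE //.
have H := congr1 (fun l : R -> W => l 1) (diff_comp dg' dF).
apply: etrans H _ => /=; congr ('d F (g t) _).
by rewrite -gv deriveE.
Qed.

Lemma continuous_near (T : topologicalType) (g : R -> T) (t : R) (A : set T) :
  {for t, continuous g} -> open A -> A (g t) ->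
  exists2 r : R, 0 < r & forall s, `|s - t| < r -> A (g s).
Proof.
move=> cg oA At; have := cg _ (open_nbhs_nbhs (conj oA At)).
by move=> /nbhs_normedP[r r0 hr]; exists r.
Qed.

End RealInduction.

(** * Differentiable maps and velocities under change of charts *)

Section MapsInCharts.
Context {R : realType}.

Lemma diff_comp_near (V W : normedModType R) n (g : V -> 'rV[R]_n)
    (T : 'rV[R]_n -> W) (h : V -> W) (x : V) :
  {near x, T \o g =1 h} -> differentiable g x -> differentiable T (g x) ->
  differentiable h x /\ forall v, 'd h x v = 'd T (g x) ('d g x v).
Proof.
move=> E dg dT; have dTg := differentiable_comp dg dT.
have [dh hE] := is_diff_near E (differentiableP dTg).
split => // v; apply: etrans (congr1 (fun l : V -> W => l v) hE) _.
exact (congr1 (fun l : V -> W => l v) (diff_comp dg dT)).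
Qed.

Context {n p : nat} {M : manifold R n} {N : manifold R p}.
Implicit Types (F : M -> N) (x : M).

Lemma near_coord i x (P : M -> Prop) : cdom i x -> (\forall y \near x, P y) ->
  \forall z \near coord i x, P (cinv i z).
Proof.
move=> ix nP; have := cinv_continuous_at (coord_cimg ix); apply.
by rewrite coordK.
Qed.

Lemma diff_change_chart F (i : chart M) (j j' : chart N) x :
  {for x, continuous F} -> cdom i x -> cdom j (F x) -> cdom j' (F x) ->
  differentiable (coord j \o F \o cinv i) (coord i x) ->
  differentiable (coord j' \o F \o cinv i) (coord i x) /\
  forall v, 'd (coord j' \o F \o cinv i) (coord i x) v =
    'd (transition j j') (coord j (F x)) ('d (coord j \o F \o cinv i) (coord i x) v).
Proof.
move=> cF ix jx jx' dF.
have E : (coord j \o F \o cinv i) (coord i x) = coord j (F x) by rewrite /= coordK.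
have [||dh hE] := @diff_comp_near _ _ _ (coord j \o F \o cinv i) (transition j j')
  (coord j' \o F \o cinv i) (coord i x) _ dF.
- have nF : \forall y \near x, cdom j (F y).
    exact: (cF _ (open_nbhs_nbhs (conj (@open_cdom _ _ N j) jx))).
  apply: filterS (near_coord ix nF) => z jz.
  by rewrite /transition /= coordK.
- by rewrite E; exact: transition_diff.
split; first exact: dh.
move=> v; exact (etrans (hE v) (@diff_eq R _ _ (transition j j') _ _ _ _ E erefl)).
Qed.

Lemma mdiff_chart F (j : chart N) x (v : tangent M x) : mdifferentiable F x ->
  cdom j (F x) ->
  let G := coord j \o F \o cinv (chart_at x) in
  differentiable G (coord (chart_at x) x) /\
  tcoord j (mdiff F v) = 'd G (coord (chart_at x) x) v.
Proof.
move=> [cF dF] jx.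
have [d E] := diff_change_chart cF (chart_at_cdom x) (chart_at_cdom (F x)) jx dF.
by split; [exact: d|exact: esym (E v)].
Qed.

Lemma mdifferentiable_chart F (j : chart N) x : {for x, continuous F} ->
  cdom j (F x) ->
  differentiable (coord j \o F \o cinv (chart_at x)) (coord (chart_at x) x) ->
  mdifferentiable F x.
Proof.
move=> cF jx dF; split => //.
by have [] := diff_change_chart cF (chart_at_cdom x) jx (chart_at_cdom (F x)) dF.
Qed.

End MapsInCharts.

Lemma mdiff_id (R : realType) n (M : manifold R n) (x : M) :
  mdifferentiable (@id M) x /\ forall v : tangent M x, mdiff (@id M) v = v.
Proof.
split; last by move=> v; exact: transition_id v (chart_at_cdom x).
split; first exact: cvg_id.
exact: transition_diff (chart_at_cdom x) (chart_at_cdom x).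
Qed.

Section Velocity.
Context {R : realType} {n : nat} {N : manifold R n}.
Implicit Types (i j : chart N) (gamma : R -> N) (t : R).

Lemma derive_transition i j gamma t (d : 'rV[R]_n) :
  {for t, continuous gamma} -> cdom i (gamma t) -> cdom j (gamma t) ->
  is_derive t 1 (coord i \o gamma) d ->
  is_derive t 1 (coord j \o gamma) ('d (transition i j) (coord i (gamma t)) d).
Proof.
move=> cg it jt id.
have [r r0 hr] := continuous_near cg (@open_cdom _ _ N i) it.
apply: (is_derive_near r0 _ (is_derive1_comp (transition_diff it jt) id)).
by move=> s sr; rewrite /transition /= coordK //; exact: hr.
Qed.

Lemma velocity_coord i gamma t (v : tangent N (gamma t)) :
  {for t, continuous gamma} -> cdom i (gamma t) ->
  has_velocity v <-> is_derive t 1 (coord i \o gamma) (tcoord i v).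
Proof.
move=> cg it; have ct := chart_at_cdom (gamma t); split => h.
  exact: derive_transition h.
have := derive_transition cg it ct h.
by rewrite -/(tangent_of_coord i (gamma t) (tcoord i v)) tcoordK.
Qed.

End Velocity.

(** * Solutions and flow of a control system given by its chart expressions *)

Section Dynamics.
Context {R : realType} {n m k : nat} {N : manifold R n}.
Variables (X0 : vector_field N) (X : 'I_m -> vector_field N) (u : R -> 'rV[R]_m).
Variables (f : chart N -> 'I_k -> 'rV[R]_n -> 'rV[R]_n) (w : R -> 'I_k -> R).
Hypothesis f_smooth : forall i j, smooth_on (cimg i) (f i j).
Hypothesis YE : forall i t x, cdom i x ->
  tcoord i (control_field X0 X (u t) x) = affine (f i) w t (coord i x).
Hypothesis w_measurable : forall j, lebesgue_measurable_fun (w^~ j).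
Hypothesis w_bounded : forall t1 : R, exists2 W : R, 0 <= W &
  forall t j, `|t - t1| <= 1 -> `|w t j| <= W.
Implicit Types (i j : chart N) (J : set R) (gamma : R -> N) (a b c t : R).

(** [solution] without [J 0]: pieces living away from time 0 have to be compared and glued. *)
Definition curve_solution J gamma : Prop :=
  [/\ open J, is_interval J, abs_continuous_curve J gamma &
      {ae lebesgue_measure, forall t : R, J t ->
         has_velocity (control_field X0 X (u t) (gamma t))}].

(** Lipschitz replaces absolutely continuous: near each time solutions are Lipschitz in a chart,
    since the field is bounded there, and unlike a condition in all charts this one is checked in a
    single chart and survives transitions. *)
Definition charted i a b gamma : Prop :=
  [/\ forall t, a <= t <= b -> cdom i (gamma t),
      exists K : R, forall s t, a <= s <= b -> a <= t <= b ->
        `|coord i (gamma t) - coord i (gamma s)| <= K * `|t - s| &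
      solves (affine (f i) w) a b (coord i \o gamma)].

Lemma charted_subset i a b a' b' gamma : a <= a' -> b' <= b ->
  charted i a b gamma -> charted i a' b' gamma.
Proof.
move=> aa bb [h1 [K h2] h3].
have H t : a' <= t <= b' -> a <= t <= b by move=> /andP[? ?]; apply/andP; split; lra.
split => [t /H|| ]; first exact: h1.
  by exists K => s t /H hs /H ht; exact: h2.
by apply: ae_imp h3 => t h /andP[? ?]; apply: h; apply/andP; split; lra.
Qed.

Lemma charted_eq i a b gamma gamma' :
  (forall t, a <= t <= b -> gamma t = gamma' t) ->
  charted i a b gamma -> charted i a b gamma'.
Proof.
move=> E [h1 [K h2] h3]; split => [t tab||].
- by rewrite -E //; exact: h1.
- by exists K => s t hs ht; rewrite -!E //; exact: h2.
- apply: ae_imp h3 => t h tab; have := h tab.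
  have tab' : a <= t <= b by move/andP: tab => [? ?]; apply/andP; split; exact: ltW.
  rewrite /= -(E t tab') => d.
  apply: (is_derive_near _ _ d); last first.
    move=> s /(in_itv_near tab)/andP[? ?] /=; rewrite E //.
    by apply/andP; split; exact: ltW.
  by move/andP: tab => [? ?]; rewrite lt_min !subr_gt0; apply/andP.
Qed.

Lemma charted_continuous i a b gamma t : charted i a b gamma -> a < t < b ->
  {for t, continuous gamma}.
Proof.
move=> [h1 [K h2] _] tab.
have tab' s : a < s < b -> a <= s <= b.
  by move=> /andP[? ?]; apply/andP; split; exact: ltW.
have d0 : 0 < Num.min (t - a) (b - t).
  by move/andP: tab => [? ?]; rewrite lt_min !subr_gt0; apply/andP.
have cc : {for t, continuous (coord i \o gamma)}.
  apply/cont_normP => e e0; have K0 : 0 < `|K| + 1 by rewrite ltr_wpDl.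
  exists (Num.min (Num.min (t - a) (b - t)) (e / (`|K| + 1))).
    by rewrite lt_min d0 divr_gt0.
  move=> s; rewrite lt_min => /andP[/(in_itv_near tab) sab].
  rewrite ltr_pdivlMr // => h; apply: le_lt_trans (h2 _ _ (tab' _ tab) (tab' _ sab)) _.
  apply: le_lt_trans h; rewrite mulrC; apply: ler_wpM2l => //.
  by apply: le_trans (ler_norm K) _; rewrite lerDl.
have E : \forall s \near t, cinv i ((coord i \o gamma) s) = gamma s.
  apply/nbhs_normedP; exists (Num.min (t - a) (b - t)) => // s /(in_itv_near tab) sab.
  by rewrite /= coordK //; exact/h1/tab'.
have it := h1 _ (tab' _ tab).
have cg : {for t, continuous (cinv i \o (coord i \o gamma))}.
  by apply: continuous_comp => //; apply: cinv_continuous_at; exact: coord_cimg.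
move=> A; rewrite -[gamma t](coordK it) => nA.
have nc := cg A nA.
change (\forall s \near t, A (gamma s)).
by apply: filterS (filterI E nc) => s [sE hs]; rewrite -sE.
Qed.

Lemma solution_charted J gamma c i : curve_solution J gamma -> J c ->
  cdom i (gamma c) -> exists2 e : R, 0 < e &
    (forall t, c - e <= t <= c + e -> J t) /\ charted i (c - e) (c + e) gamma.
Proof.
move=> [oJ iJ [cg ag] vg] Jc ic.
have [W W0 wW] := w_bounded c.
have [eps [rho [K [e0 r0 K0 hK _]]]] := local_uniqueness (@open_cimg _ _ N i)
  (coord_cimg ic) wW W0 (fun l => @f_smooth i l 1%N).
have /nbhs_normedP[r1 r10 h1] : nbhs c J by exact: open_nbhs_nbhs.
have [r2 r20 h2] := continuous_near (cg c Jc) (@open_cdom _ _ N i) ic.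
have cc : {for c, continuous (coord i \o gamma)}.
  by apply: continuous_comp; [exact: cg|exact: coord_continuous_at].
have /cont_normP/(_ rho r0)[r3 r30 h3] := cc.
pose e := Num.min (Num.min r1 r2) (Num.min r3 eps) / 2.
have m0 : 0 < Num.min (Num.min r1 r2) (Num.min r3 eps).
  by rewrite !lt_min r10 r20 r30.
have e0' : 0 < e by rewrite divr_gt0.
have small t : c - e <= t <= c + e -> [/\ `|t - c| < r1, `|t - c| < r2 & `|t - c| < r3].
  move=> /andP[t1 t2]; have : `|t - c| < Num.min (Num.min r1 r2) (Num.min r3 eps).
    by apply: itv_ball (half_lt m0); apply/andP; split.
  by rewrite !lt_min => /andP[/andP[-> ->] /andP[-> _]].
have eeps : e <= eps.
  rewrite /e; have : Num.min (Num.min r1 r2) (Num.min r3 eps) <= eps.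
    by rewrite !ge_min lexx !orbT.
  by move=> h; apply: ltW; exact: lt_le_trans (half_lt m0) h.
have Jt t : c - e <= t <= c + e -> J t by move=> /small[/h1].
have it t : c - e <= t <= c + e -> cdom i (gamma t) by move=> /small[_ /h2].
have sv : solves (affine (f i) w) (c - e) (c + e) (coord i \o gamma).
  apply: ae_imp vg => t h tab.
  have tab' : c - e <= t <= c + e by move/andP: tab => [? ?]; apply/andP; split; exact: ltW.
  have := (velocity_coord (i := i) (control_field X0 X (u t) (gamma t)) (cg t (Jt t tab')) (it t tab')).1 (h (Jt t tab')).
  by rewrite YE //; exact: it.
exists e => //; split => //; split => //; exists K.
apply: hK => //; first exact: lerB.
- by rewrite lerD2l.
- by apply: ag => //= t; rewrite in_itv /=; exact: Jt.
- by move=> t /small[_ _ /h3/ltW].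
Qed.

Lemma charted_solution J gamma : open J -> is_interval J ->
  (forall c, J c -> exists i, exists2 e : R, 0 < e &
     charted i (c - e) (c + e) gamma) ->
  curve_solution J gamma.
Proof.
move=> oJ iJ H.
have mid (c e : R) : 0 < e -> c - e < c < c + e.
  by move=> e0; apply/andP; split; lra.
have cg t : J t -> {for t, continuous gamma}.
  by move=> /H[i [e e0 ch]]; exact: charted_continuous ch (mid _ _ e0).
split => //; first split => //.
  move=> j a b abJ jab.
  have [ab|ba] := leP a b; last first.
    move=> e e0; exists 1 => // M s t st _ _.
    rewrite big1 // => l _; have [h1 h2 h3] := st l.
    by exfalso; lra.
  suff [K hK] : exists K : R, forall s t, a <= s -> s <= t -> t <= b ->
      `|(coord j \o gamma) t - (coord j \o gamma) s| <= K * (t - s) by exact: lip_ac hK.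
  apply: locally_lipschitz => // c cab.
  have Jc : J c by apply: abJ; rewrite /= in_itv.
  have [i [e e0 [h1 [K h2] _]]] := H c Jc.
  have ic : cdom i (gamma c) by apply: h1; move: (mid c e e0) => /andP[? ?]; apply/andP; split; exact: ltW.
  have [r [L [r0 L0 hD _ hL]]] := C1_bound (@open_overlap _ _ N i j)
    (@transition_smooth _ _ N i j 1%N) (coord_overlap ic (jab c cab)).
  have cc : {for c, continuous (coord i \o gamma)}.
    by apply: continuous_comp; [exact: cg|exact: coord_continuous_at].
  have /cont_normP/(_ r r0)[r3 r30 h3] := cc.
  exists (Num.min e r3), (L * K); split; first by rewrite lt_min e0.
  move=> s t sab tab; rewrite !lt_min => /andP[se sr] /andP[te tr].
  have near_ x : `|x - c| < e -> c - e <= x <= c + e.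
    exact: ball_itvW.
  have E x : `|x - c| < e -> coord j (gamma x) = (coord j \o cinv i) (coord i (gamma x)).
    by move=> xe; rewrite /= coordK //; exact/h1/near_.
  rewrite /= !E //; apply: le_trans (hL _ _ (h3 _ tr) (h3 _ sr)) _.
  by rewrite -mulrA; apply: ler_wpM2l => //; apply: h2; exact: near_.
apply: ae_local => t Jt; have [i [e e0 ch]] := H t Jt.
have [h1 _ h3] := ch.
have /nbhs_normedP[r1 r10 hr1] : nbhs t J by exact: open_nbhs_nbhs.
exists (Num.min e r1); first by rewrite lt_min e0.
apply: ae_imp h3 => s h; rewrite lt_min => /andP[se /hr1 Js].
have ste : t - e < s < t + e by move: se; rewrite ltr_norml => /andP[? ?]; apply/andP; split; lra.
have is' : cdom i (gamma s) by apply: h1; move/andP: ste => [? ?]; apply/andP; split; exact: ltW.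
apply/(velocity_coord (i := i) (control_field X0 X (u s) (gamma s)) (cg s Js) is').
by rewrite YE //; exact: h.
Qed.

Lemma charted_ac i a b gamma : charted i a b gamma ->
  abs_continuous_on a b (coord i \o gamma).
Proof.
move=> [_ [K h] _]; apply: (@lip_ac _ _ _ _ _ K) => s t as_ st tb.
by rewrite -[t - s]ger0_norm ?subr_ge0 //; apply: h; apply/andP; split => //; lra.
Qed.

(** If the curves agree at [c], local uniqueness in a chart spreads agreement from any nearby time.
    If they differ at [c], Hausdorff separation makes them differ at all nearby times, so the
    induction step is vacuous. *)
Lemma solution_unique J gamma gamma' t0 t : curve_solution J gamma ->
  curve_solution J gamma' -> J t0 -> gamma t0 = gamma' t0 -> J t ->
  gamma t = gamma' t.
Proof.
move=> sg sg' J0 E0 Jt; have [oJ iJ [cg _] _] := sg; have [_ _ [cg' _] _] := sg'.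
apply: (interval_ind (P := fun s => gamma s = gamma' s) iJ _ J0 Jt E0) => c Jc.
have [E|nE] := pselect (gamma c = gamma' c); last first.
  have := @mhausdorff _ _ N; rewrite open_hausdorff => /(_ (gamma c) (gamma' c)).
  case; first exact/eqP.
  move=> [A B] /= [/set_mem Ac /set_mem Bc] [oA oB /eqP AB].
  have [r r0 hr] := continuous_near (cg c Jc) oA Ac.
  have [r' r'0 hr'] := continuous_near (cg' c Jc) oB Bc.
  exists (Num.min r r'); first by rewrite lt_min r0.
  move=> s s' _ _; rewrite lt_min => /andP[/hr h /hr' h'] _ sE.
  have : (A `&` B) (gamma s) by split => //; rewrite sE.
  by rewrite AB.
pose i := chart_at (gamma c); have ic : cdom i (gamma c) by exact: chart_at_cdom.
have ic' : cdom i (gamma' c) by rewrite -E.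
have [W W0 wW] := w_bounded c.
have [eps [rho [K [e0 r0 K0 _ hU]]]] := local_uniqueness (@open_cimg _ _ N i)
  (coord_cimg ic) wW W0 (fun l => @f_smooth i l 1%N).
have [e1 e10 [_ ch1]] := solution_charted sg Jc ic.
have [e2 e20 [_ ch2]] := solution_charted sg' Jc ic'.
have cc : {for c, continuous (coord i \o gamma)}.
  by apply: continuous_comp; [exact: cg|exact: coord_continuous_at].
have cc' : {for c, continuous (coord i \o gamma')}.
  by apply: continuous_comp; [exact: cg'|exact: coord_continuous_at].
have /cont_normP/(_ rho r0)[r3 r30 h3] := cc.
have /cont_normP/(_ rho r0)[r4 r40 h4] := cc'.
pose mn := Num.min (Num.min e1 e2) (Num.min eps (Num.min r3 r4)).
have m0 : 0 < mn by rewrite !lt_min e10 e20 e0 r30.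
have [m1 m2 m3 [m4 m5]] : [/\ mn <= e1, mn <= e2, mn <= eps & mn <= r3 /\ mn <= r4].
  by rewrite /mn !ge_min !lexx !orbT.
pose e := mn / 2; have eE : e = mn / 2 by []; clearbody e mn.
have le_mn r : mn <= r -> e <= r by apply: le_trans; rewrite eE ltW // half_lt.
have [e1' e2' e3'] : [/\ e <= e1, e <= e2 & e <= eps] by split; exact: le_mn.
have H s : `|s - c| < e -> c - e <= s <= c + e.
  exact: ball_itvW.
exists e; first by rewrite eE divr_gt0.
move=> s s' _ _ /H sc /H s'c sE.
have chg : charted i (c - e) (c + e) gamma by apply: charted_subset ch1; rewrite ?lerD2l ?lerN2.
have chg' : charted i (c - e) (c + e) gamma' by apply: charted_subset ch2; rewrite ?lerD2l ?lerN2.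
have [d1 _ s1] := chg; have [d2 _ s2] := chg'.
rewrite -(coordK (d1 _ s'c)) -(coordK (d2 _ s'c)); congr cinv.
apply: (hU (c - e) (c + e) (coord i \o gamma) (coord i \o gamma') s) => //.
- by rewrite lerD2l lerN2.
- by rewrite lerD2l.
- exact: charted_ac.
- exact: charted_ac.
- move=> x xce; have emn : `|x - c| < mn by apply: itv_ball xce _; rewrite eE half_lt.
  have xr : `|x - c| < r3 /\ `|x - c| < r4 by split; exact: lt_le_trans emn _.
  split; apply: ltW; first by apply: h3; case: xr.
  by rewrite E; apply: h4; case: xr.
- by rewrite /= sE.
Qed.

Lemma solution_subset J J' gamma : open J' -> is_interval J' -> J' `<=` J ->
  curve_solution J gamma -> curve_solution J' gamma.
Proof.
move=> oJ' iJ' JJ [_ _ [cg ag] vg]; split => //; first split.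
- by move=> t /JJ; exact: cg.
- by move=> i a b ab; apply: ag; apply: subset_trans JJ.
- by apply: ae_imp vg => t h /JJ.
Qed.

Lemma solution_agree J J' gamma gamma' t0 t : curve_solution J gamma ->
  curve_solution J' gamma' -> J t0 -> J' t0 -> gamma t0 = gamma' t0 ->
  J t -> J' t -> gamma t = gamma' t.
Proof.
move=> sg sg' J0 J'0 E0 Jt J't.
have [oJ iJ _ _] := sg; have [oJ' iJ' _ _] := sg'.
have oI : open (J `&` J') by exact: openI.
have iI : is_interval (J `&` J').
  by move=> x y [Jx J'x] [Jy J'y] z xzy; split; [exact: (iJ x y)|exact: (iJ' x y)].
apply: (@solution_unique (J `&` J') gamma gamma' t0 t) => //.
- by apply: solution_subset sg => // x [].
- by apply: solution_subset sg' => // x [].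
Qed.

Lemma solution_glue J J' gamma gamma' c : curve_solution J gamma ->
  curve_solution J' gamma' -> J c -> J' c -> gamma c = gamma' c ->
  exists g, [/\ curve_solution (J `|` J') g, forall t, J t -> g t = gamma t &
    forall t, J' t -> g t = gamma' t].
Proof.
move=> sg sg' Jc J'c Ec.
have [oJ iJ _ _] := sg; have [oJ' iJ' _ _] := sg'.
pose g t := if t \in J then gamma t else gamma' t.
have gJ t : J t -> g t = gamma t by move=> Jt; rewrite /g mem_set.
have gJ' t : J' t -> g t = gamma' t.
  move=> Jt; rewrite /g; case: ifPn => // /set_mem Jt'.
  exact: solution_agree sg sg' Jc J'c Ec _ _.
exists g; split => //; apply: charted_solution; first exact: openU.
  have H (x y z : R) (A B : set R) : is_interval A -> is_interval B -> A c ->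
      B c -> A x -> B y -> x <= z <= y -> A z \/ B z.
    move=> iA iB Ac Bc Ax By /andP[xz zy]; have [zc|cz] := leP z c.
      by left; apply: (iA x c) => //; rewrite xz zc.
    by right; apply: (iB c y) => //; rewrite zy ltW.
  move=> x y [Jx|Jx] [Jy|Jy] z xzy.
  - by left; exact: (iJ x y).
  - exact: H Jc J'c Jx Jy xzy.
  - by have [|] := H x y z J' J iJ' iJ J'c Jc Jx Jy xzy; [right|left].
  - by right; exact: (iJ' x y).
move=> t [Jt|Jt].
  have [e e0 [eJ ch]] := solution_charted sg Jt (chart_at_cdom _).
  exists (chart_at (gamma t)), e => //.
  by apply: charted_eq ch => s /eJ/gJ.
have [e e0 [eJ ch]] := solution_charted sg' Jt (chart_at_cdom _).
exists (chart_at (gamma' t)), e => //.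
by apply: charted_eq ch => s /eJ/gJ'.
Qed.

Lemma chart_curve_solution i a b (z : R -> 'rV[R]_n) :
  (forall t, cimg i (z t)) ->
  (exists K : R, forall s t, `|z t - z s| <= K * `|t - s|) ->
  solves (affine (f i) w) a b z -> curve_solution `]a, b[%classic (cinv i \o z).
Proof.
move=> iz [K zK] sz; apply: charted_solution.
- exact: interval_open.
- exact: interval_is_interval.
- move=> t; rewrite /= in_itv /= => /andP[at_ tb].
  have E : coord i \o (cinv i \o z) = z by apply/funext => s; rewrite /= cinvK.
  have ch : charted i a b (cinv i \o z).
    split=> [s _||]; last by rewrite E.
      exact: cinv_cdom.
    by exists K => s s' _ _; rewrite /= !cinvK.
  exists i, (Num.min (t - a) (b - t)).
    by rewrite lt_min !subr_gt0 at_.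
  have : Num.min (t - a) (b - t) <= t - a by rewrite ge_min lexx.
  have : Num.min (t - a) (b - t) <= b - t by rewrite ge_min lexx orbT.
  by move=> h1 h2; apply: charted_subset ch; lra.
Qed.

Lemma solutionE J gamma :
  solution X0 X u J gamma <-> curve_solution J gamma /\ J 0.
Proof. by split=> [[]|[[]]]. Qed.

(** [gamma] keeps [xget] from its default, and uniqueness on the common interval makes any other
    witness agree with it. *)
Lemma flow_eq J gamma x t : curve_solution J gamma -> J 0 -> gamma 0 = x ->
  J t -> flow X0 X u t x = gamma t.
Proof.
move=> sg J0 g0 Jt; rewrite /flow; case: xgetP => [y _|/(_ (gamma t))].
  move=> [J' [g [/solutionE[sg' J'0] g'0 J't <-]]].
  by apply: solution_agree sg' sg J'0 J0 _ J't Jt; rewrite g0.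
by case; exists J, gamma; split => //; apply/solutionE.
Qed.

Lemma flow_dom_intro J gamma x t : curve_solution J gamma -> J 0 ->
  gamma 0 = x -> J t -> flow_dom X0 X u x t.
Proof. by move=> sg J0 g0 Jt; exists J, gamma; split => //; apply/solutionE. Qed.

Lemma local_chart_flow i c (x : N) : cdom i x ->
  exists eps del (xi : R -> 'rV[R]_n -> R -> 'rV[R]_n), [/\ 0 < eps, 0 < del &
    forall t0 y, c - eps <= t0 <= c + eps -> `|y - coord i x| < del ->
      [/\ xi t0 y t0 = y, curve_solution `]c - eps, c + eps[%classic
            (cinv i \o xi t0 y),
        forall t, cimg i (xi t0 y t),
        forall t, c - eps <= t <= c + eps ->
          differentiable (fun y' => xi t0 y' t) y &
        forall v, let g t := row_mx (xi t0 y t) ('d (fun y' => xi t0 y' t) y v) in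
          (exists K : R, forall s t, c - eps <= s <= c + eps ->
             c - eps <= t <= c + eps -> `|g t - g s| <= K * `|t - s|) /\
          solves (affine (fun l => lift_field (f i l)) w) (c - eps) (c + eps) g]].
Proof.
move=> ix; have [W W0 wW] := w_bounded c.
have [eps [del [xi [e0 d0 H]]]] := local_flow (@open_cimg _ _ N i)
  (coord_cimg ix) w_measurable wW W0 (@f_smooth i).
exists eps, del, xi; split => // t0 y h1 h2.
have [E D K S [df L]] := H t0 y h1 h2; split => //.
exact: chart_curve_solution.
Qed.

(** The flow is the maximal solution: all solutions from [x] agree on overlaps, and the union of
    their open intervals around 0 is again one. *)
Lemma flow_solution x :
  [/\ curve_solution (flow_dom X0 X u x) (fun t => flow X0 X u t x),
    flow_dom X0 X u x 0 & flow X0 X u 0 x = x].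
Proof.
have [eps [del [xi [e0 d0 H]]]] := local_chart_flow 0 (chart_at_cdom x).
set i := chart_at x in H; have ix : cdom i x := chart_at_cdom x.
have [||E S _ _ _] := H 0 (coord i x).
- by apply/andP; split; lra.
- by rewrite subrr normr0.
have J0 : `]0 - eps, 0 + eps[%classic (0 : R).
  by rewrite /= in_itv /=; apply/andP; split; lra.
have g0 : (cinv i \o xi 0 (coord i x)) 0 = x by rewrite /= E coordK.
have D0 := flow_dom_intro S J0 g0 J0.
split => //; last by rewrite (flow_eq S J0 g0 J0).
apply: charted_solution.
- rewrite openE => t [J [g [/solutionE[sg Jz] gz Jt]]].
  have [oJ _ _ _] := sg.
  apply: filterS (open_nbhs_nbhs (conj oJ Jt)) => s Js.
  exact: flow_dom_intro sg Jz gz Js.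
- move=> a b [Ja [ga [/solutionE[sa a0] za Jaa]]] [Jb [gb [/solutionE[sb b0] zb Jbb]]] t /andP[at_ tb].
  have [_ ia _ _] := sa; have [_ ib _ _] := sb.
  have [t0|/ltW t0] := leP t 0.
    by apply: (flow_dom_intro sa a0 za); apply: (ia a 0) => //; rewrite at_.
  by apply: (flow_dom_intro sb b0 zb); apply: (ib 0 b) => //; rewrite t0.
- move=> c [J [g [/solutionE[sg Jz] gz Jc]]].
  have [e e00 [eJ ch]] := solution_charted sg Jc (chart_at_cdom _).
  exists (chart_at (g c)), e => //.
  by apply: charted_eq ch => s /eJ Js; rewrite (flow_eq sg Jz gz Js).
Qed.

Lemma flow_extend x c J gamma t : flow_dom X0 X u x c -> curve_solution J gamma ->
  J c -> gamma c = flow X0 X u c x -> J t ->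
  flow_dom X0 X u x t /\ flow X0 X u t x = gamma t.
Proof.
move=> Dc sg Jc gc Jt; have [S D0 F0] := flow_solution x.
have [g [sg' gD gJ]] := solution_glue S sg Dc Jc (esym gc).
have Z : (flow_dom X0 X u x `|` J) 0 by left.
have g0 : g 0 = x by rewrite gD.
have Ut : (flow_dom X0 X u x `|` J) t by right.
split; first exact: flow_dom_intro sg' Z g0 Ut.
by rewrite (flow_eq sg' Z g0 Ut) gJ.
Qed.

(* Near time [c], the flow is read in the chart [i] as the local flow of
   [affine (f i) w] started from the time-[s] map. *)
Lemma flow_local x0 c i : flow_dom X0 X u x0 c -> cdom i (flow X0 X u c x0) ->
  exists r (xi : R -> 'rV[R]_n -> R -> 'rV[R]_n), [/\ 0 < r,
    forall s, `|s - c| < r ->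
      flow_dom X0 X u x0 s /\ cdom i (flow X0 X u s x0),
    forall s t, `|s - c| < r -> `|t - c| < r ->
      (\forall x \near x0, flow_dom X0 X u x s) ->
      {for x0, continuous (flow X0 X u s)} ->
      differentiable (fun y => xi s y t) (coord i (flow X0 X u s x0)) /\
      \forall x \near x0, [/\ flow_dom X0 X u x t, cimg i (xi s (coord i (flow X0 X u s x)) t) &
        flow X0 X u t x = cinv i (xi s (coord i (flow X0 X u s x)) t)] &
    forall v, let y := coord i (flow X0 X u c x0) in
      let g t := row_mx (xi c y t) ('d (fun y' => xi c y' t) y v) in
      (exists K : R, forall s t, c - r <= s <= c + r ->
         c - r <= t <= c + r -> `|g t - g s| <= K * `|t - s|) /\
      solves (affine (fun l => lift_field (f i l)) w) (c - r) (c + r) g].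
Proof.
move=> Dc ic; have [S _ _] := flow_solution x0.
have [oD _ [cg _] _] := S.
have [eps [del [xi [e0 d0 H]]]] := local_chart_flow c ic.
have /nbhs_normedP[r1 r10 h1] : nbhs c (flow_dom X0 X u x0) by exact: open_nbhs_nbhs.
have [r2 r20 h2] := continuous_near (cg c Dc) (@open_cdom _ _ N i) ic.
have cc : {for c, continuous (coord i \o (fun t => flow X0 X u t x0))}.
  by apply: continuous_comp; [exact: cg|exact: coord_continuous_at].
have /cont_normP/(_ del d0)[r3 r30 h3] := cc.
pose r := Num.min (Num.min r1 r2) (Num.min r3 eps).
have r0 : 0 < r by rewrite !lt_min r10 r20 r30.
have [q1 q2 q3 q4] : [/\ r <= r1, r <= r2, r <= r3 & r <= eps].
  by rewrite /r !ge_min !lexx !orbT.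
clearbody r.
have itv s : `|s - c| < r -> c - eps < s < c + eps.
  by move=> sr; rewrite -ltr_distl; exact: lt_le_trans q4.
have itv' s : `|s - c| < r -> c - eps <= s <= c + eps.
  by move/itv => /andP[? ?]; apply/andP; split; exact: ltW.
have wide s : c - r <= s <= c + r -> c - eps <= s <= c + eps.
  by rewrite -!ler_distl => sr; exact: le_trans q4.
exists r, xi; split => //.
- by move=> s sr; split; [apply: h1|apply: h2]; exact: lt_le_trans sr _.
- move=> s t sr tr Ds cs.
  have is0 : cdom i (flow X0 X u s x0) by apply: h2; exact: lt_le_trans sr _.
  have near0 : `|coord i (flow X0 X u s x0) - coord i (flow X0 X u c x0)| < del.
    by apply: h3; exact: lt_le_trans sr _.
  have [_ _ _ df _] := H s _ (itv' s sr) near0; split; first exact/df/itv'.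
  have nC : \forall x \near x0, cdom i (flow X0 X u s x).
    exact: (cs _ (open_nbhs_nbhs (conj (@open_cdom _ _ N i) is0))).
  have cis : {for x0, continuous (coord i \o flow X0 X u s)}.
    by apply: continuous_comp => //; exact: coord_continuous_at.
  have nB : \forall x \near x0,
      `|coord i (flow X0 X u s x) - coord i (flow X0 X u c x0)| < del.
    have [q q0 hq] : exists2 q : R, 0 < q & forall y,
        `|y - coord i (flow X0 X u s x0)| < q ->
        `|y - coord i (flow X0 X u c x0)| < del.
      exists (del - `|coord i (flow X0 X u s x0) - coord i (flow X0 X u c x0)|).
        by rewrite subr_gt0.
      move=> y hy; apply: le_lt_trans (ler_dist_split _ (coord i (flow X0 X u s x0)) _) _.
      by rewrite -ltrBrDr.
    have nd : nbhs (coord i (flow X0 X u s x0))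
        [set y | `|y - coord i (flow X0 X u c x0)| < del].
      by apply/nbhs_normedP; exists q.
    exact: (cis _ nd).
  apply: filterS (filterI Ds (filterI nC nB)) => x [Dx [Cx Bx]].
  have [E Sx Ix _ _] := H s _ (itv' s sr) Bx.
  have Is : `]c - eps, c + eps[%classic s by rewrite /= in_itv /=; exact: itv.
  have It : `]c - eps, c + eps[%classic t by rewrite /= in_itv /=; exact: itv.
  have [|Dt ->] := flow_extend Dx Sx Is _ It; last by split.
  by rewrite /= E coordK.
- move=> v y g.
  have near0 : `|y - coord i (flow X0 X u c x0)| < del by rewrite subrr normr0.
  have [|_ _ _ _ /(_ v)[[K hK] hs]] := H c y _ near0.
    by apply: itv'; rewrite subrr normr0.
  split; first by exists K => s t /wide hs' /wide ht; exact: hK.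
  apply: ae_imp hs => t h; rewrite -ltr_distl => tr; apply: h; exact: itv.
Qed.

(** The first half is part of the induction because [flow X0 X u t] has a meaningful value only at
    initial points whose solution lasts until [t]. *)
Let flow_smooth x0 t := (\forall x \near x0, flow_dom X0 X u x t) /\
  mdifferentiable (flow X0 X u t) x0.

(** Near [x0] the time-[t] map factors through the time-[s] map and [xi] inside one chart, so
    differentiability and the formula for the differential are the chain rule. *)
Lemma flow_step x0 s t i (xi : 'rV[R]_n -> 'rV[R]_n) :
  cdom i (flow X0 X u s x0) -> cdom i (flow X0 X u t x0) ->
  mdifferentiable (flow X0 X u s) x0 ->
  differentiable xi (coord i (flow X0 X u s x0)) ->
  (\forall x \near x0, cimg i (xi (coord i (flow X0 X u s x))) /\
     flow X0 X u t x = cinv i (xi (coord i (flow X0 X u s x)))) ->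
  mdifferentiable (flow X0 X u t) x0 /\
  forall v : tangent N x0, tcoord i (mdiff (flow X0 X u t) v) =
    'd xi (coord i (flow X0 X u s x0)) (tcoord i (mdiff (flow X0 X u s) v)).
Proof.
move=> is0 it0 ds dxi E.
have [cs _] := ds; have [ixi fE] := nbhs_singleton E.
have ct : {for x0, continuous (flow X0 X u t)}.
  have cc : {for x0, continuous (cinv i \o (xi \o (coord i \o flow X0 X u s)))}.
    apply: continuous_comp; last exact: cinv_continuous_at.
    apply: continuous_comp; last exact: differentiable_continuous.
    by apply: continuous_comp => //; exact: coord_continuous_at.
  move=> A; rewrite fE => nA; have nc := cc A nA.
  change (\forall x \near x0, A (flow X0 X u t x)).
  by apply: filterS (filterI E nc) => x [[_ ->]].
pose z0 := coord (chart_at x0) x0.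
have G0 : (coord i \o flow X0 X u s \o cinv (chart_at x0)) z0 = coord i (flow X0 X u s x0).
  by rewrite /z0 /= coordK //; exact: chart_at_cdom.
have [dG _] := mdiff_chart 0 ds is0.
have [||dH dHE] := @diff_comp_near _ _ _ _ (coord i \o flow X0 X u s \o cinv (chart_at x0))
  xi (coord i \o flow X0 X u t \o cinv (chart_at x0)) z0 _ dG.
- apply: filterS (near_coord (chart_at_cdom x0) E) => z [h1 h2].
  by rewrite /= h2 cinvK.
- by rewrite G0.
have dt := mdifferentiable_chart ct it0 dH.
split; first exact: dt.
move=> v; have [_ tE] := mdiff_chart v dt it0; have [_ sE] := mdiff_chart v ds is0.
apply: (etrans tE); apply: (etrans (dHE v)).
exact (@diff_eq R _ _ xi _ _ _ _ G0 (esym sE)).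
Qed.

Lemma flow_differentiable x0 t : flow_dom X0 X u x0 t ->
  (\forall x \near x0, flow_dom X0 X u x t) /\
  mdifferentiable (flow X0 X u t) x0.
Proof.
move=> Dt; have [S D0 _] := flow_solution x0; have [_ iD _ _] := S.
apply: (interval_ind (P := flow_smooth x0) iD _ D0 Dt); last first.
  split; first by apply: nearW => x; have [] := flow_solution x.
  have -> : flow X0 X u 0 = id by apply/funext => x; have [] := flow_solution x.
  exact: (mdiff_id x0).1.
move=> c Dc; have ic := chart_at_cdom (flow X0 X u c x0).
have [r [xi [r0 h1 h2 _]]] := flow_local Dc ic.
exists r => // s t' Ds Dt' sr tr [ns ds].
have [dxi E] := h2 s t' sr tr ns ds.1.
split; first by apply: filterS E => x [].
have [_ is0] := h1 s sr; have [_ it0] := h1 t' tr.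
have [|dt _] := flow_step is0 it0 ds dxi _; last exact: dt.
by apply: filterS E => x [].
Qed.

(** With [s = c] in [flow_step], the differential at each nearby time is that of the local flow
    applied to the same vector, the image of [v0] at time [c]; this curve solves the lifted equation
    by [flow_local]. *)
Lemma flow_tangent_charted x0 (v0 : tangent N x0) c i : flow_dom X0 X u x0 c ->
  cdom i (flow X0 X u c x0) ->
  let g t := row_mx (coord i (flow X0 X u t x0))
    (tcoord i (mdiff (flow X0 X u t) v0)) in
  exists2 e : R, 0 < e & [/\ forall t, c - e <= t <= c + e -> cdom i (flow X0 X u t x0),
    exists K : R, forall s t, c - e <= s <= c + e -> c - e <= t <= c + e ->
      `|g t - g s| <= K * `|t - s| &
    solves (affine (fun l => lift_field (f i l)) w) (c - e) (c + e) g].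
Proof.
move=> Dc ic g; have [r [xi [r0 h1 h2 h3]]] := flow_local Dc ic.
have [nc dc] := flow_differentiable Dc.
have cr : `|c - c| < r by rewrite subrr normr0.
pose e := r / 2; have e0 : 0 < e by rewrite divr_gt0.
have er : e = r / 2 by []; clearbody e.
have small t : c - e <= t <= c + e -> `|t - c| < r.
  by rewrite -ler_distl => te; apply: le_lt_trans te _; rewrite er half_lt.
have wide t : c - e <= t <= c + e -> c - r <= t <= c + r.
  by move=> /small; exact: ball_itvW.
pose y := coord i (flow X0 X u c x0).
pose v := tcoord i (mdiff (flow X0 X u c) v0).
have E t : c - e <= t <= c + e ->
    row_mx (xi c y t) ('d (fun y' => xi c y' t) y v) = g t.
  move=> /small tr; have [dxi E] := h2 c t cr tr nc dc.1.
  have [_ it0] := h1 t tr.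
  have [|_ /(_ v0) tE] := flow_step ic it0 dc dxi _.
    by apply: filterS E => x [].
  rewrite /g tE; congr row_mx.
  by have [_ h ->] := nbhs_singleton E; rewrite cinvK.
have [[K hK] hs] := h3 v.
exists e => //; split.
- by move=> t /small /h1[].
- by exists K => s t hs' ht; rewrite -!E //; apply: hK; exact: wide.
- apply: ae_imp hs => t h tab.
  have tab' : c - e <= t <= c + e by move/andP: tab => [? ?]; apply/andP; split; exact: ltW.
  have d : c - r < t < c + r by rewrite -ltr_distl; exact: small.
  rewrite -E //; apply: (is_derive_near _ _ (h d)); last first.
    move=> s /(in_itv_near tab)/andP[? ?]; rewrite E //.
    by apply/andP; split; exact: ltW.
  by move/andP: tab => [? ?]; rewrite lt_min !subr_gt0; apply/andP.
Qed.

End Dynamics.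

(** * The given system and its lift in affine form *)

Section ControlInCharts.
Context {R : realType} {n m : nat}.

(* Index [0] carries the drift. *)
Definition control_weight (u : R -> 'rV[R]_m) (t : R) (j : 'I_m.+1) : R :=
  if unlift ord0 j is Some k then u t 0 k else 1.

Definition chart_fields (N : manifold R n) (X0 : vector_field N)
    (X : 'I_m -> vector_field N) (i : chart N) (j : 'I_m.+1) :=
  local_field i (if unlift ord0 j is Some k then X k else X0).

Lemma local_field_coord (N : manifold R n) (i : chart N) (X : vector_field N) x :
  cdom i x -> local_field i X (coord i x) = tcoord i (X x).
Proof. by move=> ix; rewrite /local_field coordK. Qed.

Lemma control_field_chart (N : manifold R n) (X0 : vector_field N)
    (X : 'I_m -> vector_field N) (u : R -> 'rV[R]_m) (i : chart N) (t : R) x :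
  cdom i x -> tcoord i (control_field X0 X (u t) x) =
  affine (chart_fields X0 X i) (control_weight u) t (coord i x).
Proof.
move=> ix; rewrite /affine big_ord_recl /control_weight /chart_fields.
rewrite unlift_none scale1r local_field_coord //.
rewrite /tcoord /control_field linearD; congr (_ + _).
rewrite linear_sum; apply: eq_bigr => l _.
by rewrite liftK local_field_coord // linearZ.
Qed.

Lemma control_weight_measurable (U : set 'rV[R]_m) (u : R -> 'rV[R]_m) j :
  admissible_control U u -> lebesgue_measurable_fun ((control_weight u)^~ j).
Proof.
move=> [mu _ _]; rewrite /control_weight; case: (unlift ord0 j) => [l|]; first exact: mu.
exact: measurable_cst.
Qed.

Lemma control_weight_bounded (U : set 'rV[R]_m) (u : R -> 'rV[R]_m) (t1 : R) :
  admissible_control U u -> exists2 W : R, 0 <= W &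
    forall t j, `|t - t1| <= 1 -> `|control_weight u t j| <= W.
Proof.
move=> [_ bu _]; have [K hK] := bu (t1 - 1) (t1 + 1).
exists (`|K| + 1); first by rewrite addr_ge0.
move=> t j; rewrite ler_norml => /andP[h1 h2]; rewrite /control_weight.
case: (unlift ord0 j) => [l|]; last by rewrite normr1 lerDr.
apply: le_trans (rV_coord_le _ _) _; apply: (@le_trans _ _ K).
  by apply: hK; apply/andP; split; lra.
by apply: le_trans (ler_norm K) _; rewrite lerDl.
Qed.

End ControlInCharts.

Lemma control_field_lift_chart (R : realType) n m (M : manifold R n)
    (X0 : vector_field M) (X : 'I_m -> vector_field M) (u : R -> 'rV[R]_m)
    (i : chart (tangent_bundle M)) (t : R) (p : tangent_bundle M) :
  cdom i p -> tcoord i (control_field (complete_lift X0)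
    (fun l => complete_lift (X l)) (u t) p) =
  affine (fun j => lift_field (chart_fields X0 X (i : chart M) j))
    (control_weight u) t (coord i p).
Proof.
move=> ip; apply: etrans (control_field_chart _ _ u t ip) _.
apply: eq_bigr => j _; congr (_ *: _); rewrite /chart_fields.
by case: (unlift ord0 j) => [l|];
  apply: etrans (local_field_coord _ ip) _; exact: complete_lift_chart.
Qed.

Theorem theorem3p1 (R : realType) (n m : nat) (M : manifold R n)
  (X0 : vector_field M) (X : 'I_m -> vector_field M)
  (U : set 'rV[R]_m) (controls : set (R -> 'rV[R]_m))
  (admissible : forall u, controls u -> admissible_control U u)
  (u : R -> 'rV[R]_m) (hu : controls u) (x0 : M) (v0 : tangent M x0) :
  let phi := flow X0 X u in
  let J := flow_dom X0 X u x0 in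
  let Gamma : R -> tangent_bundle M :=
    fun t => TPoint (phi t x0) (mdiff (phi t) v0) in
  [/\ forall t, J t ->
        (\forall x \near x0, flow_dom X0 X u x t) /\
        mdifferentiable (phi t) x0,
      solution (complete_lift X0) (fun i => complete_lift (X i)) u J Gamma &
      Gamma 0 = TPoint x0 v0].
Proof.
move=> phi J Gamma.
have au := admissible u hu.
have fs (i : chart M) j : smooth_on (cimg i) (chart_fields X0 X i j).
  exact: local_field_smooth.
have YE (i : chart M) t x := @control_field_chart _ _ _ M X0 X u i t x.
have wm j := control_weight_measurable j au.
have wb t1 := control_weight_bounded t1 au.
have [S D0 _] := flow_solution fs YE wm wb x0.
have [oJ iJ _ _] := S.
split; first by move=> t Jt; exact: flow_differentiable fs YE wm wb _ _ Jt.
  apply/solutionE; split => //.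
  (* On the tangent bundle it only remains to pass from charts back to a solution. In the induced
     chart, [Gamma] is by conversion the curve [g] of [flow_tangent_charted]. *)
  apply: (charted_solution (f := fun (i : chart (tangent_bundle M)) j =>
    lift_field (chart_fields X0 X (i : chart M) j)) (w := control_weight u)) => //.
  - by move=> i t p; exact: control_field_lift_chart.
  - move=> c Jc; exists (chart_at (phi c x0)).
    have [e e0 ch] := flow_tangent_charted fs YE wm wb v0 Jc (chart_at_cdom _).
    by exists e.
rewrite /Gamma; have -> : phi 0 = id.
  by apply/funext => x; have [] := flow_solution fs YE wm wb x.
by rewrite (mdiff_id x0).2.
Qed.
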